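(* Let $n\ge 4$ and let $\Delta=\Delta_d\cup\Delta_e$ be a triangulation of the $n$-gon $G_n$. Let $T_\Delta$ be the labelled tree associated to $\Delta$ and $\mathcal{G}_\Delta$ the plabic graph associated to $\Delta$. Let $\mathbf{w}_{T_\Delta}$ be the weight vector given by the tree degrees $\deg_{T_\Delta}(P_{ij})$ and $\mathbf{w}_{\mathcal{G}_\Delta}$ the weight vector given by the plabic degrees $\deg_{\mathcal{G}_\Delta}(P_{ij})$ ($1\le i<j\le n$). Put $I_{T_\Delta}=\operatorname{in}_{-\mathbf{w}_{T_\Delta}}(I_{2,n})$ and $I_{\mathcal{G}_\Delta}=\operatorname{in}_{\mathbf{w}_{\mathcal{G}_\Delta}}(I_{2,n})$. Then $I_{T_\Delta}=I_{\mathcal{G}_\Delta}$.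
   Context: **Plücker ideal and initial ideals.** $I_{2,n}$ is the ideal of the polynomial ring $\mathbb{C}[P_{ij}\mid 1\le i<j\le n]$ defining the Grassmannian $\operatorname{Gr}(2,n)$ in its Plücker embedding; it is generated by the Plücker relations $P_{ij}P_{kl}-P_{ik}P_{jl}+P_{il}P_{jk}$ for $1\le i<j<k<l\le n$. For a polynomial $f=\sum a_{\mathbf u}x^{\mathbf u}$ in $N$ variables and $\mathbf w\in\mathbb{R}^N$, $\operatorname{in}_{\mathbf w}(f)$ is the sum of those terms $a_{\mathbf u}x^{\mathbf u}$ of $f$ (with $a_{\mathbf u}\neq0$) for which $\langle\mathbf u,\mathbf w\rangle$ is minimal. For an ideal $I$, $\operatorname{in}_{\mathbf w}(I)$ is the ideal generated by all $\operatorname{in}_{\mathbf w}(f)$, $f\in I$. **Triangulations.** $G_n$ is the convex $n$-gon with vertices labelled $1,\dots,n$ counterclockwise; $(a,b)$ denotes the edge or diagonal connecting $a$ and $b$. A triangulation is $\Delta=\Delta_d\cup\Delta_e$, where $\Delta_d$ is its set of $n-3$ diagonals and $\Delta_e=\{(1,2),\dots,(n-1,n),(n,1)\}$. **Labelled tree $T_\Delta$ and tree degree.** Draw an (inner) vertex for every triangle of $\Delta$; connect the vertices of two adjacent triangles by an edge; for every boundary edge $(i,i+1)$ (indices mod $n$) draw a leaf labelled $i+1$ and connect it to the vertex of the unique triangle having $(i,i+1)$ as a side. This gives a trivalent tree with leaves $1,\dots,n$. The tree degree $\deg_{T_\Delta}(P_{ij})$ is the number of internal edges (edges connecting two trivalent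 vertices) on the path between the leaves $i$ and $j$. **Plabic graph $\mathcal{G}_\Delta$.** (i) Put a black vertex in the interior of each triangle of $\Delta$ and connect it to the three vertices of that triangle. (ii) Color the vertices of $G_n$ incident to a diagonal of $\Delta$ white and the remaining vertices of $G_n$ black. (iii) Erase the edges of $\Delta$ (sides and diagonals), and contract every pair of adjacent vertices of the same color. (iv) Add one ray from each of the vertices $1,\dots,n$ outward to a boundary vertex, labelled by the same number, on the boundary of a surrounding disk, so that the rays do not intersect. The result $\mathcal{G}_\Delta$ is a planar bicolored graph in a disk whose boundary vertices $1,\dots,n$ (counterclockwise, uncolored) are each joined to one internal vertex. **Plabic degree.** A face of $\mathcal{G}_\Delta$ is internal if it does not meet the boundary of the disk. A perfect orientation is an orientation of the edges such that every internal white vertex has exactly one incoming arrow and every internal black vertex has exactly one outgoing arrow; its source set is the set of boundary vertices that are sources. Fix a perfect orientation $\mathcal O$ of $\mathcal{G}_\Delta$ with source set $I_{\mathcal O}=\{1,2\}$. A directed path from a source boundary vertex to a sink boundary vertex divides the disk into two parts; its degree is the number of internal faces to the left of the path. For a 2-element subset $J$ of $\{1,\dots,n\}$, a $J$-flow is a collection of self-avoiding, vertex-disjoint directed paths with sources $I_{\mathcal O}\setminus(J\cap I_{\mathcal O})$ and sinks $J\setminus(J\cap I_{\mathcal O})$; its degree is the sum of the degrees of its paths (0 for the empty flow). The plabic degree $\deg_{\mathcal{G}_\Delta}(P_J)$ is the minimum of the degrees of all $J$-flows. *)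

(* Defs.v *)
From HB Require Import structures.
From mathcomp Require Import all_boot all_order all_algebra.
From mathcomp Require Import reals complex mpoly.

Set Implicit Arguments.
Unset Strict Implicit.
Unset Printing Implicit Defensive.

(** Throughout, [i : 'I_n] stands for the label [i.+1] of {1, ..., n}; the
    counterclockwise successor of a vertex of the n-gon is [ordS i]. *)

(** * Triangulations of the n-gon *)

Definition is_side n (e : {set 'I_n}) : bool := [exists i, e == [set i; ordS i]].

Definition is_diagonal n (e : {set 'I_n}) : bool := (#|e| == 2) && ~~ is_side e.

Definition crossing n (e f : {set 'I_n}) : Prop :=
  exists a b c d : 'I_n,
    [/\ a < b, b < c, c < d, e = [set a; c] & f = [set b; d]].

(** A triangulation is given by its set of diagonals. *)
Definition triangulation n (Dd : {set {set 'I_n}}) : Prop :=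
  [/\ {in Dd, forall e, is_diagonal e},
      {in Dd &, forall e f, ~ crossing e f}
    & #|Dd| = n - 3].

Section Triangulation.
Variables (n : nat) (Dd : {set {set 'I_n}}).

(** Since the n-gon is convex and [Dd] is non-crossing, three vertices pairwise
    joined in the triangulation span a triangle of it. *)
Definition is_triangle (t : {set 'I_n}) : bool :=
  (#|t| == 3) &&
  [forall a in t, forall b in t,
     (a != b) ==> (([set a; b] \in Dd) || is_side [set a; b])].

(** * The labelled tree *)

Definition tree_vertex := ('I_n + {set 'I_n})%type.
Definition leaf (i : 'I_n) : tree_vertex := inl i.
Definition is_inner (x : tree_vertex) : bool := if x is inr _ then true else false.

Definition leaf_adj (j : 'I_n) (t : {set 'I_n}) : bool :=
  is_triangle t && [exists i, (j == ordS i) && ([set i; ordS i] \subset t)].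

Definition tree_adj : rel tree_vertex := fun x y =>
  match x, y with
  | inl j, inr t | inr t, inl j => leaf_adj j t
  | inr t, inr t' => [&& is_triangle t, is_triangle t' & #|t :&: t'| == 2]
  | inl _, inl _ => false
  end.

Definition is_tree_path (i j : 'I_n) (p : seq tree_vertex) : bool :=
  [&& path tree_adj (leaf i) p, last (leaf i) p == leaf j & uniq (leaf i :: p)].

Definition internal_edges (x : tree_vertex) (p : seq tree_vertex) : nat :=
  count (fun e => is_inner e.1 && is_inner e.2) (zip (x :: p) p).

(** The simple path between two leaves is unique, so [pick] makes no choice. *)
Definition tree_degree (i j : 'I_n) : nat :=
  if [pick p : #|{: tree_vertex}|.-bseq tree_vertex | is_tree_path i j p]
    is Some p then internal_edges (leaf i) p else 0.

End Triangulation.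

(** * Bicolored graphs embedded in a disk *)

Definition color := option bool.
Definition white : color := Some true.
Definition black : color := Some false.
Definition uncolored : color := None.

(** [D] contains the oriented edges ("darts"), only those in [darts] being
    present; [opp] reverses a dart. The embedding is recorded by [face_next]:
    [face_next d] follows [d] on the counterclockwise boundary walk of the face
    lying to the left of [d]. When that walk reaches the i-th boundary vertex it
    continues along the boundary circle to the next boundary vertex and then
    inwards; the circular arc itself is not a dart. [ray i] is the edge at the
    i-th boundary vertex, directed inwards. *)
Record disk_graph (n : nat) (V D : finType) := DiskGraph {
  darts : {set D};
  opp : D -> D;
  tail : D -> V;
  vcolor : V -> color;
  face_next : D -> D;
  ray : 'I_n -> D
}.

Section DiskGraph.
Variables (n : nat) (V D : finType) (G : disk_graph n V D).

Definition head_of (d : D) : V := tail G (opp G d).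

(** ** Contraction of all edges joining vertices of the same color *)

Definition monochromatic (d : D) : bool :=
  vcolor G (tail G d) == vcolor G (head_of d).

Definition mono_adj : rel V := fun x y =>
  [exists d in darts G, [&& tail G d == x, head_of d == y & monochromatic d]].

Definition first_return (f : D -> D) (P : pred D) (d : D) : D :=
  head d (filter P (traject f (f d) #|D|)).

(** A contracted vertex is named by the canonical representative of the vertices
    merged into it; the darts of a contracted edge are dropped from the boundary
    walks of the faces. *)
Definition contract : disk_graph n V D := {|
  darts := [set d in darts G | ~~ monochromatic d];
  opp := opp G;
  tail := fun d => fingraph.root mono_adj (tail G d);
  vcolor := vcolor G;
  face_next := first_return (face_next G) (fun d => ~~ monochromatic d);
  ray := ray G
|}.

(** ** Faces *)

Definition face_of (d : D) : {set D} := [set e | fconnect (face_next G) d e].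

Definition faces : {set {set D}} := [set face_of d | d in darts G].

Definition internal_face (F : {set D}) : bool :=
  [forall i, (ray G i \notin F) && (opp G (ray G i) \notin F)].

(** ** Perfect orientations: [O] is the set of the darts chosen as arrows *)

Definition vertices : {set V} := [set tail G d | d in darts G].

Definition perfect_orientation (O : {set D}) : Prop :=
  [/\ O \subset darts G,
      {in darts G, forall d, (d \in O) (+) (opp G d \in O)},
      {in vertices, forall v, vcolor G v = white ->
         #|[set d in O | head_of d == v]| = 1}
    & {in vertices, forall v, vcolor G v = black ->
         #|[set d in O | tail G d == v]| = 1}].

Definition source_set (O : {set D}) : {set 'I_n} := [set i | ray G i \in O].

(** ** Directed paths, as sequences of darts *)

Definition path_vertices (p : seq D) : seq V :=
  if p is d :: _ then tail G d :: map head_of p else [::].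

Definition is_dpath (O : {set D}) (s t : 'I_n) (p : seq D) : bool :=
  if p is d :: q then
    [&& all (mem O) p, d == ray G s, last d q == opp G (ray G t),
        path (fun x y => head_of x == tail G y) d q & uniq (path_vertices p)]
  else false.

(** Moves from a dart to a dart of the same face, or across an edge which is not
    on the path [p]. Starting from the darts of [p], these reach exactly the faces
    in the part of the disk to the left of [p]. *)
Definition left_move (p : seq D) : rel D := fun x y =>
  (y == face_next G x) || [&& y == opp G x, x \notin p & opp G x \notin p].

Definition left_of (p : seq D) (F : {set D}) : bool :=
  has (fun d => [exists e in F, connect (left_move p) d e]) p.

Definition path_degree (p : seq D) : nat :=
  #|[set F in faces | internal_face F && left_of p F]|.

(** ** Flows: a path visits no dart twice, hence the bound on its length *)

Definition dpath := #|D|.-bseq D.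

Definition is_flow (O : {set D}) (J : {set 'I_n}) (F : {set dpath}) : bool :=
  let S := source_set O :\: J in
  let T := J :\: source_set O in
  [&& [forall p in F, [exists s in S, [exists t in T, is_dpath O s t p]]],
      [forall s in S, [exists p in F, [exists t in T, is_dpath O s t p]]],
      [forall t in T, [exists p in F, [exists s in S, is_dpath O s t p]]]
    & [forall p in F, forall q in F, (p != q) ==>
         ~~ has (mem (path_vertices p)) (path_vertices q)]].

Definition flow_degree (F : {set dpath}) : nat := \sum_(p in F) path_degree p.

(** The value 0 is only a default for the case where there is no J-flow. *)
Definition plabic_degree (O : {set D}) (J : {set 'I_n}) : nat :=
  if [pick F | is_flow O J F] is Some F0 then
    flow_degree [arg min_(F < F0 | is_flow O J F) flow_degree F]
  else 0.

End DiskGraph.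

(** * The plabic graph of a triangulation *)

Section PlabicGraph.
Variables (n : nat) (Dd : {set {set 'I_n}}).

Definition pre_vertex := ('I_n + 'I_n + {set 'I_n})%type.
Definition boundary_vertex (i : 'I_n) : pre_vertex := inl (inl i).
Definition polygon_vertex (i : 'I_n) : pre_vertex := inl (inr i).
Definition center (t : {set 'I_n}) : pre_vertex := inr t.

Definition pre_dart := (pre_vertex * pre_vertex)%type.

Definition pre_adj : rel pre_vertex := fun x y =>
  match x, y with
  | inl (inl i), inl (inr j) | inl (inr j), inl (inl i) => i == j
  | inl (inr v), inr t | inr t, inl (inr v) => is_triangle Dd t && (v \in t)
  | _, _ => false
  end.

Definition pre_color (x : pre_vertex) : color :=
  match x with
  | inl (inl _) => uncolored
  | inl (inr v) => if [exists e in Dd, v \in e] then white else black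
  | inr _ => black
  end.

Definition pre_ray (i : 'I_n) : pre_dart := (boundary_vertex i, polygon_vertex i).

Definition pre_opp (d : pre_dart) : pre_dart := (d.2, d.1).

(** [enum t] lists the vertices of a triangle [t] in counterclockwise order. *)
Definition ccw_in (t : {set 'I_n}) (v : 'I_n) : 'I_n := next (enum t) v.
Definition cw_in (t : {set 'I_n}) (v : 'I_n) : 'I_n := prev (enum t) v.

(** Around the polygon vertex [v], clockwise after the segment from [v] to [x]:
    the edge to the center of the triangle [v, cw_in t v = x, ccw_in t v], or the
    ray if there is no triangle on that side. *)
Definition cw_after (v x : 'I_n) : pre_dart :=
  if [pick t | [&& is_triangle Dd t, v \in t & cw_in t v == x]] is Some t
  then (polygon_vertex v, center t)
  else (polygon_vertex v, boundary_vertex v).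

(** The dart which follows [d] clockwise around the tail of [d]. *)
Definition cw_next (d : pre_dart) : pre_dart :=
  match d with
  | (inr t, inl (inr v)) => (center t, polygon_vertex (cw_in t v))
  | (inl (inr v), inr t) => cw_after v (ccw_in t v)
  | (inl (inr v), inl (inl _)) => cw_after v (ord_pred v)
  | _ => d
  end.

Definition pre_face_next (d : pre_dart) : pre_dart :=
  if d.2 is inl (inl i) then pre_ray (ordS i) else cw_next (pre_opp d).

(** The sides and diagonals are already erased, and the rays already drawn. *)
Definition pre_plabic_graph : disk_graph n pre_vertex pre_dart := {|
  darts := [set d | pre_adj d.1 d.2];
  opp := pre_opp;
  tail := fun d => d.1;
  vcolor := pre_color;
  face_next := pre_face_next;
  ray := pre_ray
|}.

Definition plabic_graph : disk_graph n pre_vertex pre_dart :=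
  contract pre_plabic_graph.

End PlabicGraph.

(** * Ideals, initial ideals and the Plücker ideal *)

Import GRing.Theory Num.Theory.
Local Open Scope ring_scope.

Definition ideal_generated (A : comNzRingType) (S : A -> Prop) (x : A) : Prop :=
  exists s : seq (A * A),
    (forall u, u \in s -> S u.2) /\ x = \sum_(u <- s) u.1 * u.2.

Section Initial.
Variables (R : realType) (N : nat).
Implicit Type w : 'I_N -> R.

Definition mweight w (m : 'X_{1..N}) : R := \sum_(k < N) (m k)%:R * w k.

Definition initial_form w (f : {mpoly R[i][N]}) : {mpoly R[i][N]} :=
  \sum_(m <- msupp f | all (fun m' => mweight w m <= mweight w m') (msupp f))
     f@_m *: 'X_[m].

Definition initial_ideal w (I : {mpoly R[i][N]} -> Prop) :
    {mpoly R[i][N]} -> Prop :=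
  ideal_generated (fun g => exists2 f, I f & g = initial_form w f).

End Initial.

(** The Plücker coordinates P_ij, i < j, are numbered by ['I_(nplucker n)]. *)
Definition plucker_index (n : nat) := {p : 'I_n * 'I_n | (p.1 < p.2)%N}.
Definition nplucker (n : nat) : nat := #|{: plucker_index n}|.

Definition plucker_ring (R : realType) (n : nat) := {mpoly R[i][nplucker n]}.

(** Only meaningful for [i < j]. *)
Definition plucker (R : realType) n (i j : 'I_n) : plucker_ring R n :=
  if insub (i, j) is Some p then 'X_(enum_rank (p : plucker_index n)) else 0.

Definition plucker_relation (R : realType) n (f : plucker_ring R n) : Prop :=
  exists i j k l : 'I_n, [/\ (i < j)%N, (j < k)%N, (k < l)%N &
    f = plucker R i j * plucker R k l - plucker R i k * plucker R j l
        + plucker R i l * plucker R j k].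

Definition plucker_ideal (R : realType) n : plucker_ring R n -> Prop :=
  ideal_generated (@plucker_relation R n).

(** * The two weight vectors *)

Definition tree_weight (R : realType) n (Dd : {set {set 'I_n}})
    (k : 'I_(nplucker n)) : R :=
  let p := val (enum_val k : plucker_index n) in (tree_degree Dd p.1 p.2)%:R.

Definition plabic_weight (R : realType) n (Dd : {set {set 'I_n}})
    (O : {set pre_dart n}) (k : 'I_(nplucker n)) : R :=
  let p := val (enum_val k : plucker_index n) in
  (plabic_degree (plabic_graph Dd) O [set p.1; p.2])%:R.

(* Main.v *)
Require Import Defs.
From mathcomp Require Import all_boot all_order all_algebra.
From mathcomp Require Import reals complex mpoly.
From HB Require Import structures.
From mathcomp Require Import zify ring lra.
Import Defs.

Set Implicit Arguments.
Unset Strict Implicit.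
Unset Printing Implicit Defensive.

(** The Plücker ideal is homogeneous for every grading in which the coordinate
    of a pair {i, j} has degree B i + B j.  Adding such a degree to a weight
    vector, or multiplying the weight vector by a positive constant, does not
    change the initial form of a homogeneous polynomial, and therefore does not
    change the initial ideal ([initial_ideal_affine]).  So it suffices to find a
    B such that twice the plabic degree of {i, j} is B i + B j minus the tree
    degree ([degrees_relation]).

    Both degrees are sums over the diagonals.  Read the vertices of the polygon
    in the cyclic order that starts at the second source of the orientation and
    stops at the first one.  In this order a diagonal is a pair a < b, every
    triangle has a middle vertex, its apex, and every vertex which is not a
    source is the apex of exactly one triangle.

    The edge of the tree which crosses the diagonal (a, b) separates the leaves
    in ]a, b] from the other leaves, and a simple path crosses it at most once.
    The tree degree of i and j is therefore the number of diagonals for which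
    exactly one of i and j is in ]a, b] ([tree_degreeE]).

    After contraction, the plabic graph has one black vertex for each triangle,
    one white vertex for each end of a diagonal, and one internal face for each
    diagonal.  In a perfect orientation every triangle points to one of its
    vertices; distinct triangles point to distinct vertices, none of which is a
    source.  Starting from the triangle on the edge that joins the sources, this
    forces every triangle to point to its apex ([orientedE]).  A directed path is
    then a chain of polygon vertices in which each vertex is the apex of a
    triangle that contains the vertex before it ([extract]).  The face of (a, b)
    is to the left of a chain if and only if the last vertex of the chain which
    is not strictly between a and b is at or before a ([path_degree_chain]).

    Fix the end points x and y of two disjoint chains from the two sources.  The
    number of these chains that have the face of (a, b) to their left is at
    least [x <= a] + [y <= a] + [x and y are in ]a, b]]: in the last case one of
    the chains avoids b, so that it gets behind the diagonal through a
    ([min_left_le]).  One pair of disjoint chains attains these bounds for all the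
    diagonals at once ([min_left_attained]), so the plabic degree is the sum of
    the bounds, up to the n - 3 faces that are to the left of the chain reduced
    to the second source ([plabic_degreeE]).  Finally, for u and v in {0, 1}, the
    sum of 2 u v and of [u <> v] is u + v; this turns twice the plabic degree plus
    the tree degree into a contribution of i plus a contribution of j. *)

(** * Noncrossing chords of an interval *)

Section Chords.
Variables (I : finType) (D : {set I}) (lo hi : I -> nat) (n : nat).
Hypothesis bounds : {in D, forall e, [&& 0 < lo e, hi e <= n & (lo e).+1 < hi e]}.
Hypothesis not_root : {in D, forall e, ~ (lo e = 1 /\ hi e = n)}.
Hypothesis noncrossing : {in D &, forall e f, ~~ [&& lo e < lo f, lo f < hi e & hi e < hi f]}.
Hypothesis ends_inj : {in D &, forall e f, lo e = lo f -> hi e = hi f -> e = f}.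

Definition chord x y := [exists e in D, (lo e == x) && (hi e == y)].

Definition inside x y := [set e in D | (x <= lo e) && (hi e <= y)].

Definition strictly_inside x y :=
  [set e in inside x y | ~~ ((lo e == x) && (hi e == y))].

Lemma card_inside x y : #|inside x y| = #|strictly_inside x y| + chord x y.
Proof.
have [/exists_inP[e eD /andP[/eqP ex /eqP ey]]|/exists_inPn nch] := boolP (chord x y).
  rewrite (cardsD1 e) inE eD ex ey !leqnn addnC; congr (#|pred_of_set _| + _).
  apply/setP => f; rewrite !inE andbC; case fD: (f \in D) => //=.
  congr (_ && ~~ _); apply/eqP/andP => [->|[/eqP fx /eqP fy]]; first by rewrite ex ey.
  by apply: ends_inj => //; rewrite ?ex ?ey.
rewrite addn0; apply: eq_card => f; rewrite !inE; case fD: (f \in D) => //=.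
by rewrite nch ?andbT.
Qed.

Lemma inside_side x y : y <= x.+1 -> #|inside x y| = 0.
Proof.
move=> yx; apply: eq_card0 => e; rewrite !inE; apply: contraTF yx.
by move=> /and3P[/bounds]; lia.
Qed.

(** Choosing the last chord at [x] makes the chords between [x] and [y] split at [c]:
    one that has [c] strictly inside either starts at [x], against the choice of
    [c], or crosses the chord from [x] to [c]. *)
Lemma last_chord x y : x.+1 < y -> exists c, [/\ x < c < y, (c == x.+1) || chord x c
  & forall c', c < c' < y -> ~~ chord x c'].
Proof.
move=> xy; pose P c := (x < c < y) && ((c == x.+1) || chord x c).
have exP : exists c, P c by exists x.+1; rewrite /P eqxx ltnSn xy.
have ubP c : P c -> c <= y by case/andP; lia.
case: (ex_maxnP exP ubP) => c /andP[cxy cE] cmax; exists c; split=> // c' cc'.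
apply/negP => c'E; have := cmax c'; rewrite /P c'E orbT andbT; lia.
Qed.

Lemma strictly_inside_split x y c : (c == x.+1) || chord x c ->
  (forall c', c < c' < y -> ~~ chord x c') ->
  #|strictly_inside x y| <= #|inside x c| + #|inside c y|.
Proof.
move=> xc cmax; apply: leq_trans (leq_card_setU _ _); apply/subset_leq_card/subsetP => e.
rewrite !inE => /andP[/and3P[eD xe ey] nxy]; rewrite eD xe ey /= andbT.
have [//|ce /=] := leqP (hi e) c; have [//|ec] := leqP c (lo e).
have [ex|xe'] := eqVneq (lo e) x.
  have [/eqP exy|ny] := eqVneq (hi e) y; first by rewrite ex exy eqxx in nxy.
  have /negP[] := cmax (hi e) ltac:(lia).
  by apply/exists_inP; exists e; rewrite // ex !eqxx.
case/orP: xc => [/eqP|/exists_inP[f fD /andP[/eqP fx /eqP fc]]]; first lia.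
by have := noncrossing fD eD; rewrite fx fc; lia.
Qed.

(** The usual count of the diagonals of a polygon with [y - x + 1] vertices. *)
Lemma strictly_inside_le x y : x.+1 < y -> #|strictly_inside x y| <= y - x - 2.
Proof.
have [k] := ubnP (y - x); elim: k x y => // k IH x y yx xy.
have [c [cxy cE cmax]] := last_chord xy.
apply: leq_trans (strictly_inside_split cE cmax) _.
have bd u v : u < v -> v - u < k -> #|inside u v| <= v - u - 1.
  move=> uv vk; have [v1|v2] := leqP v u.+1; first by rewrite inside_side.
  rewrite card_inside; have := IH u v vk v2; case: chord; lia.
by have := bd x c ltac:(lia) ltac:(lia); have := bd c y ltac:(lia) ltac:(lia); lia.
Qed.

Lemma inside_le x y : x < y -> #|inside x y| <= y - x - 1.
Proof.
move=> xy; have [y1|y2] := leqP y x.+1; first by rewrite inside_side.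
rewrite card_inside; have := strictly_inside_le y2; case: chord; lia.
Qed.

(** Equality in [strictly_inside_le] means that the chords between [x] and [y]
    triangulate the polygon with vertices [x], ..., [y]. *)
Definition tight x y := (y <= x.+1) || (#|strictly_inside x y| == y - x - 2).

(** The chord from [1] to [n] is a side of the polygon, as are the steps [x], [x.+1]. *)
Definition edge_nat x y := [|| y == x.+1, (x == 1) && (y == n) | chord x y].

(** Equality in the sum of the two bounds forces equality in both of them, and it
    forces the chord from [c] to [y] to be present. *)
Lemma tight_split x y : x.+1 < y -> tight x y ->
  exists c, [/\ x < c < y, (c == x.+1) || chord x c, (y == c.+1) || chord c y,
    tight x c & tight c y].
Proof.
move=> xy /orP[|/eqP t]; first lia.
have [c [cxy cE cmax]] := last_chord xy; have /andP[xc cy] := cxy.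
have split_le := strictly_inside_split cE cmax.
have xc_le := inside_le xc; have cy_le := inside_le cy.
exists c; split=> //.
- have [//|yc] := eqVneq y c.+1; have cy2 : c.+1 < y by lia.
  have := strictly_inside_le cy2; move: cy_le split_le; rewrite [#|inside c y|]card_inside.
  by case: chord => //=; lia.
- have [xx|xc2] := leqP c x.+1; first by rewrite /tight xx.
  have := strictly_inside_le xc2; move: xc_le split_le.
  rewrite /tight [#|inside x c|]card_inside.
  by case: chord => /=; lia.
- have [xx|cy2] := leqP y c.+1; first by rewrite /tight xx.
  have := strictly_inside_le cy2; move: cy_le split_le.
  rewrite /tight [#|inside c y|]card_inside.
  by case: chord => /=; lia.
Qed.

Lemma edge_nat_noncrossing a b c d : edge_nat a c -> edge_nat b d ->
  0 < a -> d <= n -> ~~ [&& a < b, b < c & c < d].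
Proof.
move=> ac bd a0 dn; apply/negP => /and3P[ab bc cd].
case/or3P: ac => [||/exists_inP[e eD /andP[/eqP ea /eqP ec]]]; [lia|lia|].
case/or3P: bd => [||/exists_inP[f fD /andP[/eqP fb /eqP fd]]]; [lia|lia|].
by have := noncrossing eD fD; rewrite ea ec fb fd ab bc cd.
Qed.

Hypothesis many : n <= #|D| + 3.

(** Tightness goes down from the whole polygon along [tight_split] until the interval
    is that from [a] to [b], because a chord cannot cross the two edges at the splitting
    point. *)
Lemma tight_chord a b : chord a b -> tight a b.
Proof.
move=> ab; have /exists_inP[e eD /andP[/eqP ea /eqP eb]] := ab.
have tight_root : tight 1 n.
  have [n3|n4] := leqP n 2; first by rewrite /tight; lia.
  apply/orP; right; rewrite eqn_leq strictly_inside_le //=.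
  rewrite (_ : strictly_inside 1 n = D); first lia.
  apply/setP => f; rewrite !inE; case fD: (f \in D) => //=.
  have := bounds fD; have := not_root fD; lia.
suff st k x y : y - x < k -> x <= a -> b <= y -> 0 < x -> y <= n ->
    edge_nat x y -> tight x y -> tight a b.
  have := bounds eD => e0; apply: (st n.+1 1 n) => //; rewrite ?ea ?eb; try lia.
  by rewrite /edge_nat !eqxx orbT.
elim: k x y => // k IH x y yk xa yb x0 yn xyE xyt.
have [xya|nxy] := eqVneq (a, b) (x, y); first by case: xya => -> ->.
have := bounds eD => e0.
have [c [cxy xc cy t1 t2]] := @tight_split x y ltac:(lia) xyt.
have abE : edge_nat a b by rewrite /edge_nat ab !orbT.
have xcE : edge_nat x c by rewrite /edge_nat; case/orP: xc => -> //; rewrite !orbT.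
have cyE : edge_nat c y by rewrite /edge_nat; case/orP: cy => -> //; rewrite !orbT.
have /andP[lxc lcy] := cxy.
have [bc|cb] := leqP b c; first by apply: (IH x c) => //; clear -yk lxc lcy yn; lia.
have [ca|ac] := leqP c a.
  by apply: (IH c y) => //; clear -yk lxc lcy x0; lia.
have := edge_nat_noncrossing xcE abE x0 (leq_trans yb yn).
have := edge_nat_noncrossing abE cyE (leq_trans x0 xa) yn.
rewrite ac cb /= !andbT -!leqNgt => yb' ax.
by case/eqP: nxy; congr (_, _); apply/eqP; rewrite eqn_leq ?ax ?xa ?yb ?yb'.
Qed.

(** In a maximal set of noncrossing chords every chord is the base of a triangle. *)
Lemma edge_nat_split a b : edge_nat a b -> a.+1 < b ->
  exists c, [/\ a < c < b, edge_nat a c & edge_nat c b].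
Proof.
move=> ab lab; suff /(tight_split lab)[c [cab ac cb _ _]] : tight a b.
  by exists c; split => //; rewrite /edge_nat; [case/orP: ac|case/orP: cb] => -> //; rewrite !orbT.
case/or3P: ab => [|/andP[/eqP a1 /eqP bn]|]; [lia| |exact: tight_chord].
subst a b.
apply/orP; right; rewrite eqn_leq strictly_inside_le //=.
rewrite (_ : strictly_inside 1 n = D); first lia.
apply/setP => f; rewrite !inE; case fD: (f \in D) => //=.
have := bounds fD; have := not_root fD; lia.
Qed.

End Chords.

(** * Finite sets, cycles and first returns *)

Lemma set2_inj (T : finType) (u v x y : T) : [set u; v] = [set x; y] ->
  (u = x /\ v = y) \/ (u = y /\ v = x).
Proof.
move=> e; have : u \in [set x; y] by rewrite -e set21.
have : v \in [set x; y] by rewrite -e set22.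
have : x \in [set u; v] by rewrite e set21.
have : y \in [set u; v] by rewrite e set22.
by rewrite !inE; do 4 case/orP => /eqP ?; subst; auto.
Qed.

Lemma enum_set3 n (x y z : 'I_n) : x < y -> y < z -> enum [set x; y; z] = [:: x; y; z].
Proof.
move=> xy yz; apply: (@irr_sorted_eq _ (relpre val ltn)).
- by move=> a b c; apply: ltn_trans.
- by move=> a; apply: ltnn.
- rewrite /enum_mem -enumT; apply: sorted_filter; first by move=> a b c; apply: ltn_trans.
  by rewrite -sorted_map val_enum_ord iota_ltn_sorted.
- by rewrite /= xy yz.
- by move=> a; rewrite mem_enum !inE orbA.
Qed.

Section FirstReturn.
Variables (D : finType) (g : D -> D) (P : pred D).

(** [first_return] searches only the first [#|D|] iterates, whence the bound on [k]. *)
Lemma first_return_iter d k : 0 < k <= #|D| -> P (iter k g d) ->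
  exists j, [/\ 0 < j <= k, first_return g P d = iter j g d & P (iter j g d)].
Proof.
case: k => // k /= kD Pk; rewrite /first_return.
set s := traject g (g d) #|D|.
have nthE i : i < #|D| -> nth d s i = iter i.+1 g d.
  by move=> iD; rewrite (set_nth_default (g d)) ?size_traject // nth_traject // iterSr.
have hasP' : has P s.
  by apply/hasP; exists (iter k.+1 g d) => //; rewrite -nthE // mem_nth // size_traject.
have fk : find P s <= k.
  by rewrite leqNgt; apply/negP => /(before_find d); rewrite nthE // /= Pk.
have fD : find P s < #|D| by apply: leq_ltn_trans kD.
exists (find P s).+1; rewrite -(nthE _ fD); split; [exact: fk| |exact: nth_find].
elim: s hasP' {nthE fk fD} => //= x s IH; case: ifP => //= Px; exact: IH.
Qed.

Lemma first_return_mem d : P d -> P (first_return g P d).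
Proof.
move=> Pd; rewrite /first_return; case E: (filter _ _) => [//|x s] /=.
have : x \in filter P (traject g (g d) #|D|) by rewrite E mem_head.
by rewrite mem_filter => /andP[].
Qed.

Lemma first_return_orbit d : exists k, first_return g P d = iter k g d.
Proof.
rewrite /first_return; case E: (filter _ _) => [|x s] /=; first by exists 0.
have : x \in filter P (traject g (g d) #|D|) by rewrite E mem_head.
rewrite mem_filter => /andP[_ /trajectP[i _ ->]]; exists i.+1; by rewrite iterSr.
Qed.

Lemma first_return_connect d k : k <= #|D| -> P (iter k g d) ->
  fconnect (first_return g P) d (iter k g d).
Proof.
elim/ltn_ind: k d => k IH d kD Pk; have [->|k0] := posnP k; first exact: connect0.
have k1 : 0 < k <= #|D| by rewrite k0.
have [j [/andP[j0 jk] fj _]] := first_return_iter k1 Pk.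
apply: connect_trans (fconnect1 _ _) _; rewrite fj -(subnK jk) iterD.
apply: IH; first lia; first by apply: leq_trans kD; exact: leq_subr.
by rewrite -iterD subnK.
Qed.

End FirstReturn.

(** * Positions of the vertices *)

Section Positions.
Variables (n : nat).

(** The cyclic order of the polygon, cut between the vertices [0] and [1].  These
    are the sources of the orientation, and they become the last and the first
    vertex; the edge which joins them is the one from position [1] to position [n]. *)
Definition pos (v : 'I_n) : nat := if v == 0 :> nat then n else v.

Lemma pos_gt0 v : 0 < pos v.
Proof. by have := ltn_ord v; rewrite /pos; case: eqP; lia. Qed.

Lemma pos_le v : pos v <= n.
Proof. by have := ltn_ord v; rewrite /pos; case: eqP; lia. Qed.

Lemma pos_inj : injective pos.
Proof.
move=> u v; rewrite /pos => uv; apply/val_inj/eqP.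
by move: uv; have := ltn_ord u; have := ltn_ord v; do 2 case: eqP => /=; lia.
Qed.

Lemma pos_nz u v : pos u < pos v -> u != 0 :> nat.
Proof. by have := pos_le v; rewrite {2}/pos; case: (u =P 0 :> nat); lia. Qed.

Lemma pos_lt u v : pos u < pos v -> v = 0 :> nat \/ u < v.
Proof. by move=> uv; have := pos_nz uv; move: uv; rewrite /pos; do 2 case: eqP; lia. Qed.

Lemma pos_eq u v : (pos u == pos v) = (u == v).
Proof. by apply/eqP/eqP => [/pos_inj|->]. Qed.

Lemma pos_surj k : 0 < k -> k <= n -> exists v, pos v = k.
Proof.
move=> k0 kn; have [kn'|nk] := ltnP k n.
  by exists (Ordinal kn'); rewrite /pos /=; case: eqP; lia.
by exists (Ordinal (leq_trans k0 kn)); rewrite /pos /=; lia.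
Qed.

Lemma pos_ordS v : pos (ordS v) = if pos v == n then 1 else (pos v).+1.
Proof.
rewrite /pos /=; have vn := ltn_ord v.
have [v0|v0] := eqVneq (v : nat) 0.
  rewrite v0 eqxx; have [n1|n1] := eqVneq n 1; first by rewrite n1 modn1.
  by rewrite modn_small //; lia.
rewrite (ltn_eqF vn).
have [Sn|Sn] := eqVneq v.+1 n; first by rewrite Sn modnn.
by rewrite modn_small //; lia.
Qed.

Definition source v := (pos v == 1) || (pos v == n).

Lemma sourceE (v : 'I_n) : source v = (v < 2).
Proof. by have := ltn_ord v; rewrite /source /pos; case: (v =P 0 :> nat); lia. Qed.

Lemma sourceF v : ~~ source v -> 1 < pos v < n.
Proof. by rewrite /source; have := pos_gt0 v; have := pos_le v; lia. Qed.

Hypothesis n4 : 3 < n.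

Lemma is_sideE u v : pos u < pos v ->
  is_side [set u; v] = (pos v == (pos u).+1) || ((pos u == 1) && (pos v == n)).
Proof.
move=> uv; have u0 := pos_gt0 u; have vn := pos_le v.
apply/existsP/idP => [[i /eqP iE]|].
  have : u \in [set i; ordS i] by rewrite -iE set21.
  have : v \in [set i; ordS i] by rewrite -iE set22.
  rewrite !inE -!pos_eq !pos_ordS; case: (pos i =P n); lia.
case/orP=> [/eqP vu|/andP[/eqP u1 /eqP v1]].
  exists u; apply/eqP; congr [set _; _]; apply/pos_inj; rewrite pos_ordS.
  by case: (pos u =P n); lia.
exists v; apply/eqP; rewrite setUC; congr [set _; _]; apply/pos_inj.
by rewrite pos_ordS v1 eqxx.
Qed.

Definition end_hi (e : {set 'I_n}) := \max_(v in e) pos v.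
(** The subtraction leaves the smaller position of a pair of vertices. *)
Definition end_lo (e : {set 'I_n}) := \sum_(v in e) pos v - end_hi e.

Lemma end_hiE u v : pos u < pos v -> end_hi [set u; v] = pos v.
Proof.
move=> uv; have nuv : u \notin [set v] by rewrite inE -pos_eq; lia.
by rewrite /end_hi big_setU1 //= big_set1; lia.
Qed.

Lemma end_loE u v : pos u < pos v -> end_lo [set u; v] = pos u.
Proof.
move=> uv; have nuv : u \notin [set v] by rewrite inE -pos_eq; lia.
by rewrite /end_lo end_hiE // big_setU1 //= big_set1; lia.
Qed.

End Positions.

(** * Edges of a triangulation *)

Section Triangulated.
Variables (n : nat) (Dd : {set {set 'I_n}}).
Hypotheses (n4 : 3 < n) (hDd : triangulation Dd).

Definition edge (u v : 'I_n) := ([set u; v] \in Dd) || is_side [set u; v].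

Lemma edgeC u v : edge u v = edge v u.
Proof. by rewrite /edge setUC. Qed.

(** Sides, including the one that joins the sources, are excluded by the two
    conditions on the positions. *)
Lemma diagonal_ends e : e \in Dd -> exists a b, [/\ (pos a).+1 < pos b,
  ~ (pos a = 1 /\ pos b = n), e = [set a; b], end_lo e = pos a & end_hi e = pos b].
Proof.
case: hDd => diag _ _ eD; have /andP[/cards2P[u [v [uv ee]]] ns] := diag e eD.
have [a [b [ab {}ee]]] : exists a b, pos a < pos b /\ e = [set a; b].
  have [uv'|vu|/pos_inj uvE] := ltngtP (pos u) (pos v); last by rewrite uvE eqxx in uv.
    by exists u, v.
  by exists v, u; rewrite setUC.
exists a, b; rewrite ee end_loE // end_hiE //; split=> //; move: ns;
  by rewrite ee is_sideE //; lia.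
Qed.

Lemma diagonal_bounds : {in Dd, forall e,
  [&& 0 < end_lo e, end_hi e <= n & (end_lo e).+1 < end_hi e]}.
Proof.
by move=> e /diagonal_ends[a [b [ab _ _ -> ->]]]; rewrite pos_gt0 pos_le ab.
Qed.

Lemma diagonal_not_root : {in Dd, forall e, ~ (end_lo e = 1 /\ end_hi e = n)}.
Proof. by move=> e /diagonal_ends[a [b [_ nr _ -> ->]]]. Qed.

Lemma diagonal_noncrossing : {in Dd &, forall e f,
  ~~ [&& end_lo e < end_lo f, end_lo f < end_hi e & end_hi e < end_hi f]}.
Proof.
move=> e f eD fD; have [_ nc _] := hDd; apply/negP.
have [a [c [_ _ eE -> ->]]] := diagonal_ends eD.
have [b [d [_ _ fE -> ->]]] := diagonal_ends fD => /and3P[ab bc cd].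
have lt (u v w : 'I_n) : pos u < pos v -> pos v < pos w -> u < v.
  by move=> uv vw; have v0 := pos_nz vw; case: (pos_lt uv) => // v0'; rewrite v0' in v0.
have ab' := lt _ _ _ ab bc; have bc' := lt _ _ _ bc cd.
have [d0|d0] := eqVneq (d : nat) 0.
  apply: (nc f e) => //; exists d, a, b, c; split; rewrite ?ab' ?bc' //; last by rewrite fE setUC.
  by have := pos_nz ab; rewrite d0 lt0n.
apply: (nc e f) => //; exists a, b, c, d; split=> //.
by case: (pos_lt cd) => // d0'; rewrite d0' in d0.
Qed.

Lemma diagonal_ends_inj : {in Dd &, forall e f, end_lo e = end_lo f -> end_hi e = end_hi f -> e = f}.
Proof.
move=> e f /diagonal_ends[a [c [_ _ -> -> ->]]] /diagonal_ends[b [d [_ _ -> -> ->]]].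
by move=> /pos_inj -> /pos_inj ->.
Qed.

Lemma diagonals_many : n <= #|Dd| + 3.
Proof. by have [_ _ ->] := hDd; lia. Qed.

Lemma edge_edge_nat a b : pos a < pos b ->
  edge a b = edge_nat Dd (@end_lo n) (@end_hi n) n (pos a) (pos b).
Proof.
move=> ab; rewrite /edge /edge_nat is_sideE // orbC orbA; congr (_ || _).
apply/idP/exists_inP => [abD|[e eD /andP[/eqP ea /eqP eb]]].
  by exists [set a; b]; rewrite // end_loE // end_hiE // !eqxx.
have [a' [b' [_ _ eE ea' eb']]] := diagonal_ends eD.
have <- : a' = a by apply: pos_inj; rewrite -ea'.
by have <- : b' = b by [apply: pos_inj; rewrite -eb']; rewrite -eE.
Qed.

(** Crossing is invariant under rotation of the polygon, so that it may be tested
    on positions. *)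
Lemma edge_noncrossing a b c d : edge a c -> edge b d ->
  pos a < pos b -> pos b < pos c -> pos c < pos d -> False.
Proof.
move=> ac bd ab bc cd; have acl := ltn_trans ab bc; have bdl := ltn_trans bc cd.
rewrite edge_edge_nat // in ac; rewrite edge_edge_nat // in bd.
have := edge_nat_noncrossing diagonal_noncrossing ac bd (pos_gt0 _) (pos_le _).
by rewrite ab bc cd.
Qed.

Lemma edge_split a b : edge a b -> (pos a).+1 < pos b ->
  exists c, [/\ pos a < pos c, pos c < pos b, edge a c & edge c b].
Proof.
move=> ab lab; have lab' : pos a < pos b by apply: ltnW.
rewrite edge_edge_nat // in ab.
have [k [/andP[ak kb] ak' kb']] :=
  edge_nat_split diagonal_bounds diagonal_not_root diagonal_noncrossing
    diagonal_ends_inj diagonals_many ab lab.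
have [c cE] : exists c : 'I_n, pos c = k.
  by apply: pos_surj; [apply: leq_trans ak|apply: leq_trans (ltnW kb) (pos_le b)].
by exists c; rewrite !edge_edge_nat cE //; split.
Qed.

Lemma edge_side a b : pos b = (pos a).+1 -> edge a b.
Proof. by move=> ba; rewrite /edge is_sideE // ba ?eqxx ?orbT. Qed.

Lemma edge_root a b : pos a = 1 -> pos b = n -> edge a b.
Proof. by move=> a1 bn; rewrite /edge is_sideE ?a1 ?bn ?eqxx ?orbT //; lia. Qed.

Lemma edge_neq u v : edge u v -> u != v.
Proof.
apply: contraTneq => ->; rewrite /edge setUid negb_or; apply/andP; split.
  by apply/negP; case: hDd => d _ _ /d /andP[]; rewrite cards1.
apply/existsPn => i; apply/eqP => e.
have : i \in [set v] by rewrite e set21.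
have : ordS i \in [set v] by rewrite e set22.
by rewrite !inE -!pos_eq !pos_ordS; case: (pos i =P n); have := pos_gt0 i; lia.
Qed.

(** * Triangles and their apexes *)

Definition tri a c b :=
  [&& pos a < pos c, pos c < pos b, edge a c, edge c b & edge a b].

(** The smallest edge with [c] strictly inside is the base of a triangle with apex
    [c]: otherwise [edge_split] would give a smaller one. *)
Lemma tri_exists c : ~~ source c -> exists a b, tri a c b.
Proof.
move=> /sourceF /andP[c1 cn].
suff ex k a b : pos b - pos a < k -> pos a < pos c -> pos c < pos b -> edge a b ->
    exists a b, tri a c b.
  have [||a a1] := @pos_surj n 1 => //; first lia.
  have [||b bn] := @pos_surj n n => //; first lia.
  by apply: (ex n a b); rewrite ?a1 ?bn //; [lia|apply: edge_root].
elim: k a b => // k IH a b abk ac cb ab.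
have [d [ad db adE dbE]] : exists d, [/\ pos a < pos d, pos d < pos b, edge a d & edge d b].
  by apply: edge_split => //; lia.
have [cd|dc|/pos_inj cd] := ltngtP (pos c) (pos d).
- by apply: (IH a d) => //; lia.
- by apply: (IH d b) => //; lia.
- by exists a, b; rewrite /tri cd ad db adE dbE ab.
Qed.

Lemma tri_unique a c b a' b' : tri a c b -> tri a' c b' -> a = a' /\ b = b'.
Proof.
move=> /and5P[ac cb acE cbE abE] /and5P[ac' cb' acE' cbE' abE'].
split; apply/pos_inj.
  have [aa'|aa'|//] := ltngtP (pos a) (pos a').
    by have := edge_noncrossing acE abE' aa' ac' cb'.
  by have := edge_noncrossing acE' abE aa' ac cb.
have [bb'|bb'|//] := ltngtP (pos b) (pos b').
  by have := edge_noncrossing abE cbE' ac cb bb'.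
by have := edge_noncrossing abE' cbE ac' cb' bb'.
Qed.

Lemma tri_apex_unique a c b c' : tri a c b -> tri a c' b -> c = c'.
Proof.
move=> /and5P[ac cb acE cbE abE] /and5P[ac' cb' acE' cbE' abE'].
apply/pos_inj; have [cc'|cc'|//] := ltngtP (pos c) (pos c').
  by have := edge_noncrossing acE' cbE ac cc' cb'.
by have := edge_noncrossing acE cbE' ac' cc' cb.
Qed.

(** The default value is only reached for the two sources, which are no apexes. *)
Definition base c : 'I_n * 'I_n := odflt (c, c) [pick p | tri p.1 c p.2].
Definition lo c := (base c).1.
Definition hi c := (base c).2.

Lemma triP c : ~~ source c -> tri (lo c) c (hi c).
Proof.
move=> /tri_exists [a [b abc]]; rewrite /lo /hi /base; case: pickP => [//|].
by move/(_ (a, b)); rewrite /= abc.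
Qed.

Lemma tri_nsource a c b : tri a c b -> ~~ source c.
Proof.
case/and5P=> ac cb _ _ _; rewrite /source; have := pos_gt0 a; have := pos_le b; lia.
Qed.

Lemma tri_base a c b : tri a c b -> [/\ ~~ source c, lo c = a & hi c = b].
Proof.
move=> t; have nc := tri_nsource t; split => //; have [] := tri_unique (triP nc) t; done.
Qed.

Lemma lo_lt c : ~~ source c -> pos (lo c) < pos c.
Proof. by case/triP/and5P. Qed.
Lemma lt_hi c : ~~ source c -> pos c < pos (hi c).
Proof. by case/triP/and5P. Qed.
Lemma edge_lo c : ~~ source c -> edge (lo c) c.
Proof. by case/triP/and5P. Qed.
Lemma edge_hi c : ~~ source c -> edge c (hi c).
Proof. by case/triP/and5P. Qed.
Lemma edge_base c : ~~ source c -> edge (lo c) (hi c).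
Proof. by case/triP/and5P. Qed.

Lemma child_triangle a b : edge a b -> (pos a).+1 < pos b ->
  exists c, [/\ ~~ source c, lo c = a & hi c = b].
Proof.
move=> ab lab; have [c [ac cb acE cbE]] := edge_split ab lab.
by exists c; apply: tri_base; rewrite /tri ac cb acE cbE ab.
Qed.

Lemma apex_unique c c' : ~~ source c -> ~~ source c' -> lo c = lo c' -> hi c = hi c' ->
  c = c'.
Proof.
move=> nc nc' lc hc; apply: tri_apex_unique (triP nc) _; rewrite lc hc; exact: triP.
Qed.

(** The third vertex of the triangle on the outer side of an edge is the end of the
    smallest edge that properly contains it; the apex of that triangle is the end of
    the given edge which lies strictly inside the larger one. *)
Lemma parent_triangle a b : edge a b -> pos a < pos b -> ~ (pos a = 1 /\ pos b = n) ->
  (~~ source a /\ hi a = b) \/ (~~ source b /\ lo b = a).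
Proof.
move=> ab lab nroot.
suff ex k x y : pos y - pos x < k -> pos x <= pos a -> pos b <= pos y -> edge x y ->
    (a != x) || (b != y) -> (~~ source a /\ hi a = b) \/ (~~ source b /\ lo b = a).
  have [||x x1] := @pos_surj n 1 => //; first lia.
  have [||y yn] := @pos_surj n n => //; first lia.
  apply: (ex n x y); rewrite ?x1 ?yn ?pos_gt0 ?pos_le //; [lia|exact: edge_root|].
  by rewrite -!pos_eq x1 yn; lia.
elim: k x y => // k IH x y xyk xa yb xy nxy.
have [c [xc cy xcE cyE]] : exists c, [/\ pos x < pos c, pos c < pos y, edge x c & edge c y].
  by apply: edge_split => //; rewrite -!pos_eq in nxy; lia.
have [ca|ac] := leqP (pos c) (pos a).
  have [/andP[/eqP aE /eqP bE]|ne] := boolP ((a == c) && (b == y)).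
    subst c y; have t : tri x a b by rewrite /tri xc cy xcE cyE xy.
    by left; have [] := tri_base t.
  by apply: (IH c y) => //; [lia|rewrite negb_and in ne].
have [bc|cb] := leqP (pos b) (pos c).
  have [/andP[/eqP aE /eqP bE]|ne] := boolP ((a == x) && (b == c)).
    subst c x; have t : tri a b y by rewrite /tri xc cy xcE cyE xy.
    by right; have [] := tri_base t.
  by apply: (IH x c) => //; [lia|rewrite negb_and in ne].
have := edge_noncrossing xcE ab; have := edge_noncrossing ab cyE.
by rewrite -!pos_eq in nxy; lia.
Qed.

Lemma parent_exclusive a b : ~~ source a -> ~~ source b -> hi a = b -> lo b = a -> False.
Proof.
move=> na nb ha lb.
have /and5P[t1 t2 t3 t4 t5] := triP na; have /and5P[s1 s2 s3 s4 s5] := triP nb.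
rewrite ha in t2 t4 t5; rewrite lb in s1 s3 s5.
exact: (edge_noncrossing t5 s5 t1 s1 s2).
Qed.

Definition triangle c := [set lo c; c; hi c].

Lemma in_triangle c v : (v \in triangle c) = [|| v == lo c, v == c | v == hi c].
Proof. by rewrite !inE orbA. Qed.

Lemma card3P (t : {set 'I_n}) : #|t| = 3 ->
  exists a c b, [/\ pos a < pos c, pos c < pos b & t = [set a; c; b]].
Proof.
move=> t3; have [k kt] : exists k, k \in t by apply/card_gt0P; rewrite t3.
have [a at' amin] := arg_minnP (@pos n) kt.
have [b bt bmax] := arg_maxnP (@pos n) kt.
have ab : pos a <= pos b by apply: amin.
have ltab : pos a < pos b.
  rewrite ltn_neqAle ab andbT pos_eq; apply/eqP => abE; subst b.
  suff : t \subset [set a] by move/subset_leq_card; rewrite t3 cards1.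
  apply/subsetP => v vt; rewrite inE -pos_eq eqn_leq.
  by have := amin v vt; have := bmax v vt; rewrite /= => -> ->.
have nab : a != b by rewrite -pos_eq; lia.
have abt : [set a; b] \subset t by apply/subsetP => v; rewrite !inE => /orP[]/eqP->.
have /cards1P[c tc] : #|t :\: [set a; b]| == 1.
  by apply/eqP/(@addnI 2); have := cardsID [set a; b] t; rewrite (setIidPr abt) cards2 nab t3.
have : c \in t :\: [set a; b] by rewrite tc set11.
rewrite !inE negb_or => /andP[/andP[ca cb] ct].
exists a, c, b; split.
- by have := amin c ct; rewrite -pos_eq in ca; lia.
- by have := bmax c ct; rewrite -pos_eq in cb; lia.
- rewrite -(setID t [set a; b]) (setIidPr abt) tc; apply/setP => v; rewrite !inE.
  by rewrite orbAC.
Qed.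

(** With [triangle_inj], this indexes the triangles by the vertices other than the
    sources. *)
Lemma triangleP t : reflect (exists2 c, ~~ source c & t = triangle c) (is_triangle Dd t).
Proof.
apply: (iffP andP) => [[/eqP /card3P[a [c [b [ac cb ->]]]]]|[c nc ->]].
  move=> /forall_inP al.
  have E u v : u \in [set a; c; b] -> v \in [set a; c; b] -> u != v -> edge u v.
    by move=> /al /forall_inP h /h /implyP.
  have := E a c; have := E c b; have := E a b; rewrite !inE -!pos_eq !eqxx /= ?orbT.
  move=> /(_ isT isT) ab /(_ isT isT) cb' /(_ isT isT) ac'.
  have acb : tri a c b.
    rewrite /tri ac cb ab ?ac' ?cb' //; first by rewrite (ltn_eqF cb).
      by rewrite (ltn_eqF ac).
    by rewrite (ltn_eqF (ltn_trans ac cb)).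
  by have [nc l h] := tri_base acb; exists c; rewrite // /triangle l h.
have /and5P[t1 t2 t3 t4 t5] := triP nc; split.
  rewrite /triangle setUC cardsU1 cards2 !inE -!pos_eq; lia.
apply/forall_inP => u; rewrite in_triangle => ut; apply/forall_inP => v.
rewrite in_triangle => vt; apply/implyP; rewrite -/(edge u v).
by case/or3P: ut => /eqP ->; case/or3P: vt => /eqP ->; rewrite ?eqxx // edgeC.
Qed.

Lemma triangle_inj c c' : ~~ source c -> ~~ source c' -> triangle c = triangle c' -> c = c'.
Proof.
move=> nc nc' cc'; have := lo_lt nc; have := lt_hi nc; have := lo_lt nc'; have := lt_hi nc'.
have M v : v \in triangle c -> v \in triangle c' by rewrite cc'.
have := M c; have := M (lo c); have := M (hi c).
rewrite !in_triangle !eqxx ?orbT -!pos_eq => /(_ isT) h1 /(_ isT) h2 /(_ isT) h3 *.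
by apply/pos_inj; lia.
Qed.

Definition span c := pos (hi c) - pos (lo c).

(** The triangles that contain [v] and have another apex lie behind the triangle
    with apex [v]. *)
Lemma span_parent c v : ~~ source c -> ~~ source v -> v \in triangle c -> v != c ->
  span c < span v.
Proof.
move=> nc nv; rewrite in_triangle; have /and5P[t1 t2 t3 t4 t5] := triP nc.
have /and5P[s1 s2 s3 s4 s5] := triP nv; rewrite /span.
case/or3P=> /eqP vE; rewrite vE ?eqxx // => _; rewrite -!vE in t1 t2 t3 t4 t5 *.
  have := edge_noncrossing s5 t5; lia.
rewrite edgeC in t5; rewrite edgeC in s5.
have := @edge_noncrossing (lo c) (lo v) v (hi v); rewrite edgeC t5 edgeC s5; lia.
Qed.

Lemma edge_inside a b u v : edge a b -> edge u v -> pos a < pos u < pos b ->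
  pos a <= pos v <= pos b.
Proof.
move=> ab uv /andP[au ub]; have := edge_noncrossing ab uv.
rewrite edgeC in uv; have := edge_noncrossing uv ab; lia.
Qed.

(** * Tips of ears *)

(** The polygon vertices that the plabic graph colours black. *)
Definition ear_tip v := ~~ [exists e in Dd, v \in e].

Lemma ear_tip_side v x : ear_tip v -> edge v x -> x = ordS v \/ v = ordS x.
Proof.
move=> /exists_inPn ear /orP[/ear|/existsP[i /eqP e]]; first by rewrite set21.
have : v \in [set i; ordS i] by rewrite -e set21.
have : x \in [set i; ordS i] by rewrite -e set22.
have : ordS i \in [set v; x] by rewrite e set22.
have : i \in [set v; x] by rewrite e set21.
rewrite !inE; do 4 case/orP => /eqP ?; subst; auto.
Qed.

Definition ear (v : 'I_n) := [set ord_pred v; v; ordS v].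

(** Both edges of the triangle at [v] are sides. *)
Lemma ear_tip_triangle v t : ear_tip v -> is_triangle Dd t -> v \in t -> t = ear v.
Proof.
move=> evt tT vt; have /andP[/eqP t3 /forall_inP al] := tT.
have sub : t \subset ear v.
  apply/subsetP => x xt; rewrite !inE; have [->|xv] := eqVneq x v; first by rewrite orbT.
  have /forall_inP/(_ x xt)/implyP := al v vt; rewrite eq_sym => /(_ xv) vx.
  have [->|->] := ear_tip_side evt vx; first by rewrite eqxx !orbT.
  by rewrite ordSK eqxx.
apply/eqP; rewrite eqEcard sub t3 /ear setUC cardsU1 cards2.
by case: (_ \notin _); case: (_ != _).
Qed.

(** * Tree degrees *)

(** The two sides of the edge of the tree dual to a diagonal.  The leaf [j] hangs
    on the side of the polygon that ends at [j], which is why the interval is open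
    on the left. *)
Definition beyond (e : {set 'I_n}) (x : tree_vertex n) : bool :=
  match x with
  | inl j => end_lo e < pos j <= end_hi e
  | inr t => [forall v in t, end_lo e <= pos v <= end_hi e]
  end.

Lemma is_triangle_triangle c : ~~ source c -> is_triangle Dd (triangle c).
Proof. by move=> nc; apply/triangleP; exists c. Qed.

Lemma triangle_edge t u v : is_triangle Dd t -> u \in t -> v \in t -> u != v -> edge u v.
Proof.
by move=> /andP[_ /forall_inP al] /al /forall_inP h /h /implyP.
Qed.

Lemma beyond_leaf e j t : e \in Dd -> leaf_adj Dd j t ->
  beyond e (inl j) = beyond e (inr t).
Proof.
move=> eD /andP[tT /existsP[i /andP[/eqP jE /subsetP sub]]].
have it : i \in t by apply: sub; rewrite set21.
have jt : j \in t by apply: sub; rewrite jE set22.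
have pj : pos j = if pos i == n then 1 else (pos i).+1 by rewrite jE pos_ordS.
have [a [b [ab nroot eE ea eb]]] := diagonal_ends eD.
have abE : edge a b by rewrite /edge -eE eD.
rewrite /= ea eb; case: eqP pj => [iN|_] pj.
  apply/idP/forall_inP => [|al]; first by have := pos_gt0 a; lia.
  have := al i it; have := al j jt; have := pos_le b; have := pos_gt0 a; lia.
apply/idP/forall_inP => [jab v vt|al]; last by have := al i it; have := al j jt; lia.
have [->|vi] := eqVneq v i; first lia.
have [->|vj] := eqVneq v j; first lia.
rewrite eq_sym in vi; rewrite eq_sym in vj.
have [ai|ia] := ltnP (pos a) (pos i).
  by apply: (edge_inside abE (triangle_edge tT it vt vi)); lia.
by apply: (edge_inside abE (triangle_edge tT jt vt vj)); lia.
Qed.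

(** A vertex of [t'] strictly between the ends of [e] would confine the whole
    triangle to that side of [e]. *)
Lemma beyond_change_sub e t t' : e \in Dd -> is_triangle Dd t' ->
  beyond e (inr t) -> ~~ beyond e (inr t') -> t :&: t' \subset e.
Proof.
move=> eD tT' /forall_inP al /forall_inPn[w wt' we].
have [a [b [ab nroot eE ea eb]]] := diagonal_ends eD.
have abE : edge a b by rewrite /edge -eE eD.
rewrite ea eb in al we; apply/subsetP => v; rewrite inE => /andP[vt vt'].
have vw : v != w by apply: contraNneq we => <-; apply: al.
have := edge_inside abE (triangle_edge tT' vt' wt' vw).
rewrite eE !inE -!pos_eq; have := al v vt; lia.
Qed.

Lemma card_diagonal e : e \in Dd -> #|e| = 2.
Proof.
move=> /diagonal_ends[a [b [ab _ -> _ _]]]; rewrite cards2.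
by case: eqP => // abE; rewrite abE in ab; lia.
Qed.

Lemma beyond_change e t t' : e \in Dd -> tree_adj Dd (inr t) (inr t') ->
  beyond e (inr t) != beyond e (inr t') -> e = t :&: t'.
Proof.
move=> eD /and3P[tT tT' /eqP tt'] ch; apply/eqP; rewrite eq_sym.
have := card_diagonal eD => e2; rewrite eqEcard e2 tt' leqnn andbT.
case: (boolP (beyond e (inr t))) ch; case: (boolP (beyond e (inr t'))) => // t'e te _.
  exact: beyond_change_sub.
by rewrite setIC; exact: beyond_change_sub.
Qed.

Lemma triangle_pair c u v : ~~ source c -> u \in triangle c -> v \in triangle c ->
  pos u < pos v ->
  [\/ u = lo c /\ v = hi c, u = lo c /\ v = c | u = c /\ v = hi c].
Proof.
move=> nc; rewrite !in_triangle; have := lo_lt nc; have := lt_hi nc => h1 h2.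
by case/or3P=> /eqP -> /or3P[]/eqP -> uv; try (exfalso; lia);
  [apply: Or32|apply: Or31|apply: Or33].
Qed.

Lemma adjacent_base c c' : ~~ source c -> ~~ source c' ->
  lo c \in triangle c' -> hi c \in triangle c' -> c' != c ->
  let e := triangle c :&: triangle c' in
  [/\ e = [set lo c; hi c], e \in Dd & beyond e (inr (triangle c)) != beyond e (inr (triangle c'))].
Proof.
move=> nc nc' lc hc cc' e; have := lo_lt nc; have := lt_hi nc => h1 h2.
have lh := ltn_trans h2 h1.
have nbase : c \notin triangle c'.
  have h3 := lo_lt nc'; have h4 := lt_hi nc'.
  rewrite in_triangle [c == c']eq_sym (negPf cc') /=; apply/negP.
  move: lc hc; rewrite !in_triangle -!pos_eq; lia.
have eE : e = [set lo c; hi c].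
  apply/setP => v; rewrite in_setI in_set2.
  have [->|vl] := eqVneq v (lo c); first by rewrite lc in_triangle eqxx.
  have [->|vh] := eqVneq v (hi c); first by rewrite hc in_triangle eqxx !orbT.
  rewrite in_triangle (negPf vl) (negPf vh) /= orbF.
  by have [->|//] := eqVneq v c; apply: negPf.
have nroot : ~ (pos (lo c) = 1 /\ pos (hi c) = n).
  move=> [l1 hn]; have := lo_lt nc'; have := lt_hi nc'.
  have [[e1 e2]|[_ e1]|[e1 _]] := triangle_pair nc' lc hc lh.
  - by case/eqP: cc'; apply: apex_unique.
  - have := pos_le (hi c'); rewrite -e1; lia.
  - have := pos_gt0 (lo c'); rewrite -e1; lia.
have eD : e \in Dd.
  have := edge_base nc; rewrite /edge -eE => /orP[//|].
  by rewrite eE is_sideE //; lia.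
split=> //; rewrite (_ : beyond e _ = true); last first.
  apply/forall_inP => v; rewrite eE (end_loE n4 lh) (end_hiE n4 lh) in_triangle.
  by case/or3P=> /eqP ->; clear -h1 h2; lia.
suff -> : beyond e (inr (triangle c')) = false by [].
apply/negP => /forall_inP al.
have h3 := lo_lt nc'; have h4 := lt_hi nc'.
have := al (lo c'); have := al (hi c').
rewrite eE (end_loE n4 lh) (end_hiE n4 lh) !in_triangle.
rewrite !eqxx ?orbT => /(_ isT) h5 /(_ isT) h6.
have [[e1 e2]|[e1 e2]|[e1 e2]] := triangle_pair nc' lc hc lh.
- by case/eqP: cc'; apply: apex_unique.
- by rewrite e2 in h5; lia.
- by rewrite e1 in h6; lia.
Qed.

Lemma adjacent_diagonal t t' : tree_adj Dd (inr t) (inr t') ->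
  t :&: t' \in Dd /\ beyond (t :&: t') (inr t) != beyond (t :&: t') (inr t').
Proof.
case/and3P => /triangleP[c nc ->] /triangleP[c' nc' ->] tt'.
have cc' : c' != c.
  apply: contraTneq tt' => ->; rewrite setIid; by case/andP: (is_triangle_triangle nc) => /eqP ->.
have /cards2P[u [v [uv e]]] := tt'.
wlog {uv} uv : u v e / pos u < pos v.
  move=> h; have [|vu|/pos_inj uvE] := ltngtP (pos u) (pos v); first exact: h.
    by apply: h vu; rewrite setUC.
  by rewrite uvE eqxx in uv.
have : u \in [set u; v] by rewrite set21.
have : v \in [set u; v] by rewrite set22.
rewrite -e !in_setI => /andP[vc vc'] /andP[uc uc'].
have [[uE vE]|[uE vE]|[uE vE]] := triangle_pair nc uc vc uv.
- by rewrite uE in uc'; rewrite vE in vc'; have [] := adjacent_base nc nc' uc' vc' cc'.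
- have [[uE' vE']|[uE' vE']|[uE' vE']] := triangle_pair nc' uc' vc' uv.
  + rewrite uE' in uc; rewrite vE' in vc; rewrite eq_sym in cc'.
    by rewrite setIC; have [_ -> ] := adjacent_base nc' nc uc vc cc'; rewrite eq_sym.
  + by rewrite -vE -vE' eqxx in cc'.
  + by case: (@parent_exclusive u v); rewrite ?uE' ?vE // -?uE' -?vE //; congruence.
- have [[uE' vE']|[uE' vE']|[uE' vE']] := triangle_pair nc' uc' vc' uv.
  + rewrite uE' in uc; rewrite vE' in vc; rewrite eq_sym in cc'.
    by rewrite setIC; have [_ -> ] := adjacent_base nc' nc uc vc cc'; rewrite eq_sym.
  + by case: (@parent_exclusive u v); rewrite ?uE ?vE' // -?uE -?vE' //; congruence.
  + by rewrite -uE -uE' eqxx in cc'.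
Qed.

Lemma card_triangle t : is_triangle Dd t -> #|t| = 3.
Proof. by case/andP=> /eqP. Qed.

(** Two adjacent triangles are on opposite sides of their common diagonal, so an edge
    has at most one triangle on each side. *)
Lemma beyond_inj (e : {set 'I_n}) t t' : is_triangle Dd t -> is_triangle Dd t' -> #|e| = 2 ->
  e \subset t -> e \subset t' -> beyond e (inr t) = beyond e (inr t') -> t = t'.
Proof.
move=> tT tT' e2 et et' b; apply/eqP/negPn/negP => tt'.
have sub : e \subset t :&: t' by rewrite subsetI et.
have c2 : #|t :&: t'| == 2.
  rewrite eqn_leq -{2}e2 subset_leq_card // andbT -ltnS -(card_triangle tT).
  apply: proper_card; rewrite properE subsetIl /=; apply: contra tt'.
  by rewrite subsetI => /andP[_ s]; rewrite eqEcard s !card_triangle.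
have eE : e = t :&: t' by apply/eqP; rewrite eqEcard sub e2 (eqP c2).
have /adjacent_diagonal[_] : tree_adj Dd (inr t) (inr t') by rewrite /= tT tT' c2.
by rewrite -eE b eqxx.
Qed.

(** A leaf is on the same side of every diagonal as its triangle, and two adjacent
    triangles are separated by their common side only. *)
Lemma card_beyond_change x y : tree_adj Dd x y ->
  #|[set e in Dd | beyond e x != beyond e y]| = is_inner x && is_inner y.
Proof.
case: x y => [i|t] [j|t'] // xy.
- apply: eq_card0 => e; rewrite in_set [RHS]inE; apply/andP => -[eD].
  by rewrite (beyond_leaf eD xy) eqxx.
- apply: eq_card0 => e; rewrite in_set [RHS]inE; apply/andP => -[eD].
  by rewrite -(beyond_leaf eD xy) eqxx.
have [eD ch] := adjacent_diagonal xy.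
apply/eqP/cards1P; exists (t :&: t'); apply/setP => e; rewrite !inE.
by apply/andP/eqP => [[eD' ch']|->//]; apply: beyond_change ch'.
Qed.

Definition changes e x p := count (fun s => beyond e s.1 != beyond e s.2) (zip (x :: p) p).

Lemma internal_edges_changes x p : path (tree_adj Dd) x p ->
  internal_edges x p = \sum_(e in Dd) changes e x p.
Proof.
elim: p x => [|y q IH] x /=; first by rewrite big1.
case/andP=> xy /IH; rewrite /internal_edges /changes /= big_split /= => ->.
congr (_ + _); rewrite -(card_beyond_change xy) -sum1_card big_mkcond [RHS]big_mkcond.
by apply: eq_bigr => e _; rewrite !inE; case: (e \in Dd) => //=; case: (_ != _).
Qed.

Lemma tree_adj_sym : ssrbool.symmetric (tree_adj Dd).
Proof. by move=> [i|t] [j|t'] //=; rewrite setIC andbCA. Qed.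

Lemma change_step e x y : e \in Dd -> tree_adj Dd x y -> beyond e x != beyond e y ->
  exists t, [/\ x = inr t, is_triangle Dd t & e \subset t].
Proof.
move=> eD; case: x y => [i|t] [j|t'] // xy.
- by rewrite (beyond_leaf eD xy) eqxx.
- by rewrite -(beyond_leaf eD xy) eqxx.
move=> ch; exists t; have /and3P[tT _ _] := xy; split=> //.
by rewrite (beyond_change eD xy ch) subsetIl.
Qed.

(** Crossing [e] again would need the two triangles adjacent to [e], and [t] is one
    of them. *)
Lemma no_change e t y q : e \in Dd -> is_triangle Dd t -> e \subset t ->
  path (tree_adj Dd) y q -> inr t \notin y :: q ->
  changes e y q = 0 /\ beyond e (last y q) = beyond e y.
Proof.
move=> eD tT et; elim: q y => [|z q IH] y //= /andP[yz zq].
rewrite !inE !negb_or => /and3P[ty tz tq].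
have [|c0 ->] := IH z zq; first by rewrite inE negb_or tz.
rewrite /changes /= -/(changes e z q) c0.
have [-> //|ch] := eqVneq (beyond e y) (beyond e z).
have [u [yE uT eu]] := change_step eD yz ch.
rewrite tree_adj_sym in yz; rewrite eq_sym in ch.
have [w [zE wT ew]] := change_step eD yz ch.
have e2 := card_diagonal eD.
have [tu|tu] := eqVneq (beyond e (inr t)) (beyond e (inr u)).
  by move: ty; rewrite yE (beyond_inj tT uT e2 et eu tu) eqxx.
have tw : beyond e (inr t) = beyond e (inr w).
  by move: ch tu; rewrite yE zE; do 3 case: beyond.
by move: tz; rewrite zE (beyond_inj tT wT e2 et ew tw) eqxx.
Qed.

Lemma changes_simple e x p : e \in Dd -> path (tree_adj Dd) x p -> uniq (x :: p) ->
  changes e x p = (beyond e x != beyond e (last x p)).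
Proof.
move=> eD; elim: p x => [|y q IH] x; first by rewrite /= eqxx.
rewrite [path _ _ _]/= [uniq _]/= => /andP[xy yq] /andP[nx uq].
rewrite /changes /= -/(changes e y q).
have [->|ch] := eqVneq (beyond e x) (beyond e y); first exact: IH.
have [t [xE tT et]] := change_step eD xy ch; rewrite xE in nx.
by have [-> ->] := no_change eD tT et yq nx; rewrite ch.
Qed.

Lemma triangle_leaf j : exists2 t, is_triangle Dd t & tree_adj Dd (inl j) (inr t).
Proof.
pose i := ord_pred j; have jE : j = ordS i by rewrite ord_predK.
suff [c nc [ic jc]] : exists2 c, ~~ source c & i \in triangle c /\ j \in triangle c.
  have tT := is_triangle_triangle nc.
  exists (triangle c); rewrite //= /leaf_adj tT /=; apply/existsP; exists i.
  by rewrite jE eqxx; apply/subsetP => v; rewrite in_set2 => /orP[]/eqP->; rewrite // -jE.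
have pj : pos j = if pos i == n then 1 else (pos i).+1 by rewrite {1}jE pos_ordS.
case: eqP pj => iN pj.
  have [c [nc lc hc]] := child_triangle (edge_root pj iN) ltac:(lia).
  by exists c; rewrite // !in_triangle lc hc !eqxx !orbT.
have ij : edge i j by apply: edge_side.
have [[nc h]|[nc h]] := parent_triangle ij ltac:(lia) ltac:(lia).
  by exists i; rewrite // !in_triangle h !eqxx !orbT.
by exists j; rewrite // !in_triangle h !eqxx !orbT.
Qed.

(** Parent triangles have larger span, so every triangle is connected to the one on
    the edge that joins the sources. *)
Lemma connect_triangles c c' : ~~ source c -> ~~ source c' ->
  connect (tree_adj Dd) (inr (triangle c)) (inr (triangle c')).
Proof.
have [||r r1] := @pos_surj n 1 => //; first lia.
have [||s sn] := @pos_surj n n => //; first lia.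
have [z [nz lz hz]] := child_triangle (edge_root r1 sn) ltac:(lia).
have cz k d : n - span d < k -> ~~ source d ->
    connect (tree_adj Dd) (inr (triangle d)) (inr (triangle z)).
  elim: k d => // k IH d dk nd; have h1 := lo_lt nd; have h2 := lt_hi nd.
  have [/andP[/eqP l1 /eqP hn]|nroot] := boolP ((pos (lo d) == 1) && (pos (hi d) == n)).
    have -> : d = z; last by [].
    by apply: apex_unique => //; apply: pos_inj; rewrite ?lz ?hz ?l1 ?hn.
  have [c0 [nc0 dc0 lc0 hc0]] : exists c0, [/\ ~~ source c0, c0 != d,
      lo d \in triangle c0 & hi d \in triangle c0].
    have [[nc h]|[nc h]] := parent_triangle (edge_base nd) ltac:(lia) ltac:(lia).
      by exists (lo d); rewrite !in_triangle h !eqxx ?orbT -pos_eq; split=> //; lia.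
    by exists (hi d); rewrite !in_triangle h !eqxx ?orbT -pos_eq; split=> //; lia.
  have [eE eD _] := adjacent_base nd nc0 lc0 hc0 dc0.
  apply: connect_trans (IH c0 _ nc0).
    by apply: connect1; rewrite /= !is_triangle_triangle ?(card_diagonal eD).
  have : span d < span c0.
    have := lo_lt nc0; have := lt_hi nc0; rewrite /span.
    have [[e1 e2]|[e1 e2]|[e1 e2]] := triangle_pair nc0 lc0 hc0 (ltn_trans h1 h2).
    - by case/eqP: dc0; apply: apex_unique.
    - rewrite e1 e2; lia.
    - rewrite e1 e2; lia.
  have := pos_le (hi c0); rewrite /span in dk *; lia.
move=> nc nc'; apply: connect_trans (cz _ _ (ltnSn _) nc) _.
rewrite (sym_connect_sym tree_adj_sym); exact: cz _ _ (ltnSn _) nc'.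
Qed.

Lemma tree_degreeE i j : tree_degree Dd i j =
  \sum_(e in Dd) (beyond e (inl i) != beyond e (inl j)).
Proof.
have deg (p : seq (tree_vertex n)) : is_tree_path Dd i j p ->
    internal_edges (leaf i) p = \sum_(e in Dd) (beyond e (inl i) != beyond e (inl j)).
  case/and3P=> pp /eqP pl up; rewrite internal_edges_changes //.
  by apply: eq_bigr => e eD; rewrite changes_simple // pl.
rewrite /tree_degree; case: pickP => [p /deg //|none].
have [t /triangleP[c nc ->] it] := triangle_leaf i.
have [t' /triangleP[c' nc' ->] jt'] := triangle_leaf j.
have : connect (tree_adj Dd) (inl i) (inl j).
  apply: connect_trans (connect1 it) (connect_trans (connect_triangles nc nc') _).
  by apply: connect1; rewrite tree_adj_sym.
case/connectP => p pp; case/shortenP: pp => q pq uq _ lq.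
have sq : size q <= #|{: tree_vertex n}|.
  have /card_uniqP sz := uq.
  by have := max_card (mem (leaf i :: q)); rewrite sz; apply: ltnW.
have qP : is_tree_path Dd i j q by apply/and3P; rewrite -lq; split.
by have := none (Bseq sq); rewrite qP.
Qed.

(** * Chains of polygon vertices *)

(** A directed path through the triangle with apex [y] comes from one of the other
    two vertices and leaves at [y]. *)
Definition step x y := ~~ source y && ((x == lo y) || (x == hi y)).

(** Steps increase the age, which makes the oriented graph acyclic. *)
Definition age v := if source v then 0 else (n - span v).+1.

Lemma step_triangle x y : step x y -> [/\ ~~ source y, x \in triangle y & x != y].
Proof.
case/andP=> ny xy; rewrite in_triangle; have h1 := lo_lt ny; have h2 := lt_hi ny.
split=> //; first by case/orP: xy => ->; rewrite ?orbT.
by rewrite -pos_eq; case/orP: xy => /eqP ->; lia.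
Qed.

Lemma step_age x y : step x y -> age x < age y.
Proof.
case/step_triangle=> ny xt xy; rewrite /age (negPf ny); case: ifPn => // nx.
have := span_parent ny nx xt xy; have := pos_le (hi x); rewrite /span; lia.
Qed.

Lemma chain_age s P v : path step s P -> v \in s :: P -> v = last s P \/ age v < age (last s P).
Proof.
elim: P s v => [|y P IH] s v /=; first by rewrite inE => _ /eqP ->; left.
case/andP=> sy yP; rewrite inE => /orP[/eqP ->|]; last exact: IH.
have h := step_age sy; right.
by have [<-//|] := IH y y yP (mem_head _ _); apply: ltn_trans.
Qed.

(** The triangle with apex [v] lies behind the edge, and the edge lies in the span of
    the triangle whose apex is one of its ends. *)
Lemma age_inside a b v : edge a b -> pos a < pos v < pos b ->
  age a < age v /\ age b < age v.
Proof.
move=> ab /andP[av vb]; have nv : ~~ source v.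
  by rewrite /source; have := pos_gt0 a; have := pos_le b; lia.
have vi : pos a < pos v < pos b by rewrite av.
have lv : edge v (lo v) by rewrite edgeC edge_lo.
have h1 := edge_inside ab lv vi; have h2 := edge_inside ab (edge_hi nv) vi.
rewrite /age (negPf nv); split; case: ifPn => // na; rewrite ltnS /span.
  have := lo_lt na; have := lt_hi na; have := edge_inside (edge_base na) ab.
  have := pos_le (hi a); lia.
rewrite edgeC in ab.
have := lo_lt na; have := lt_hi na; have := edge_inside (edge_base na) ab.
have := pos_le (hi b); lia.
Qed.

(** The face of [e] is to the left of a path that stops at or before the lower end of
    [e], and to the right of one that stops at or after the upper end.  A path that
    goes on behind [e] is decided by the end of [e] through which it enters: from
    there on, the value no longer changes. *)
Definition left_of_chain (e : {set 'I_n}) (vs : seq 'I_n) : bool :=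
  foldl (fun b v => if end_lo e < pos v < end_hi e then b else pos v <= end_lo e) false vs.

Lemma left_of_chain_rcons e vs v : left_of_chain e (rcons vs v) =
  if end_lo e < pos v < end_hi e then left_of_chain e vs else pos v <= end_lo e.
Proof. by rewrite /left_of_chain foldl_rcons. Qed.

Lemma left_of_chain_last e s P : ~~ (end_lo e < pos (last s P) < end_hi e) ->
  left_of_chain e (s :: P) = (pos (last s P) <= end_lo e).
Proof.
move=> h; rewrite lastI left_of_chain_rcons; exact: ifN.
Qed.

Lemma diagonal_edge e : e \in Dd -> exists a b, [/\ edge a b, pos a = end_lo e,
  pos b = end_hi e, (pos a).+1 < pos b & ~ (pos a = 1 /\ pos b = n)].
Proof.
move=> eD; have [a [b [ab nr eE ea eb]]] := diagonal_ends eD; exists a, b.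
by rewrite ea eb /edge -eE eD.
Qed.

(** A chain that avoids the upper end of [e] can only get behind [e] through the
    lower end. *)
Lemma left_of_chain_avoid e s P : e \in Dd -> source s -> path step s P ->
  end_lo e < pos (last s P) < end_hi e -> {in s :: P, forall v, pos v != end_hi e} ->
  left_of_chain e (s :: P).
Proof.
move=> eD ss; have [a [b [ab ea eb lab _]]] := diagonal_edge eD.
elim/last_ind: P => [|P y IH] /=.
  by move: ss; rewrite /source; have := pos_gt0 a; have := pos_le b; lia.
rewrite rcons_path last_rcons -rcons_cons => /andP[sP xy] yab av.
rewrite left_of_chain_rcons yab.
have [ny xt xy'] := step_triangle xy.
have yx : edge y (last s P).
  by case/andP: xy => _ /orP[/eqP ->|/eqP ->]; [rewrite edgeC; exact: edge_lo|exact: edge_hi].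
have := edge_inside ab yx; rewrite ea eb => /(_ yab) xab.
have xb : pos (last s P) != end_hi e by apply: av; rewrite mem_rcons inE mem_last orbT.
have [xin|xout] := boolP (end_lo e < pos (last s P) < end_hi e).
  by apply: IH => // v vP; apply: av; rewrite mem_rcons inE vP orbT.
by rewrite left_of_chain_last //; clear -xout xab xb; lia.
Qed.

(** * Minimal pairs of disjoint chains *)

(** The least number of chains with the face of [e] on the left, among two disjoint
    chains from the two sources to [x] and [y]. *)
Definition min_left (e : {set 'I_n}) (x y : 'I_n) : nat :=
  (pos x <= end_lo e) + (pos y <= end_lo e) +
  ((end_lo e < pos x <= end_hi e) && (end_lo e < pos y <= end_hi e)).

Lemma min_leftC e x y : min_left e x y = min_left e y x.
Proof. by rewrite /min_left [(_ <= _) + _]addnC andbC. Qed.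

(** When [x] and [y] are both behind [e], one of the disjoint chains avoids the upper
    end of [e], and [left_of_chain_avoid] applies to it. *)
Lemma min_left_le e s t P Q : e \in Dd -> source s -> source t ->
  path step s P -> path step t Q -> ~~ has (mem (s :: P)) (t :: Q) ->
  min_left e (last s P) (last t Q) <= left_of_chain e (s :: P) + left_of_chain e (t :: Q).
Proof.
move=> eD ss st sP tQ dis; rewrite /min_left.
have [a [b [ab ea eb lab _]]] := diagonal_edge eD.
have low u R : (pos (last u R) <= end_lo e) <= left_of_chain e (u :: R).
  have [h|//] := boolP (pos _ <= _); rewrite left_of_chain_last ?h //.
  by rewrite negb_and -leqNgt h.
have := low s P; have := low t Q.
have [bP|bP] := boolP (b \in s :: P).
  have bQ : b \notin t :: Q by apply: contra dis => bQ; apply/hasP; exists b.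
  have := @left_of_chain_avoid e t Q eD st tQ.
  have : {in t :: Q, forall v, pos v != end_hi e}.
    by move=> v vQ; rewrite -eb pos_eq; apply: contraNneq bQ => <-.
  have : pos (last t Q) != end_hi e.
    by rewrite -eb pos_eq; apply: contraNneq bQ => <-; exact: mem_last.
  move=> hQ av /(_ _ av); clear -hQ; lia.
have := @left_of_chain_avoid e s P eD ss sP.
have : {in s :: P, forall v, pos v != end_hi e}.
  by move=> v vQ; rewrite -eb pos_eq; apply: contraNneq bP => <-.
have : pos (last s P) != end_hi e.
  by rewrite -eb pos_eq; apply: contraNneq bP => <-; exact: mem_last.
move=> hP av /(_ _ av); clear -hP; lia.
Qed.

(** By induction on the ages: the younger end point is reached by one step from its
    upper neighbour [hi], which keeps the path as far to the left as possible, unless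
    [hi] is the other end point; then the step starts from [lo].  Only the diagonals
    [e] that do not have the new end point behind them change, and for these
    [left_of_chain_last] gives both values. *)
Lemma min_left_attained s t x y : pos s = 1 -> pos t = n -> pos x < pos y ->
  exists P Q, [/\ path step s P /\ last s P = x, path step t Q /\ last t Q = y,
    ~~ has (mem (s :: P)) (t :: Q) &
    {in Dd, forall e, left_of_chain e (s :: P) + left_of_chain e (t :: Q) = min_left e x y}].
Proof.
move=> s1 tn; have [k] := ubnP (age x + age y); elim: k x y => // k IH x y xyk xy.
(* A diagonal which does not have the apex of a triangle strictly behind it has none of
     the three vertices strictly behind it. *)
have fact e (u v w : 'I_n) : e \in Dd -> ~~ source v -> pos u = pos (lo v) -> pos w = pos (hi v) ->
  [/\ pos u < pos v < pos w,
     end_lo e < pos v < end_hi e -> end_lo e <= pos u /\ pos w <= end_hi e,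
     ~~ (end_lo e < pos v < end_hi e) -> ~~ (end_lo e < pos u < end_hi e) &
     ~~ (end_lo e < pos v < end_hi e) -> ~~ (end_lo e < pos w < end_hi e)].
  move=> eD nv -> ->; have h1 := lo_lt nv; have h2 := lt_hi nv.
  have [a [b [ab <- <- lab _]]] := diagonal_edge eD.
  have vl : edge v (lo v) by rewrite edgeC edge_lo.
  have hl : edge (hi v) (lo v) by rewrite edgeC edge_base.
  have hv : edge (hi v) v by rewrite edgeC edge_hi.
  have f1 := edge_inside ab vl; have f2 := edge_inside ab (edge_hi nv).
  have f3 := edge_inside ab (edge_lo nv); have f4 := edge_inside ab (edge_base nv).
  have f5 := edge_inside ab hl; have f6 := edge_inside ab hv.
  by split; lia.
have [/andP[sx sy]|ns] := boolP (source x && source y).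
  have xs : x = s by apply: pos_inj; move: sx; rewrite /source; have := pos_le y; lia.
  have yt : y = t by apply: pos_inj; move: sy; rewrite /source; have := pos_gt0 x; lia.
  exists [::], [::]; rewrite xs yt; split=> //=; first by rewrite orbF inE -pos_eq; lia.
  move=> e eD; have [a [b [ab ea eb lab _]]] := diagonal_edge eD.
  rewrite /min_left !left_of_chain_last /=; have := pos_gt0 a; have := pos_le b; lia.
have notin u R v : path step u R -> last u R != v -> age (last u R) <= age v -> v \notin u :: R.
  move=> uR lv av; apply/negP => /(chain_age uR)[vE|]; first by rewrite -vE eqxx in lv.
  by rewrite ltnNge av.
have [xyage|yxage] := leqP (age x) (age y).
  have ny : ~~ source y.
    by apply: contra ns => sy; move: xyage; rewrite /age sy; case: ifP.
  have hy : step (hi y) y by rewrite /step ny eqxx orbT.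
  have lt1 : age x + age (hi y) < k by have := step_age hy; lia.
  have lt2 : pos x < pos (hi y) by have := lt_hi ny; lia.
  have [P [Q [[sP lP] [tQ lQ] dis tot]]] := IH x (hi y) lt1 lt2.
  exists P, (rcons Q y); rewrite rcons_path last_rcons tQ lQ hy; split=> //.
    rewrite -rcons_cons has_rcons negb_or dis andbT; apply: notin => //.
      by rewrite lP -pos_eq; lia.
    by rewrite lP.
  move=> e eD; have := tot e eD; rewrite -rcons_cons left_of_chain_rcons.
  have [f1 f2 f3 f4] := fact e (lo y) y (hi y) eD ny erefl erefl.
  (* [y] is at least as young as [x], and the ends of a diagonal are older than the vertices
     behind it. *)
  have xin : pos x != pos y -> end_hi e = pos y -> ~~ (end_lo e < pos x < end_hi e).
    move=> nxy bE; have [a [b [ab ea eb lab _]]] := diagonal_edge eD; rewrite -ea -eb; apply/negP => xab.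
    have [_] := age_inside ab xab.
    have -> : b = y by apply: pos_inj; rewrite eb bE.
    by rewrite ltnNge xyage.
  have lQE := @left_of_chain_last e t Q; rewrite lQ in lQE.
  have [yin|yout] := boolP (end_lo e < pos y < end_hi e).
    by move=> ->; rewrite /min_left; clear -f1 f2 yin xy; lia.
  rewrite lQE ?f4 // /min_left; move: (nat_of_bool (left_of_chain _ _)) => label.
  by clear -f1 f4 yout xin xy; lia.
have nx : ~~ source x by apply: contraL yxage => sx; rewrite /age sx -leqNgt.
(* Otherwise [y] would be behind the edge from [x] to [hi x], hence younger than [x]. *)
have jx : ~~ (pos x < pos y < pos (hi x)).
  apply/negP => xin; have [hx _] := age_inside (edge_hi nx) xin.
  by rewrite ltnNge (ltnW yxage) in hx.
have [hy|hy] := eqVneq (hi x) y.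
  have lx : step (lo x) x by rewrite /step nx eqxx.
  have lt1 : age (lo x) + age y < k by have := step_age lx; lia.
  have lt2 : pos (lo x) < pos y by have := lo_lt nx; lia.
  have [P [Q [[sP lP] [tQ lQ] dis tot]]] := IH (lo x) y lt1 lt2.
  exists (rcons P x), Q; rewrite rcons_path last_rcons sP lP lx; split=> //.
    rewrite has_sym -rcons_cons has_rcons negb_or has_sym dis andbT; apply: notin => //.
      by rewrite lQ -pos_eq; lia.
    by rewrite lQ ltnW.
  move=> e eD; have := tot e eD; rewrite -rcons_cons left_of_chain_rcons.
  have [f1 f2 f3 f4] := fact e (lo x) x (hi x) eD nx erefl erefl; rewrite hy in f1 f2 f3 f4.
  have lPE := @left_of_chain_last e s P; rewrite lP in lPE.
  have [xin|xout] := boolP (end_lo e < pos x < end_hi e).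
    by move=> ->; rewrite /min_left; clear -f1 f2 xin xy; lia.
  rewrite lPE ?f3 // /min_left; move: (nat_of_bool (left_of_chain _ (t :: _))) => label.
  by clear -f1 f3 xout xy; lia.
have hx : step (hi x) x by rewrite /step nx eqxx orbT.
have hy' : pos (hi x) < pos y by rewrite -pos_eq in hy; have := lt_hi nx; lia.
have lt1 : age (hi x) + age y < k by have := step_age hx; lia.
have [P [Q [[sP lP] [tQ lQ] dis tot]]] := IH (hi x) y lt1 hy'.
exists (rcons P x), Q; rewrite rcons_path last_rcons sP lP hx; split=> //.
  rewrite has_sym -rcons_cons has_rcons negb_or has_sym dis andbT; apply: notin => //.
    by rewrite lQ -pos_eq; lia.
  by rewrite lQ ltnW.
move=> e eD; have := tot e eD; rewrite -rcons_cons left_of_chain_rcons.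
have [f1 f2 f3 f4] := fact e (lo x) x (hi x) eD nx erefl erefl.
have lPE := @left_of_chain_last e s P; rewrite lP in lPE.
have [xin|xout] := boolP (end_lo e < pos x < end_hi e).
  by move=> ->; rewrite /min_left; clear -f1 f2 xin xy hy'; lia.
rewrite lPE ?f4 // /min_left; move: (nat_of_bool (left_of_chain _ (t :: _))) => label.
by clear -f1 f4 xout xy hy'; lia.
Qed.

(** * Darts and the edges on their left *)

Lemma cyclic_enum c : ~~ source c ->
  enum (triangle c) = [:: lo c; c; hi c] \/ enum (triangle c) = [:: hi c; lo c; c].
Proof.
move=> nc; have h1 := lo_lt nc; have h2 := lt_hi nc.
have lt (u v w : 'I_n) : pos u < pos v -> pos v < pos w -> u < v.
  by move=> uv vw; have v0 := pos_nz vw; case: (pos_lt uv) => // v0'; rewrite v0' in v0.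
have l1 := lt _ _ _ h1 h2.
have [h0|h0] := eqVneq (hi c : nat) 0; [right|left].
  have -> : triangle c = [set hi c; lo c; c] by rewrite /triangle setUC setUA.
  by apply: enum_set3; rewrite ?h0 ?lt0n ?(pos_nz h1).
apply: enum_set3 => //; case: (pos_lt h2) => // h0'; by rewrite h0' in h0.
Qed.

Lemma cyclic_nexts c : ~~ source c ->
  [/\ ccw_in (triangle c) (lo c) = c, ccw_in (triangle c) c = hi c,
      ccw_in (triangle c) (hi c) = lo c, cw_in (triangle c) (lo c) = hi c &
      cw_in (triangle c) c = lo c /\ cw_in (triangle c) (hi c) = c].
Proof.
move=> nc; have h1 := lo_lt nc; have h2 := lt_hi nc; rewrite /ccw_in /cw_in.
have lc : lo c != c by rewrite -pos_eq; lia.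
have lh : lo c != hi c by rewrite -pos_eq; lia.
have ch : c != hi c by rewrite -pos_eq; lia.
have cl := lc; have hl := lh; have hc := ch.
rewrite eq_sym in cl; rewrite eq_sym in hl; rewrite eq_sym in hc.
by have [-> | ->] := cyclic_enum nc; rewrite /= !eqxx ?(negPf lc) ?(negPf lh) ?(negPf ch)
  ?(negPf cl) ?(negPf hl) ?(negPf hc).
Qed.

(** The neighbours of [v] in its triangle, by the place of [v] in the order of the
    positions. *)
Variant vertex_spec t : 'I_n -> 'I_n -> 'I_n -> Prop :=
  | VertexLo c of ~~ source c & t = triangle c : vertex_spec t (lo c) (hi c) c
  | VertexApex c of ~~ source c & t = triangle c : vertex_spec t c (lo c) (hi c)
  | VertexHi c of ~~ source c & t = triangle c : vertex_spec t (hi c) c (lo c).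

Lemma vertexP t v : is_triangle Dd t -> v \in t ->
  vertex_spec t v (cw_in t v) (ccw_in t v).
Proof.
case/triangleP=> c nc ->; have [c1 c2 c3 c4 [c5 c6]] := cyclic_nexts nc.
rewrite in_triangle => /or3P[]/eqP->.
- by rewrite c4 c1; constructor.
- by rewrite c5 c2; constructor.
- by rewrite c6 c3; constructor.
Qed.

Lemma cw_in_mem t v : is_triangle Dd t -> v \in t -> cw_in t v \in t.
Proof.
by move=> tT vt; case: (vertexP tT vt) => c nc ->; rewrite in_triangle !eqxx ?orbT.
Qed.

Lemma ccw_in_mem t v : is_triangle Dd t -> v \in t -> ccw_in t v \in t.
Proof.
by move=> tT vt; case: (vertexP tT vt) => c nc ->; rewrite in_triangle !eqxx ?orbT.
Qed.

Lemma ccw_cw t v : is_triangle Dd t -> v \in t -> ccw_in t (cw_in t v) = v.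
Proof.
move=> tT vt; case: (vertexP tT vt) => c nc ->;
by have [c1 c2 c3 c4 [c5 c6]] := cyclic_nexts nc.
Qed.

Lemma cw_ccw t v : is_triangle Dd t -> v \in t -> cw_in t (ccw_in t v) = v.
Proof.
move=> tT vt; case: (vertexP tT vt) => c nc ->;
by have [c1 c2 c3 c4 [c5 c6]] := cyclic_nexts nc.
Qed.

Lemma edge_cw t v : is_triangle Dd t -> v \in t -> edge v (cw_in t v).
Proof.
move=> tT vt; case: (vertexP tT vt) => c nc _; first exact: edge_base.
  by rewrite edgeC; apply: edge_lo.
by rewrite edgeC; apply: edge_hi.
Qed.

Lemma edge_ccw t v : is_triangle Dd t -> v \in t -> edge v (ccw_in t v).
Proof.
move=> tT vt; case: (vertexP tT vt) => c nc _; first exact: edge_lo.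
  exact: edge_hi.
by rewrite edgeC; apply: edge_base.
Qed.

(** On one side of the edge this is [child_triangle], on the other one
    [parent_triangle]; there is no triangle only outside of the polygon. *)
Lemma cw_triangle_exists v x : edge v x -> x != ordS v ->
  exists t, [/\ is_triangle Dd t, v \in t & cw_in t v = x].
Proof.
move=> vx nS; have vx' : v != x by apply: edge_neq.
have [lvx|lxv|/pos_inj vxE] := ltngtP (pos v) (pos x); last by rewrite vxE eqxx in vx'.
  have [c [nc lc hc]] : exists c, [/\ ~~ source c, lo c = v & hi c = x].
    apply: child_triangle => //; rewrite ltn_neqAle lvx andbT; apply: contra nS => /eqP e.
    by apply/eqP/pos_inj; rewrite pos_ordS -e; case: eqP => //; have := pos_le x; lia.
  exists (triangle c); rewrite -lc -hc; have [_ _ _ -> _] := cyclic_nexts nc.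
  by rewrite is_triangle_triangle // in_triangle eqxx.
have [|[nx hx]|[nv lv]] := parent_triangle (etrans (edgeC x v) vx) lxv.
- move=> [x1 vn]; case/eqP: nS; apply: pos_inj; by rewrite pos_ordS vn eqxx.
- exists (triangle x); rewrite -hx; have [_ _ _ _ [_ ->]] := cyclic_nexts nx.
  by rewrite is_triangle_triangle // in_triangle eqxx !orbT.
- exists (triangle v); rewrite -lv; have [_ _ _ _ [-> _]] := cyclic_nexts nv.
  by rewrite is_triangle_triangle // in_triangle eqxx !orbT.
Qed.

Lemma cw_inE t v x : is_triangle Dd t -> v \in t -> cw_in t v = x ->
  if pos v < pos x then exists c, [/\ ~~ source c, t = triangle c, lo c = v & hi c = x]
  else (~~ source v /\ t = triangle v /\ lo v = x) \/
       (~~ source x /\ t = triangle x /\ hi x = v).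
Proof.
move=> tT vt; case: (vertexP tT vt) => c nc -> <-; have h1 := lo_lt nc; have h2 := lt_hi nc.
- by rewrite (ltn_trans h1 h2); exists c.
- by rewrite ltnNge (ltnW h1); left.
- by rewrite ltnNge (ltnW h2); right.
Qed.

(** By [apex_unique] on one side of the edge, and by [parent_exclusive] on the other. *)
Lemma cw_triangle_unique t t' v : is_triangle Dd t -> is_triangle Dd t' ->
  v \in t -> v \in t' -> cw_in t v = cw_in t' v -> t = t'.
Proof.
move=> tT tT' vt vt'; move xE: (cw_in t' v) => x tx.
have := cw_inE tT vt tx; have := cw_inE tT' vt' xE.
case: ifP => _ [].
  move=> c [nc -> lc hc] [c' [nc' -> lc' hc']]; congr (triangle _).
  by apply: apex_unique => //; rewrite ?lc ?lc' ?hc ?hc'.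
- move=> [nv [-> lv]] [[_ [-> _]]|[nx [-> hx]]] //.
  by case: (parent_exclusive nx nv).
- move=> [nv [-> lv]] [[nv' [-> lv']]|[nx [-> hx]]] //.
  by case: (parent_exclusive nv nv').
Qed.

Variant cw_after_spec v x : pre_dart n -> Prop :=
  | CwTriangle t of is_triangle Dd t & v \in t & cw_in t v = x :
      cw_after_spec v x (polygon_vertex v, center t)
  | CwRay of x = ordS v : cw_after_spec v x (polygon_vertex v, boundary_vertex v).

Lemma cw_afterP v x : edge v x -> cw_after_spec v x (cw_after Dd v x).
Proof.
move=> vx; rewrite /cw_after; case: pickP => [t /and3P[tT vt /eqP tx]|none].
  exact: CwTriangle.
apply: CwRay; apply/eqP/negPn/negP => /(cw_triangle_exists vx)[t [tT vt tx]].
by have := none t; rewrite tT vt tx eqxx.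
Qed.

Lemma cw_after_triangle v t : is_triangle Dd t -> v \in t ->
  cw_after Dd v (cw_in t v) = (polygon_vertex v, center t).
Proof.
move=> tT vt; rewrite /cw_after; case: pickP => [t' /and3P[tT' vt' /eqP tx]|none].
  by rewrite (cw_triangle_unique tT' tT vt' vt tx).
by have := none t; rewrite tT vt eqxx.
Qed.

(** The edge of the triangulation whose face lies to the left of a dart: the faces
    of the plabic graph surround the midpoints of the edges. *)
Definition face_edge (d : pre_dart n) : {set 'I_n} :=
  match d with
  | (inl (inr v), inr t) => [set v; cw_in t v]
  | (inr t, inl (inr v)) => [set v; ccw_in t v]
  | (inl (inl i), inl (inr _)) => [set i; ord_pred i]
  | (inl (inr i), inl (inl _)) => [set i; ordS i]
  | _ => set0
  end.

Variant dart_spec : pre_dart n -> Prop :=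
  | DartIn v : dart_spec (boundary_vertex v, polygon_vertex v)
  | DartOut v : dart_spec (polygon_vertex v, boundary_vertex v)
  | DartTo v t of is_triangle Dd t & v \in t : dart_spec (polygon_vertex v, center t)
  | DartFrom v t of is_triangle Dd t & v \in t : dart_spec (center t, polygon_vertex v).

Definition is_dart (d : pre_dart n) := pre_adj Dd d.1 d.2.

Lemma dartP d : is_dart d -> dart_spec d.
Proof.
case: d => [[[i|v]|t] [[j|w]|t']] //=; rewrite /is_dart /=.
- by move/eqP=> ->; apply: DartIn.
- by move/eqP=> ->; apply: DartOut.
- by case/andP=> ? ?; apply: DartTo.
- by case/andP=> ? ?; apply: DartFrom.
Qed.

Lemma edge_ordS v : edge v (ordS v).
Proof. by rewrite /edge; apply/orP; right; apply/existsP; exists v. Qed.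

Lemma edge_ord_pred v : edge v (ord_pred v).
Proof. by rewrite edgeC -{2}(ord_predK v) edge_ordS. Qed.

Lemma face_next_dart d : is_dart d ->
  is_dart (pre_face_next Dd d) /\ face_edge (pre_face_next Dd d) = face_edge d.
Proof.
have after v x : edge v x ->
    is_dart (cw_after Dd v x) /\ face_edge (cw_after Dd v x) = [set v; x].
  move=> vx; case: (cw_afterP vx) => [t tT vt <-|->]; split => //=.
    by rewrite /is_dart /= tT vt.
  by rewrite /is_dart /= eqxx.
case/dartP=> [v|v|v t tT vt|v t tT vt].
- exact: after (edge_ord_pred v).
- by rewrite /is_dart /= eqxx /pre_face_next /= ordSK setUC.
- rewrite /is_dart /= tT cw_in_mem //; split=> //.
  by rewrite ccw_cw // setUC.
- exact: after (edge_ccw tT vt).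
Qed.

(** * Contraction of the ears *)

Local Notation G0 := (pre_plabic_graph Dd).
Local Notation G := (plabic_graph Dd).
Local Notation pv := (@polygon_vertex n).
Local Notation bv := (@boundary_vertex n).
Local Notation ct := (@center n).

Lemma triangle_of_vertex v : exists c, ~~ source c /\ v \in triangle c.
Proof.
have [sv|nv] := boolP (source v); last by exists v; rewrite in_triangle eqxx orbT.
have [||r r1] := @pos_surj n 1 => //; first lia.
have [||s sn] := @pos_surj n n => //; first lia.
have [z [nz lz hz]] := child_triangle (edge_root r1 sn) ltac:(lia).
exists z; rewrite in_triangle lz hz -!pos_eq r1 sn; split=> //.
by move: sv; rewrite /source => /orP[->|->]; rewrite ?orbT.
Qed.

Lemma ear_tip_ear v c : ear_tip v -> ~~ source c -> v \in triangle c -> ear v = triangle c.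
Proof. by move=> ev nc vc; rewrite (ear_tip_triangle ev (is_triangle_triangle nc) vc). Qed.

Lemma apex_in_triangle c : c \in triangle c.
Proof. by rewrite in_triangle eqxx orbT. Qed.

Lemma ear_tip_apex v : ear_tip v -> ~~ source v -> ear v = triangle v.
Proof. by move=> ev nv; apply: ear_tip_ear => //; apply: apex_in_triangle. Qed.

Definition mono (d : pre_dart n) := monochromatic G0 d.

Lemma mono_to v t : mono (pv v, ct t) = ear_tip v.
Proof. by rewrite /mono /monochromatic /head_of /= /ear_tip; case: ifP. Qed.

Lemma mono_from v t : mono (ct t, pv v) = ear_tip v.
Proof. by rewrite -(mono_to v t) /mono /monochromatic eq_sym. Qed.

Lemma mono_in v w : mono (bv v, pv w) = false.
Proof. by rewrite /mono /monochromatic /head_of /=; case: ifP. Qed.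

Lemma mono_out v w : mono (pv w, bv v) = false.
Proof. by rewrite /mono /monochromatic /head_of /=; case: ifP. Qed.

Definition monoE := (mono_to, mono_from, mono_in, mono_out).

(** A concrete name for the vertices of the contracted graph: the only contracted
    edges join the tip of an ear to the center of its triangle. *)
Definition contracted (x : pre_vertex n) : pre_vertex n :=
  if x is inl (inr v) then if ear_tip v then ct (ear v) else x else x.

Lemma contracted_mono d : is_dart d -> mono d -> contracted d.1 = contracted d.2.
Proof.
case/dartP=> [v|v|v t tT vt|v t tT vt]; rewrite monoE // => ev /=.
  by rewrite ev (ear_tip_triangle ev tT vt).
by rewrite ev (ear_tip_triangle ev tT vt).
Qed.

Lemma is_dart_opp d : is_dart (d.2, d.1) = is_dart d.
Proof. by case: d => [[[i|v]|t] [[j|w]|t']] //=; rewrite /is_dart /= 1?eq_sym. Qed.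

Definition contract_root (x : pre_vertex n) := fingraph.root (mono_adj G0) x.

Lemma mono_adjP x y : reflect (is_dart (x, y) /\ mono (x, y)) (mono_adj G0 x y).
Proof.
apply: (iffP exists_inP) => [[[a b]]|[p m]].
  by rewrite inE => p /and3P[/eqP <- /eqP <- m].
by exists (x, y); rewrite ?inE //= !eqxx.
Qed.

Lemma mono_adj_sym : ssrbool.symmetric (mono_adj G0).
Proof.
have h x y : mono_adj G0 x y -> mono_adj G0 y x.
  case/mono_adjP=> p m; apply/mono_adjP; split; first by rewrite (is_dart_opp (x, y)).
  by rewrite /mono /monochromatic eq_sym.
by move=> x y; apply/idP/idP; apply: h.
Qed.

(** [contracted] is constant along contracted edges, and it joins each vertex to its
    image by such an edge. *)
Lemma contract_root_eq x y : (contract_root x == contract_root y) = (contracted x == contracted y).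
Proof.
have csym := sym_connect_sym mono_adj_sym; rewrite /contract_root root_connect //.
have step1 z w : connect (mono_adj G0) z w -> contracted z = contracted w.
  case/connectP=> p; elim: p z => [|u p IH] z /=; first by move=> _ ->.
  by case/andP=> /mono_adjP[pz mz] up lp; rewrite (contracted_mono pz mz) (IH u).
have to_contracted z : connect (mono_adj G0) z (contracted z).
  case: z => [[i|v]|t]; rewrite ?connect0 //= /contracted; case: ifP => ev; rewrite ?connect0 //.
  apply/connect1/mono_adjP; rewrite monoE ev; split=> //.
  have [c [nc vc]] := triangle_of_vertex v.
  by rewrite /is_dart /= (ear_tip_ear ev nc vc) is_triangle_triangle.
apply/idP/eqP => [/step1//|xy]; apply: connect_trans (to_contracted x) _.
by rewrite xy csym.
Qed.

Lemma contracted_contract_root x : contracted (contract_root x) = contracted x.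
Proof.
apply/eqP; rewrite -contract_root_eq /contract_root root_root //; exact: sym_connect_sym mono_adj_sym.
Qed.

Definition plabic_dart d := is_dart d && ~~ mono d.

Lemma darts_plabic d : (d \in darts G) = plabic_dart d.
Proof. by rewrite !inE. Qed.

Lemma contract_root_white v : ~~ ear_tip v -> contract_root (pv v) = pv v.
Proof.
move=> wv; have := contracted_contract_root (pv v); rewrite [RHS]/contracted /= (negPf wv).
case: (contract_root (pv v)) => [[i|w]|t] //=; by case: ifP.
Qed.

Lemma color_contract_root_center t : pre_color Dd (contract_root (ct t)) = black.
Proof.
have := contracted_contract_root (ct t); rewrite [RHS]/contracted /=.
case: (contract_root (ct t)) => [[i|w]|t'] //=; case: ifP => // ew _.
by rewrite (negPf ew).
Qed.

(** * The perfect orientation *)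

Definition is_apex t v := ~~ source v && (t == triangle v).

(** The orientation in which every triangle points to its apex.  On the darts at an
    ear tip, which disappear in the contraction, it is the direction in which a
    directed path passes. *)
Definition outward (d : pre_dart n) : bool :=
  match d with
  | (inl (inl v), _) => source v
  | (inl (inr v), inl _) => ~~ source v
  | (inl (inr v), inr t) => ~~ is_apex t v
  | (inr t, inl (inr v)) => is_apex t v
  | _ => false
  end.

Lemma is_apex_triangle c v : ~~ source c -> is_apex (triangle c) v = (v == c).
Proof.
move=> nc; apply/andP/eqP => [[nv /eqP cv]|->//]; exact: triangle_inj.
Qed.

Section Orientation.
Variable O : {set pre_dart n}.
Hypothesis hO : perfect_orientation G O.
Hypothesis hsrc : source_set G O = [set i : 'I_n | (i < 2)%N].

Lemma plabic_dart_in v : plabic_dart (bv v, pv v).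
Proof. by rewrite /plabic_dart monoE /is_dart /= eqxx. Qed.

Lemma plabic_dart_out v : plabic_dart (pv v, bv v).
Proof. by rewrite /plabic_dart monoE /is_dart /= eqxx. Qed.

Lemma oriented_opp d : plabic_dart d -> ((d.2, d.1) \in O) = (d \notin O).
Proof.
case: hO => _ h _ _ gd; have := h d; rewrite darts_plabic => /(_ gd).
by rewrite /= /pre_opp; do 2 case: (_ \in O).
Qed.

Lemma oriented_plabic_dart d : d \in O -> plabic_dart d.
Proof. by case: hO => /subsetP s _ _ _ /s; rewrite darts_plabic. Qed.

Lemma oriented_in v : ((bv v, pv v) \in O) = source v.
Proof.
move/setP/(_ v): hsrc; rewrite !inE /= /pre_ray => ->; by rewrite sourceE.
Qed.

Lemma oriented_out v : ((pv v, bv v) \in O) = ~~ source v.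
Proof. by rewrite -oriented_in -(oriented_opp (plabic_dart_in v)). Qed.

Lemma white_unique v d d' : ~~ ear_tip v -> d \in O -> d' \in O -> d.2 = pv v -> d'.2 = pv v ->
  d = d'.
Proof.
move=> wv dO dO' dv dv'; case: hO => _ _ h _.
have vV : contract_root (pv v) \in vertices G.
  by apply/imsetP; exists (pv v, bv v); rewrite ?darts_plabic ?plabic_dart_out.
have cw : pre_color Dd (pv v) = white by move: (wv); rewrite /ear_tip negbK /= => ->.
have := h _ vV; rewrite contract_root_white // => /(_ cw) /eqP/cards1P[d0 dE].
have inE0 e : e \in O -> e.2 = pv v -> e = d0.
  move=> eO ev; apply/set1P; rewrite -dE inE eO /=.
  by rewrite /head_of /= -/(contract_root e.2) ev contract_root_white //  negbK.
by rewrite (inE0 d) // (inE0 d').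
Qed.

(** The center of a triangle and the tip of an ear are one vertex of the contracted
    graph, so the outgoing arrow may also be the ray at the tip. *)
Lemma black_out c : ~~ source c ->
  exists2 d, d \in O & contracted d.1 = ct (triangle c).
Proof.
move=> nc; case: hO => _ _ _ h.
have tV : contract_root (ct (triangle c)) \in vertices G.
  have [ec|wc] := boolP (ear_tip c).
    apply/imsetP; exists (pv c, bv c); rewrite ?darts_plabic ?plabic_dart_out //.
    by apply/eqP; rewrite -!/(contract_root _) contract_root_eq /= ec ear_tip_apex.
  apply/imsetP; exists (ct (triangle c), pv c); rewrite // darts_plabic /plabic_dart monoE wc andbT.
  by rewrite /is_dart /= is_triangle_triangle // apex_in_triangle.
have := h _ tV (color_contract_root_center _) => /eqP/cards1P[d dE].
have : d \in [set d] by rewrite set11.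
rewrite -dE inE => /andP[dO]; rewrite /= -/(contract_root d.1) contract_root_eq => /eqP e.
by exists d.
Qed.

(** By induction, from the edge that joins the sources: the two vertices of the base
    have their incoming arrow already, from a ray or from a triangle of larger span,
    so that the outgoing arrow of the triangle can only go to the apex. *)
Lemma oriented_from c v : ~~ source c -> v \in triangle c -> ~~ ear_tip v ->
  ((ct (triangle c), pv v) \in O) = (v == c).
Proof.
move=> nc; have [k] := ubnP (n - span c); elim: k c v nc => // k IH c v nc ck vc wv.
(* No arrow leads from the triangle to a vertex that has its incoming arrow elsewhere. *)
have other w : w \in triangle c -> ~~ ear_tip w -> w != c ->
    (ct (triangle c), pv w) \notin O.
  move=> wc ww nwc; apply/negP => cw; have [sw|nw] := boolP (source w).
    have rw : (bv w, pv w) \in O by rewrite oriented_in.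
    by have := white_unique ww cw rw erefl erefl.
  have Tw : (ct (triangle w), pv w) \in O.
    rewrite IH // ?eqxx ?apex_in_triangle //; have := span_parent nc nw wc nwc.
    have := pos_le (hi w); have := lt_hi nw; have := lo_lt nw; rewrite /span in ck *; lia.
  have [/triangle_inj E] := white_unique ww cw Tw erefl erefl.
  by rewrite E ?eqxx in nwc.
have [vE|vc'] := eqVneq v c; last by apply/negbTE/other.
subst v.
have [d dO dc] := black_out nc; have /andP[pd md] := oriented_plabic_dart dO.
case/dartP: pd md dO dc => [w|w|w t tT wt|w t tT wt]; rewrite monoE //= => mw dO.
- case: ifP => // ew [wE]; have nw : ~~ source w by rewrite -oriented_out.
  move: wE; rewrite ear_tip_apex // => /triangle_inj E.
  by rewrite -E // ew in wv.
- by rewrite (negPf mw).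
- case=> tE; subst t; have [wE|nwc] := eqVneq w c; first by rewrite wE in dO.
  by have := other w wt mw nwc; rewrite dO.
Qed.

Lemma orientedE d : plabic_dart d -> (d \in O) = outward d.
Proof.
case/andP=> pd; case/dartP: pd => [v|v|v t tT vt|v t tT vt]; rewrite monoE /= => m.
- exact: oriented_in.
- exact: oriented_out.
- have gd : plabic_dart (ct t, pv v) by rewrite /plabic_dart monoE m /is_dart /= tT vt.
  rewrite (oriented_opp gd); move: vt; case/triangleP: tT => c nc -> vt.
  by rewrite oriented_from // is_apex_triangle.
- move: vt; case/triangleP: tT => c nc -> vt.
  by rewrite oriented_from // is_apex_triangle.
Qed.

End Orientation.

(** * Directed paths *)

(** The darts of the path through the chain [v :: P] before the contraction, after the
    ray at the start. *)
Fixpoint tail_darts v (P : seq 'I_n) : seq (pre_dart n) :=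
  if P is y :: P' then
    (pv v, ct (triangle y)) :: (ct (triangle y), pv y) :: tail_darts y P'
  else [:: (pv v, bv v)].

Definition full_darts s P := (bv s, pv s) :: tail_darts s P.

Definition visible := filter (fun d => ~~ mono d).

Definition chain_path s P := visible (full_darts s P).

Lemma step_outward v y : step v y ->
  is_dart (pv v, ct (triangle y)) && ~~ is_apex (triangle y) v.
Proof.
move=> vy; have [ny vt nvy] := step_triangle vy.
by rewrite /is_dart /= is_triangle_triangle // vt is_apex_triangle.
Qed.

Lemma apex_outward y : ~~ source y -> is_dart (ct (triangle y), pv y) && is_apex (triangle y) y.
Proof.
by move=> ny; rewrite /is_dart /= is_triangle_triangle // apex_in_triangle is_apex_triangle //=.
Qed.

Lemma step_nsource v y : step v y -> ~~ source y.
Proof. by case/andP. Qed.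

Lemma last_nsource v P : path step v P -> ~~ source v -> ~~ source (last v P).
Proof.
elim: P v => //= y P IH v /andP[vy yP] _; apply: IH => //; exact: step_nsource vy.
Qed.

Lemma tail_darts_outward v P : path step v P -> ~~ source (last v P) ->
  all (fun d => is_dart d && outward d) (tail_darts v P).
Proof.
elim: P v => [|y P IH] v /=; first by rewrite /is_dart /= eqxx => _ ->.
case/andP=> vy yP lP; rewrite (IH y) // andbT.
by have /andP[-> ->] := step_outward vy; have /andP[-> ->] := apex_outward (step_nsource vy).
Qed.

Definition consecutive (x y : pre_dart n) := contracted x.2 == contracted y.1.

Lemma consecutiveE (x y : pre_dart n) : (head_of G x == tail G y) = consecutive x y.
Proof. by rewrite /consecutive -contract_root_eq. Qed.

Section Oriented.
Variable O : {set pre_dart n}.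
Hypothesis hO : perfect_orientation G O.
Hypothesis hsrc : source_set G O = [set i : 'I_n | (i < 2)%N].

Lemma contracted_center x c : ~~ source c -> contracted x = ct (triangle c) ->
  x = ct (triangle c) \/ exists2 w, x = pv w & ear_tip w /\ ear w = triangle c.
Proof.
move=> nc; case: x => [[i|w]|t] //= ; last by left.
by case: ifP => // ew [e]; right; exists w.
Qed.

Lemma contracted_polygon x v : contracted x = pv v -> x = pv v.
Proof. by case: x => [[i|w]|t] //=; case: ifP. Qed.

Lemma contracted_white v : ~~ ear_tip v -> contracted (pv v) = pv v.
Proof. by move=> wv; rewrite /contracted /= (negPf wv). Qed.

Lemma contracted_boundary x v : contracted x = bv v -> x = bv v.
Proof. by case: x => [[i|w]|t] //=; case: ifP. Qed.

Lemma out_ends v (q : seq (pre_dart n)) : ~~ source v -> all (mem O) q ->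
  path consecutive (pv v, bv v) q -> q = [::].
Proof.
move=> nv; case: q => // d q /= /andP[dO _] /andP[/eqP /esym /contracted_boundary dv _].
have gd := oriented_plabic_dart hO dO; move: dO; rewrite (orientedE hO hsrc gd).
by case: d dv {gd} => x y /= ->; rewrite /= (negPf nv).
Qed.

(** A directed path alternates between polygon vertices and centers of triangles, and
    [orientedE] leaves only the apex as a way out of a triangle.  The two parts follow
    the path from a vertex of either kind. *)
Lemma extract_tail t d q : all (mem O) (d :: q) -> path consecutive d q ->
  last d q = (pv t, bv t) ->
  (forall v, contracted d.1 = pv v -> ~~ ear_tip v ->
    exists P, [/\ path step v P, last v P = t & d :: q = visible (tail_darts v P)]) /\
  (forall c, ~~ source c -> contracted d.1 = ct (triangle c) ->
    exists P, [/\ path step c P, last c P = t &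
      d :: q = visible ((ct (triangle c), pv c) :: tail_darts c P)]).
Proof.
elim: q d => [|d' q IH] d; rewrite [all _ _]/= [path _ _ _]/= [last _ _]/=.
  rewrite andbT => dO _ dE; subst d; have := dO.
  rewrite (orientedE hO hsrc (oriented_plabic_dart hO dO)) [outward _]/= => nt.
  split=> [v /contracted_polygon /= -[<-] wt|c nc].
    by exists [::]; rewrite /visible /= monoE.
  case/(contracted_center nc) => [//|[w /= [<-] [et e]]]; exists [::].
  rewrite /visible /= !monoE.
  move: e; rewrite ear_tip_apex // => /(triangle_inj nt nc) <-.
  by rewrite et.
case/and3P=> dO dO' qO /andP[dd' q'] lq.
have gd := oriented_plabic_dart hO dO; have := dO; rewrite (orientedE hO hsrc gd).
have dq : d' :: q <> [::] by [].
have dqO : all (mem O) (d' :: q) by rewrite /= dO' qO.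
have [IHv IHc] := IH d' dqO q' lq.
case/andP: gd => pd; case/dartP: pd dO dd' => [v|v|v t' tT vt|v t' tT vt] dO dd';
  rewrite monoE [outward _]/=.
- by split=> [w|c nc] //.
- by move=> _ nv; case: dq; apply: (out_ends nv dqO); rewrite /= dd' q'.
- move: vt dO dd'; case/triangleP: tT => c nc -> vt dO dd' wv.
  rewrite is_apex_triangle // => vc; split=> [w /contracted_polygon /= -[<-] ww|w nw].
    have vc' : step v c.
      by rewrite /step nc /=; move: vt; rewrite in_triangle (negPf vc).
    have [P [cP lP qE]] := IHc c nc (esym (eqP dd')); exists (c :: P).
    by rewrite /= vc' lP qE /visible /= !monoE wv.
  by case/(contracted_center nw) => [//|[w' /= [<-] [ew _]]]; rewrite ew in wv.
- move: vt dO dd'; case/triangleP: tT => c nc -> vt dO dd' wv.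
  rewrite is_apex_triangle // => /eqP vc; subst v; split=> [//|c' nc'].
  case/(contracted_center nc') => [|[] //] /= -[] /triangle_inj E.
  rewrite -E //; have dc : contracted d'.1 = pv c by rewrite -(eqP dd') contracted_white.
  have [P [cP lP qE]] := IHv c dc wv.
  by exists P; rewrite qE /visible /= !monoE wv.
Qed.

(** When the starting vertex is the tip of an ear, the path continues directly from
    the center of the ear, and the chain contains a step that the path does not show. *)
Lemma extract s t p : source s -> ~~ source t -> is_dpath G O s t p ->
  exists P, [/\ path step s P, last s P = t & p = chain_path s P].
Proof.
move=> ss nt; case: p => // d q /and5P[/= /andP[dO qO] /eqP dE /eqP lq cq _].
subst d; have {}cq : path consecutive (bv s, pv s) q.
  by apply: sub_path cq => x y; rewrite consecutiveE.
case: q qO lq cq => [|d q] //= /andP[dO' qO] lq /andP[sd dq].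
have dqO : all (mem O) (d :: q) by rewrite /= dO' qO.
have [hv hc] := extract_tail dqO dq lq.
rewrite /chain_path /visible /full_darts /= monoE /=.
have [es|ws] := boolP (ear_tip s); last first.
  have ds : contracted d.1 = pv s by rewrite -(eqP sd) contracted_white.
  by have [P [sP lP ->]] := hv s ds ws; exists P.
have [c [nc sc]] := triangle_of_vertex s.
have ds : contracted d.1 = ct (triangle c).
  by rewrite -(eqP sd) /contracted /= es (ear_tip_ear es nc sc).
have [P [cP lP ->]] := hc c nc ds; exists (c :: P); split=> //.
  have nsc : s != c by apply: contraNneq nc => <-.
  by rewrite /= cP andbT /step nc /=; move: sc; rewrite in_triangle (negPf nsc).
by rewrite /visible /= !monoE es.
Qed.

(** Recovers a vertex of the chain from a contracted vertex on its path, which reduces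
    the disjointness of paths to that of chains. *)
Definition owner (x : pre_vertex n) : option 'I_n :=
  match x with
  | inl (inl v) => Some v
  | inl (inr v) => Some v
  | inr t => [pick c | ~~ source c && (t == triangle c)]
  end.

Lemma owner_center c : ~~ source c -> owner (ct (triangle c)) = Some c.
Proof.
move=> nc; rewrite /owner /=; case: pickP => [d /andP[nd /eqP/triangle_inj->//]|].
by move/(_ c); rewrite nc eqxx.
Qed.

(** A potential which increases along the arrows; the value at the sinks only has to
    exceed the others. *)
Definition rank (x : pre_vertex n) : nat :=
  match x with
  | inl (inl v) => if source v then 0 else (2 * n + 10)
  | inl (inr v) => (2 * age v + 1)
  | inr t => if owner (ct t) is Some c then 2 * age c else 0
  end%N.

Lemma rank_center c : ~~ source c -> rank (ct (triangle c)) = (2 * age c)%N.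
Proof.
move=> nc; rewrite -[rank _]/(if owner (ct (triangle c)) is Some d then 2 * age d else 0)%N.
by rewrite owner_center.
Qed.

Lemma age_gt0 c : ~~ source c -> (0 < age c <= n.+1)%N.
Proof. by move=> nc; rewrite /age (negPf nc); lia. Qed.

Lemma rank_source v : source v -> rank (bv v) = 0%N.
Proof. by move=> sv; rewrite /rank /= sv. Qed.

Lemma rank_sink v : ~~ source v -> rank (bv v) = (2 * n + 10)%N.
Proof. by move=> nv; rewrite /rank /= (negPf nv). Qed.

Lemma rank_polygon v : rank (pv v) = (2 * age v + 1)%N.
Proof. by []. Qed.

Lemma rank_lt d : plabic_dart d -> outward d -> (rank (contracted d.1) < rank (contracted d.2))%N.
Proof.
case/andP=> pd; case/dartP: pd => [v|v|v t tT vt|v t tT vt]; rewrite monoE.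
- move=> _ sv; rewrite [contracted (_, _).1]/= rank_source // /contracted /=.
  case: ifP => ev; last by rewrite rank_polygon addn1.
  have [c [nc vc]] := triangle_of_vertex v; rewrite (ear_tip_ear ev nc vc).
  by rewrite rank_center //; have := age_gt0 nc; lia.
- move=> _ nv; have := age_gt0 nv; rewrite [contracted (_, _).2]/= [rank (bv _)]rank_sink // /contracted /=.
  case: ifP => ev; first by rewrite ear_tip_apex // rank_center //; lia.
  by rewrite rank_polygon; lia.
- move=> wv; move: vt; case/triangleP: tT => c nc -> vt.
  rewrite [outward _]/= is_apex_triangle // => vc; rewrite contracted_white // [contracted _]/=.
  have vc' : step v c by rewrite /step nc /=; move: vt; rewrite in_triangle (negPf vc).
  by have := step_age vc'; rewrite rank_center // rank_polygon; lia.
- move=> wv; move: vt; case/triangleP: tT => c nc -> vt.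
  rewrite [outward _]/= is_apex_triangle // => /eqP vc; rewrite contracted_white // vc [contracted _]/=.
  by rewrite rank_center // rank_polygon; lia.
Qed.

(** The vertices of a directed path have increasing [rank]. *)
Lemma path_vertices_uniq d q :
  all (fun d => plabic_dart d && outward d) (d :: q) -> path consecutive d q ->
  uniq (path_vertices G (d :: q)).
Proof.
move=> al dq; rewrite /path_vertices.
have hE : map (head_of G) (d :: q) = map contract_root (map snd (d :: q)) by rewrite -map_comp.
rewrite hE -[tail G d]/(contract_root d.1) -[_ :: _]/(map contract_root (d.1 :: map snd (d :: q))).
apply: (@map_uniq _ _ (rank \o contracted)); rewrite -map_comp.
have -> : [seq ((rank \o contracted) \o contract_root) i | i <- d.1 :: map snd (d :: q)] =
    map (rank \o contracted) (d.1 :: map snd (d :: q)).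
  by apply: eq_map => x /=; rewrite contracted_contract_root.
apply: (sorted_uniq ltn_trans ltnn).
rewrite /= ; elim: q d al dq {hE} => [|e q IH] d /=.
  by rewrite andbT => /andP[gd od] _; rewrite rank_lt.
case/andP=> /andP[gd od] al /andP[/eqP de eq]; rewrite rank_lt //= de.
exact: IH.
Qed.

Definition joined (d e : pre_dart n) := d.2 == e.1.

Lemma joined_path d q : path joined (d.2, d.2) q = path joined d q.
Proof. by case: q. Qed.

(** Removing contracted darts keeps consecutive darts joined in the contracted
    graph. *)
Lemma visible_consecutive z x q : contracted z.2 = contracted x ->
  all is_dart q -> path joined (x, x) q -> path consecutive z (visible q).
Proof.
elim: q z x => //= d q IH z x zx /andP[pd pq] /andP[/eqP /= xd dq].
have dq' : path joined (d.2, d.2) q by rewrite joined_path.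
have [md|nmd] := boolP (mono d) => /=.
  by apply: (IH z d.2) => //; rewrite zx xd contracted_mono.
by rewrite /consecutive zx xd eqxx; apply: (IH d d.2).
Qed.

Lemma full_darts_path v P : path joined (pv v, pv v) (tail_darts v P).
Proof.
elim: P v => [|y P IH] v /=; first by rewrite /joined eqxx.
by rewrite {1 2}/joined !eqxx -joined_path; exact: IH.
Qed.

Lemma chain_path_cons s P : chain_path s P = (bv s, pv s) :: visible (tail_darts s P).
Proof. by rewrite /chain_path /visible /full_darts /= monoE. Qed.

Lemma last_visible s P d : last d (visible (tail_darts s P)) = (pv (last s P), bv (last s P)).
Proof.
elim: P s d => [|y P IH] s d /=; first by rewrite monoE.
rewrite /visible /= -!/(visible _); case: ifP => _; case: ifP => _ /=; exact: IH.
Qed.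

Lemma chain_path_outward s P : path step s P -> source s -> ~~ source (last s P) ->
  all (fun d => plabic_dart d && outward d) (chain_path s P).
Proof.
move=> sP ss nl; rewrite chain_path_cons /= plabic_dart_in ss /=.
apply/allP => d; rewrite mem_filter => /andP[nm dt].
by have /allP/(_ d dt)/andP[pd od] := tail_darts_outward sP nl; rewrite /plabic_dart pd nm.
Qed.

Lemma chain_path_consecutive s P : path step s P -> ~~ source (last s P) ->
  path consecutive (bv s, pv s) (visible (tail_darts s P)).
Proof.
move=> sP nl; apply: (visible_consecutive (x := pv s)) => //; last exact: full_darts_path.
by apply: sub_all (tail_darts_outward sP nl) => d /andP[].
Qed.

Lemma chain_path_dpath s P : path step s P -> source s -> ~~ source (last s P) ->
  is_dpath G O s (last s P) (chain_path s P).
Proof.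
move=> sP ss nl; have al := chain_path_outward sP ss nl.
have co := chain_path_consecutive sP nl; rewrite chain_path_cons in al *.
apply/and5P; split.
- apply: sub_all al => d /andP[gd od]; by rewrite /= (orientedE hO hsrc gd).
- exact: eqxx.
- by rewrite last_visible.
- by apply: sub_path co => x y; rewrite consecutiveE.
- exact: path_vertices_uniq.
Qed.

Lemma chain_path_uniq s P : path step s P -> source s -> ~~ source (last s P) ->
  uniq (chain_path s P).
Proof.
move=> sP ss nl; have := chain_path_dpath sP ss nl; rewrite chain_path_cons.
by case/and5P=> _ _ _ _; rewrite /path_vertices cons_uniq => /andP[_ /map_uniq].
Qed.

Lemma owner_chain s P x : path step s P -> source s -> ~~ source (last s P) ->
  x \in bv s :: map snd (full_darts s P) -> exists2 v, v \in s :: P & owner (contracted x) = Some v.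
Proof.
move=> sP ss nl; rewrite inE => /orP[/eqP ->|]; first by exists s; rewrite ?mem_head.
rewrite inE => /orP[/eqP ->|].
  rewrite [contracted _]/=; case: ifP => es; last by exists s; rewrite ?mem_head.
  case: P sP nl => [|y P]; first by rewrite /= ss.
  case/andP=> sy _ _; have [ny sty _] := step_triangle sy.
  by exists y; rewrite ?inE ?eqxx ?orbT // (ear_tip_ear es ny sty) owner_center.
elim: P s sP {ss} nl => [|y P IH] s /=.
  by rewrite inE => _ _ /eqP ->; exists s; rewrite ?mem_head.
case/andP=> sy yP nl; have ny := step_nsource sy.
have yin : y \in [:: s, y & P] by rewrite !inE eqxx orbT.
rewrite inE => /orP[/eqP ->|]; first by exists y; rewrite // owner_center.
rewrite inE => /orP[/eqP ->|xP].
  exists y; rewrite // [contracted _]/=; case: ifP => // ey.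
  by rewrite ear_tip_apex // owner_center.
by have [v vP ov] := IH y yP nl xP; exists v => //; rewrite inE vP orbT.
Qed.

Lemma chain_path_vertices s P x : path step s P -> source s -> ~~ source (last s P) ->
  x \in path_vertices G (chain_path s P) -> exists2 v, v \in s :: P & owner (contracted x) = Some v.
Proof.
move=> sP ss nl; rewrite chain_path_cons => xv.
have [y ys ->] : exists2 y, y \in bv s :: map snd (full_darts s P) & x = contract_root y.
  move: xv; rewrite inE => /orP[/eqP ->|]; first by exists (bv s); rewrite ?mem_head.
  case/mapP=> d dp ->; exists d.2 => //; rewrite inE map_f ?orbT //.
  by move: dp; rewrite -chain_path_cons mem_filter => /andP[].
by rewrite contracted_contract_root; apply: owner_chain.
Qed.

(** Disjoint chains give paths that do not share the center of a triangle either,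
    because the center of a triangle is only crossed on the way to its apex. *)
Lemma chain_paths_disjoint s t P Q : path step s P -> path step t Q -> source s -> source t ->
  ~~ source (last s P) -> ~~ source (last t Q) -> ~~ has (mem (s :: P)) (t :: Q) ->
  ~~ has (mem (path_vertices G (chain_path s P))) (path_vertices G (chain_path t Q)).
Proof.
move=> sP tQ ss st nP nQ; apply: contra => /hasP[x xQ xP].
have [v vP ov] := chain_path_vertices sP ss nP xP.
have [w wQ ow] := chain_path_vertices tQ st nQ xQ.
by apply/hasP; exists w => //=; move: ow; rewrite ov => -[<-].
Qed.

(** The contracted darts that are left out do not lead to new vertices of the
    contracted graph. *)
Lemma visible_vertices x z q : contract_root x = contract_root z ->
  all is_dart q -> path joined (x, x) q ->
  {in map snd q, forall y, contract_root y \in contract_root z :: map (head_of G) (visible q)}.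
Proof.
elim: q x z => //= d q IH x z xz /andP[pd pq] /andP[/eqP /= xd dq] y.
have dq' : path joined (d.2, d.2) q by rewrite joined_path.
have [md|nmd] := boolP (mono d) => /=.
  have dz : contract_root d.2 = contract_root z by rewrite -xz xd; apply/eqP; rewrite contract_root_eq contracted_mono.
  rewrite inE => /orP[/eqP ->|yq]; last exact: (IH d.2 z).
  by rewrite dz mem_head.
rewrite inE => yq; rewrite inE; apply/orP; right; case/orP: yq => [/eqP ->|yq].
  exact: mem_head.
exact: (IH d.2 d.2).
Qed.

Lemma mem_path_vertices s P v : path step s P -> ~~ source (last s P) -> v \in s :: P ->
  contract_root (pv v) \in path_vertices G (chain_path s P).
Proof.
move=> sP nl vP; rewrite chain_path_cons inE; apply/orP; right.
have pq : all is_dart (tail_darts s P).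
  by apply: sub_all (tail_darts_outward sP nl) => d /andP[].
rewrite -[X in _ \in X]/(contract_root (pv s) :: map (head_of G) (visible (tail_darts s P))).
move: vP; rewrite inE => /orP[/eqP ->|vP]; first exact: mem_head.
apply: (visible_vertices (x := pv s)) => //; first exact: full_darts_path.
elim: P s vP {sP nl pq} => //= y P IH s; rewrite inE => /orP[/eqP ->|vP].
  by rewrite !inE eqxx orbT.
by rewrite 2!inE IH ?orbT.
Qed.

End Oriented.

(** * The faces of the plabic graph *)

Local Notation f := (pre_face_next Dd).

(** The inner side of the edge from [w] to [ordS w] sees [ordS w] as the
    counterclockwise neighbour of [w]. *)
Lemma cw_not_ordS t w : is_triangle Dd t -> w \in t -> cw_in t w <> ordS w.
Proof.
move=> tT wt e; have := cw_inE tT wt e; rewrite pos_ordS; case: eqP => wn.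
  rewrite ltnNge pos_gt0 /= => -[[nw _]|[nS _]].
    by rewrite /source wn eqxx orbT in nw.
  by rewrite /source pos_ordS wn !eqxx in nS.
rewrite ltnSn => -[c [nc _ lc hc]]; have := lo_lt nc; have := lt_hi nc.
by rewrite lc hc pos_ordS; case: eqP => //; lia.
Qed.

Lemma ordS2_neq (v : 'I_n) : ordS (ordS v) != v.
Proof. by rewrite -pos_eq !pos_ordS; case: (pos v =P n) => ?; case: (_ =P n) => ?; have := pos_gt0 v; lia. Qed.

Lemma cw_after_eq t v x : is_triangle Dd t -> v \in t -> cw_in t v = x ->
  cw_after Dd v x = (pv v, ct t).
Proof. by move=> tT vt <-; exact: cw_after_triangle. Qed.

Lemma ccw_eq t v x : is_triangle Dd t -> v \in t -> cw_in t v = x -> ccw_in t x = v.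
Proof. by move=> tT vt <-; exact: ccw_cw. Qed.

Lemma cw_eq t v x : is_triangle Dd t -> v \in t -> ccw_in t v = x -> cw_in t x = v.
Proof. by move=> tT vt <-; exact: cw_ccw. Qed.

(** A diagonal has two darts in each of its two triangles; a side has two darts in its
    only triangle and two on the rays at its ends. *)
Lemma face_cycle u v : edge u v -> exists d0, [/\ is_dart d0, iter 4 f d0 = d0 &
  forall x, is_dart x -> face_edge x = [set u; v] -> exists2 i, i < 4 & x = iter i f d0].
Proof.
have toE t w : is_triangle Dd t -> w \in t ->
    f (pv w, ct t) = (ct t, pv (cw_in t w)) by [].
have fromE t w : f (ct t, pv w) = cw_after Dd w (ccw_in t w) by [].
(* The face of a side: out and in along the rays, then through the triangle. *)
have sideC v0 : exists d0, [/\ is_dart d0, iter 4 f d0 = d0 &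
  forall x, is_dart x -> face_edge x = [set v0; ordS v0] -> exists2 i, i < 4 & x = iter i f d0].
  have edgeS : edge (ordS v0) v0 by rewrite edgeC edge_ordS.
  have [|t [tT St tS]] := cw_triangle_exists edgeS; first by rewrite eq_sym ordS2_neq.
  have vt : v0 \in t by rewrite -tS cw_in_mem.
  have f0 : f (pv v0, bv v0) = (bv (ordS v0), pv (ordS v0)) by [].
  have f1 : f (bv (ordS v0), pv (ordS v0)) = (pv (ordS v0), ct t).
    have -> : f (bv (ordS v0), pv (ordS v0)) = cw_after Dd (ordS v0) (ord_pred (ordS v0)) by [].
    by rewrite ordSK (cw_after_eq tT St tS).
  have f2 : f (pv (ordS v0), ct t) = (ct t, pv v0) by rewrite toE // tS.
  have f3 : f (ct t, pv v0) = (pv v0, bv v0).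
    rewrite fromE (ccw_eq tT St tS).
    by case: (cw_afterP (edge_ordS v0)) => // t' tT' vt' /(cw_not_ordS tT' vt').
  exists (pv v0, bv v0); rewrite [iter _ _ _]/= f0 f1 f2 f3; split=> //.
    by rewrite /is_dart /= eqxx.
  move=> x; case/dartP=> [w|w|w t' tT' wt|w t' tT' wt] /= /set2_inj[][].
  - move=> -> e; have := ordS2_neq v0; by rewrite -e ord_predK eqxx.
  - by move=> -> _; exists 1; rewrite //= f0.
  - by move=> -> _; exists 0.
  - move=> -> e; have := ordS2_neq v0; by rewrite e eqxx.
  - by move=> wE; subst w; move/(cw_not_ordS tT' wt).
  - move=> wE wv; subst w; exists 2; rewrite //= f0 f1; congr (_, ct _).
    by apply: (cw_triangle_unique tT' tT wt St); rewrite wv tS.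
  - move=> wE wS; subst w; exists 3; rewrite //= f0 f1 f2; congr (ct _, _).
    have St' : ordS v0 \in t' by rewrite -wS ccw_in_mem.
    by apply: (cw_triangle_unique tT' tT St' St); rewrite tS; apply: cw_eq wS.
  - move=> wE wv; subst w; have vt' : v0 \in t' by rewrite -wv ccw_in_mem.
    by case: (cw_not_ordS tT' vt'); apply: cw_eq wv.
move=> uv; have [->|vS] := eqVneq v (ordS u); first exact: sideC.
have [->|uS] := eqVneq u (ordS v); first by rewrite setUC; exact: sideC.
have [t [tT ut tv]] := cw_triangle_exists uv vS.
have vu : edge v u by rewrite edgeC.
have [t' [tT' vt' tu']] := cw_triangle_exists vu uS.
have vt : v \in t by rewrite -tv cw_in_mem.
have ut' : u \in t' by rewrite -tu' cw_in_mem.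
have f0 : f (pv u, ct t) = (ct t, pv v) by rewrite toE // tv.
have f1 : f (ct t, pv v) = (pv v, ct t').
  by rewrite fromE (ccw_eq tT ut tv) (cw_after_eq tT' vt' tu').
have f2 : f (pv v, ct t') = (ct t', pv u) by rewrite toE // tu'.
have f3 : f (ct t', pv u) = (pv u, ct t).
  by rewrite fromE (ccw_eq tT' vt' tu') (cw_after_eq tT ut tv).
exists (pv u, ct t); rewrite [iter _ _ _]/= f0 f1 f2 f3; split=> //.
  by rewrite /is_dart /= tT ut.
move=> x; case/dartP=> [w|w|w s sT ws|w s sT ws] /= /set2_inj[][].
- by move=> -> e; rewrite -e ord_predK eqxx in uS.
- by move=> -> e; rewrite -e ord_predK eqxx in vS.
- by move=> -> e; rewrite e eqxx in vS.
- by move=> -> e; rewrite e eqxx in uS.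
- move=> wE sv; subst w; exists 0 => //=; congr (_, ct _).
  by apply: (cw_triangle_unique sT tT ws ut); rewrite sv.
- move=> wE sv; subst w; exists 2; rewrite //= f0 f1; congr (_, ct _).
  by apply: (cw_triangle_unique sT tT' ws vt'); rewrite sv.
- move=> wE sv; subst w; exists 3; rewrite //= f0 f1 f2; congr (ct _, _).
  have vs : v \in s by rewrite -sv ccw_in_mem.
  by apply: (cw_triangle_unique sT tT' vs vt'); rewrite tu'; apply: cw_eq sv.
- move=> wE su; subst w; exists 1; rewrite //= f0; congr (ct _, _).
  have us : u \in s by rewrite -su ccw_in_mem.
  by apply: (cw_triangle_unique sT tT us ut); rewrite tv; apply: cw_eq su.
Qed.

Local Notation fnext := (face_next G).

(** Large enough for [first_return_connect], which is used with at most seven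
    iterates. *)
Lemma card_pre_dart : 8 <= #|{: pre_dart n}|.
Proof.
rewrite card_prod; have : 4 <= #|{: pre_vertex n}|.
  by rewrite card_sum; apply: leq_trans (leq_addr _ _); rewrite card_sum !card_ord; lia.
by move=> h; apply: (@leq_trans (4 * 4)) => //; apply: leq_mul.
Qed.

Lemma iter_face_next k d : is_dart d -> is_dart (iter k f d) /\ face_edge (iter k f d) = face_edge d.
Proof.
move=> pd; elim: k => //= k [pk ek]; have [pk' ek'] := face_next_dart pk.
by rewrite ek' ek.
Qed.

Lemma fnext_dart d : plabic_dart d -> plabic_dart (fnext d) /\ face_edge (fnext d) = face_edge d.
Proof.
case/andP=> pd md; rewrite /plabic_dart [fnext]/=.
have [k kE] := first_return_orbit f (fun d => ~~ monochromatic G0 d) d.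
have := first_return_mem f (P := fun d => ~~ monochromatic G0 d) md.
by rewrite kE /mono => ->; have [-> ->] := iter_face_next k pd.
Qed.

Lemma face_edge_edge d : is_dart d -> exists u v, edge u v /\ face_edge d = [set u; v].
Proof.
case/dartP=> [v|v|v t tT vt|v t tT vt].
- by exists v, (ord_pred v); rewrite edge_ord_pred.
- by exists v, (ordS v); rewrite edge_ordS.
- by exists v, (cw_in t v); rewrite edge_cw.
- by exists v, (ccw_in t v); rewrite edge_ccw.
Qed.

(** Together with [fconnect_face_edge], this identifies the faces with the edges of the
    triangulation. *)
Lemma same_face x y : plabic_dart x -> plabic_dart y -> face_edge x = face_edge y -> fconnect fnext x y.
Proof.
case/andP=> px mx /andP[py my] xy; have [u [v [uv ex]]] := face_edge_edge px.
have [d0 [pd0 d4 all4]] := face_cycle uv.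
have [i i4 xE] := all4 x px ex; have [j j4 yE] := all4 y py (etrans (esym xy) ex).
have yx : y = iter (j + (4 - i)) f x.
  by rewrite xE -iterD -addnA subnK ?(ltnW i4) // iterD d4.
rewrite yx; apply: first_return_connect; last by rewrite -yx.
by apply: leq_trans card_pre_dart; lia.
Qed.

Lemma fconnect_face_edge x y : plabic_dart x -> fconnect fnext x y ->
  plabic_dart y /\ face_edge y = face_edge x.
Proof.
move=> gx /iter_findex <-; elim: (findex _ _ _) => //= k [gk ek].
by have [gk' ek'] := fnext_dart gk; rewrite ek' ek.
Qed.

(** * The faces to the left of a path *)

Fixpoint steps (s : 'I_n) (P : seq 'I_n) : seq ('I_n * 'I_n) :=
  if P is y :: P' then (s, y) :: steps y P' else [::].

Lemma steps_rcons s P y : steps s (rcons P y) = rcons (steps s P) (last s P, y).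
Proof. by elim: P s => //= x P IH s; rewrite IH. Qed.

Lemma steps_step s P x y : path step s P -> (x, y) \in steps s P -> step x y /\ y \in P.
Proof.
elim: P s => //= z P IH s /andP[sz zP]; rewrite inE => /orP[/eqP[-> ->]|/(IH z zP)[h1 h2]].
  by rewrite mem_head.
by rewrite inE h2 orbT.
Qed.

Lemma steps_into s P y : y \in P -> exists x, (x, y) \in steps s P.
Proof.
elim: P s => //= z P IH s; rewrite inE => /orP[/eqP ->|/(IH z)[x xP]].
  by exists s; rewrite mem_head.
by exists x; rewrite inE xP orbT.
Qed.

Lemma step_inside a b x y : edge a b -> step x y -> pos a < pos x < pos b ->
  pos a < pos y < pos b.
Proof.
move=> ab xy xab; have [ax bx] := age_inside ab xab; have xy' := step_age xy.
have yx : edge x y.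
  case/andP: xy => ny /orP[/eqP ->|/eqP ->]; first exact: edge_lo.
  by rewrite edgeC; exact: edge_hi.
have := edge_inside ab yx xab.
have ya : pos y != pos a by rewrite pos_eq; apply: contraTneq xy' => ->; rewrite -leqNgt ltnW.
have yb : pos y != pos b by rewrite pos_eq; apply: contraTneq xy' => ->; rewrite -leqNgt ltnW.
lia.
Qed.

Lemma chain_inside a b x P : edge a b -> path step x P -> pos a < pos x < pos b ->
  pos a < pos (last x P) < pos b.
Proof.
move=> ab; elim: P x => //= y P IH x /andP[xy yP] xab; apply: IH => //.
exact: step_inside xy xab.
Qed.

Lemma left_of_chain_rcons_pair (u v : 'I_n) vs y : pos u < pos v -> left_of_chain [set u; v] (rcons vs y) =
  if pos u < pos y < pos v then left_of_chain [set u; v] vs else pos y <= pos u.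
Proof. by move=> uv; rewrite left_of_chain_rcons end_loE ?end_hiE. Qed.

Lemma source_outside (s a b : 'I_n) : source s -> ~~ (pos a < pos s < pos b).
Proof. by rewrite /source; have := pos_gt0 a; have := pos_le b; lia. Qed.

(** The path crosses the triangle only if it visits the apex [c].  If it does not, the
    three faces around the center are on the same side of the path; if it comes from
    [lo c], only the face of the edge from [lo c] to [c] is on the right, and if it
    comes from [hi c], only the face of the edge from [c] to [hi c] is on the left. *)
Lemma left_of_chain_triangle c s P : ~~ source c -> source s -> path step s P ->
  let: L1 := left_of_chain [set lo c; hi c] (s :: P) in
  let: L2 := left_of_chain [set lo c; c] (s :: P) in
  let: L3 := left_of_chain [set c; hi c] (s :: P) in
  (c \notin P -> L2 = L1 /\ L3 = L1) /\
  (forall x, (x, c) \in steps s P -> [/\ L1 = (x == lo c), L2 = false & L3 = true]).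
Proof.
move=> nc ss; have h1 := lo_lt nc; have h2 := lt_hi nc; have h3 := ltn_trans h1 h2.
have eb := edge_base nc; have el := edge_lo nc; have eh := edge_hi nc.
elim/last_ind: P => [|P y IH] sP.
  split=> // _; have := @source_outside s (lo c) (hi c) ss.
  rewrite /left_of_chain /= !end_loE // !end_hiE //.
  by clear -h1 h2; do 3 case: ifP; lia.
move: sP; rewrite rcons_path => /andP[sP xy]; have [IH1 IH2] := IH sP.
rewrite -rcons_cons !left_of_chain_rcons_pair //.
set x := last s P in xy *; have [ny xt nxy] := step_triangle xy.
have yx : edge y x.
  by case/andP: xy => _ /orP[/eqP ->|/eqP ->]; [rewrite edgeC; exact: edge_lo|exact: edge_hi].
have cP_last : c \in P -> pos (lo c) < pos x < pos (hi c).
  move=> cP; case/splitPr: cP sP @x {xy xt nxy yx IH IH1 IH2} => P1 P2.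
  rewrite cat_path /= => /and3P[_ _ cP2]; rewrite last_cat /=.
  by apply: chain_inside eb cP2 _; rewrite h1 h2.
have lastE (u v : 'I_n) : pos u < pos v -> ~~ (pos u < pos x < pos v) ->
    left_of_chain [set u; v] (s :: P) = (pos x <= pos u).
  by move=> uv o; rewrite left_of_chain_last end_loE ?end_hiE.
rewrite mem_rcons inE negb_or steps_rcons.
have [yc|yc] := eqVneq y c; last first.
  have st_old z : (z, c) \in rcons (steps s P) (x, y) -> (z, c) \in steps s P.
    by rewrite mem_rcons inE xpair_eqE [c == y]eq_sym (negPf yc) andbF.
  have npyc : pos y != pos c by rewrite pos_eq.
  have [yin|yout] := boolP (pos (lo c) < pos y < pos (hi c)); last first.
    have yo1 : (pos (lo c) < pos y < pos c) = false by clear -h1 h2 yout npyc; lia.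
    have yo2 : (pos c < pos y < pos (hi c)) = false by clear -h1 h2 yout npyc; lia.
    rewrite yo1 yo2; split; first by move=> _; split; [|clear -h1 h2 yout npyc; lia].
    move=> z /st_old /(steps_step sP)[_ /cP_last xin].
    by have := step_inside eb xy xin; rewrite (negPf yout).
  have /andP[ly yh] := yin.
  have nxc : c \notin P -> pos x != pos c.
    rewrite pos_eq => cP; apply: contraNneq nc => xc.
    have : x \in s :: P by rewrite mem_last.
    by rewrite inE xc (negPf cP) orbF => /eqP ->.
  have [yl|yl] := ltnP (pos y) (pos c).
    rewrite ly (ltnNge (pos c)) (ltnW yl) /=.
    split=> [cP|z /st_old zP]; last by have [-> -> _] := IH2 z zP.
    have [-> e3] := IH1 cP; split=> //; symmetry.
    have := edge_inside el yx; rewrite ly yl => /(_ isT) /andP[lx xc].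
    have {}nxc := nxc cP.
    have [xin|xout] := boolP (pos (lo c) < pos x < pos (hi c)).
      by rewrite -e3 lastE // ?xc // ltnNge xc.
    by rewrite lastE //; clear -xout lx xc nxc h2; lia.
  have {}yl : pos c < pos y by clear -yl npyc; lia.
  rewrite yl yh andbF /= [pos y <= pos (lo c)]leqNgt ly /=.
  split=> [cP|z /st_old zP]; last by have [-> _ ->] := IH2 z zP.
  have [e2 ->] := IH1 cP; split=> //; symmetry.
  have := edge_inside eh yx; rewrite yl yh => /(_ isT) /andP[cx xh].
  have {}nxc := nxc cP.
  have [xin|xout] := boolP (pos (lo c) < pos x < pos (hi c)).
    rewrite -e2 lastE //; last by rewrite [pos x < pos c]ltnNge cx andbF.
    by clear -cx h1; lia.
  by rewrite lastE //; clear -xout xh cx nxc h1; lia.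
subst y; have xlh : x = lo c \/ x = hi c.
  by case/andP: xy => _ /orP[] /eqP; auto.
have cP : c \notin P.
  by apply/negP => /cP_last; case: xlh => ->; rewrite ltnn ?andbF.
rewrite h1 h2 !ltnn andbF leqnn leqNgt h1; split=> // z.
rewrite mem_rcons inE => /orP[|/(steps_step sP)[_]]; last by rewrite (negPf cP).
rewrite xpair_eqE => /andP[/eqP -> _]; split=> //; rewrite -?/x lastE //.
  case: xlh => ->; first by rewrite leqnn eqxx.
  by rewrite leqNgt h3 -pos_eq gtn_eqF.
by case: xlh => ->; rewrite ltnn ?andbF.
Qed.

Lemma pos_ord_pred (v : 'I_n) : pos (ord_pred v) = if pos v == 1 then n else (pos v).-1.
Proof.
have := pos_ordS (ord_pred v); rewrite ord_predK; have := pos_gt0 (ord_pred v).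
by case: (pos (ord_pred v) =P n) => ?; case: (pos v =P 1) => ?; lia.
Qed.

Lemma side_pred (v : 'I_n) : [set v; ord_pred v] = [set ord_pred v; ordS (ord_pred v)].
Proof. by rewrite ord_predK setUC. Qed.

Lemma left_of_chain_side (v s : 'I_n) P : pos v < n -> left_of_chain [set v; ordS v] (s :: P) =
  (pos (last s P) <= pos v).
Proof.
move=> vn; have pS : pos (ordS v) = (pos v).+1 by rewrite pos_ordS; case: eqP vn; lia.
have lt : pos v < pos (ordS v) by rewrite pS.
by rewrite left_of_chain_last end_loE ?end_hiE ?pS //; lia.
Qed.

Lemma left_of_chain_root (s u v : 'I_n) P : pos u = 1 -> pos v = n -> source s -> path step s P ->
  left_of_chain [set u; v] (s :: P) = (s == u).
Proof.
move=> u1 vn ss; have uv : pos u < pos v by lia.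
elim/last_ind: P => [|P y IH].
  have := pos_eq s u; rewrite /left_of_chain /= end_loE ?end_hiE //; move: ss; rewrite /source u1 vn.
  by case: ifP; lia.
rewrite rcons_path => /andP[sP xy]; rewrite -rcons_cons left_of_chain_rcons_pair // IH //.
by have := step_nsource xy; rewrite u1 vn => /sourceF ->.
Qed.

Lemma mem_tail_to s P v c : path step s P -> ~~ source c ->
  ((pv v, ct (triangle c)) \in tail_darts s P) = ((v, c) \in steps s P).
Proof.
move=> sP nc; elim: P s sP => [|y P IH] s /=; first by rewrite inE xpair_eqE andbF.
case/andP=> sy yP; rewrite !inE IH //=; congr (_ || _).
rewrite !xpair_eqE; congr (_ && _); apply/eqP/eqP => [[/triangle_inj->//]|->//].
exact: step_nsource sy.
Qed.

Lemma mem_tail_from s P v c : path step s P -> ~~ source c ->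
  ((ct (triangle c), pv v) \in tail_darts s P) = (v == c) && (c \in P).
Proof.
move=> sP nc; elim: P s sP => [|y P IH] s /=; first by rewrite !inE andbF.
case/andP=> sy yP; rewrite !inE IH //= andb_orr; congr (_ || _).
rewrite xpair_eqE; apply/andP/andP => [[/eqP[/triangle_inj E] /eqP[->]]|[/eqP -> /eqP ->]].
  by rewrite -E ?(step_nsource sy).
by [].
Qed.

Lemma mem_tail_out s P v : ((pv v, bv v) \in tail_darts s P) = (v == last s P).
Proof.
elim: P s => [|y P IH] s /=; first by rewrite inE xpair_eqE andbb.
by rewrite !inE IH !xpair_eqE !andbF.
Qed.

Lemma mem_tail_in s P v : ((bv v, pv v) \in tail_darts s P) = false.
Proof. by elim: P s => [|y P IH] s //=; rewrite !inE ?IH !xpair_eqE ?andbF. Qed.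

Lemma mem_chain_path s P d : (d \in chain_path s P) =
  ~~ mono d && ((d == (bv s, pv s)) || (d \in tail_darts s P)).
Proof. by rewrite /chain_path mem_filter inE. Qed.

Lemma mem_chain_to s P v c : path step s P -> ~~ source c -> ~~ ear_tip v ->
  ((pv v, ct (triangle c)) \in chain_path s P) = ((v, c) \in steps s P).
Proof. by move=> sP nc wv; rewrite mem_chain_path monoE wv mem_tail_to. Qed.

Lemma mem_chain_from s P v c : path step s P -> ~~ source c -> ~~ ear_tip v ->
  ((ct (triangle c), pv v) \in chain_path s P) = (v == c) && (c \in P).
Proof. by move=> sP nc wv; rewrite mem_chain_path monoE wv mem_tail_from. Qed.

Lemma mem_chain_out s P v : ((pv v, bv v) \in chain_path s P) = (v == last s P).
Proof. by rewrite mem_chain_path monoE mem_tail_out. Qed.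

Lemma mem_chain_in s P v : ((bv v, pv v) \in chain_path s P) = (v == s).
Proof.
rewrite mem_chain_path monoE mem_tail_in orbF /=.
by apply/eqP/eqP => [[->]|->].
Qed.

Section Path.
Variables (s : 'I_n) (P : seq 'I_n).
Hypotheses (sP : path step s P) (ss : source s) (nl : ~~ source (last s P)).
Local Notation p := (chain_path s P).

Definition dart_on_left (d : pre_dart n) := left_of_chain (face_edge d) (s :: P).

Lemma dart_on_left_path d : d \in p -> dart_on_left d.
Proof.
rewrite mem_chain_path => /andP[md /orP[/eqP ->|dP]].
  rewrite /dart_on_left [face_edge _]/=; have [s1|sn] := orP ss.
    by rewrite left_of_chain_root ?eqxx ?(eqP s1) // pos_ord_pred (eqP s1).
  have pS : pos s = (pos (ord_pred s)).+1.
    by rewrite pos_ord_pred (eqP sn); case: eqP; lia.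
  rewrite side_pred left_of_chain_side; last by have := pos_le s; rewrite pS.
  by have := sourceF nl; have := pos_le s; lia.
have /allP/(_ d dP)/andP[pd od] := tail_darts_outward sP nl.
case/dartP: pd od md dP => [v|v|v t tT vt|v t tT vt] od md.
- by rewrite mem_tail_in.
- rewrite mem_tail_out /dart_on_left [face_edge _]/= => /eqP vl.
  by rewrite left_of_chain_side vl ?leqnn //; have := sourceF nl; lia.
- move: vt od; case/triangleP: tT => c nc -> vt od; rewrite mem_tail_to // => vc.
  have [_ /(_ v vc)[h1 h2 h3]] := left_of_chain_triangle nc ss sP.
  have [c1 c2 c3 c4 [c5 c6]] := cyclic_nexts nc.
  have [/andP[_ /orP[/eqP vE|/eqP vE]] _] := steps_step sP vc.
    by rewrite /dart_on_left [face_edge _]/= vE c4 h1 vE.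
  by rewrite /dart_on_left [face_edge _]/= vE c6 setUC.
- move: vt od; case/triangleP: tT => c nc -> vt od; rewrite mem_tail_from // => /andP[/eqP -> cP].
  have [x xc] := steps_into s cP.
  have [_ /(_ x xc)[h1 h2 h3]] := left_of_chain_triangle nc ss sP.
  have [c1 c2 c3 c4 [c5 c6]] := cyclic_nexts nc.
  by rewrite /dart_on_left [face_edge _]/= c2.
Qed.

(** Crossing an edge which is not on the path does not change sides.  At a triangle
    this is [left_of_chain_triangle]; at a ray, the two adjacent sides of the polygon
    are on different sides of the path only at its two ends. *)
Lemma dart_on_left_cross d : plabic_dart d -> d \notin p -> (d.2, d.1) \notin p ->
  dart_on_left (d.2, d.1) = dart_on_left d.
Proof.
wlog : d / match d with (inl (inl _), _) => True | (inl (inr _), inr _) => True | _ => False end.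
  move=> W gd dp odp; have /andP[pd md] := gd.
  have go : plabic_dart (d.2, d.1) by rewrite /plabic_dart is_dart_opp pd /mono /monochromatic eq_sym.
  case/dartP: pd gd dp odp go {md} => [v|v|v t tT vt|v t tT vt] gd dp odp go.
  - exact: W.
  - by symmetry; apply: (W (bv v, pv v)).
  - exact: W.
  - by symmetry; apply: (W (pv v, ct t)).
move=> D /andP[pd md]; case/dartP: pd D md => [v|v|v t tT vt|v t tT vt];
  [move=> _ md|by case|move=> _ md|by case].
  rewrite mem_chain_in mem_chain_out => nvs vl.
  rewrite /dart_on_left [face_edge _]/= [face_edge (_, _)]/=.
  have /andP[t1 tn] := sourceF nl.
  have [sv|nv] := boolP (source v).
    have [/eqP v1|/eqP vn] := orP sv.
      rewrite left_of_chain_side ?v1; last exact: ltn_trans tn.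
      rewrite left_of_chain_root // ?pos_ord_pred ?v1 //.
      by rewrite eq_sym (negPf nvs) leqNgt t1.
    have s1 : pos s = 1.
      by move: ss nvs; rewrite /source -pos_eq vn => /orP[/eqP//|/eqP ->]; rewrite eqxx.
    have S1 : pos (ordS v) = 1 by rewrite pos_ordS vn eqxx.
    rewrite (setUC [set v] [set ordS v]) left_of_chain_root // -pos_eq s1 S1 eqxx.
    have Pn : pos (ord_pred v) = n.-1 by rewrite pos_ord_pred vn; case: eqP => //; clear -n4; lia.
    rewrite side_pred left_of_chain_side Pn; last by clear -tn; lia.
    by clear -tn; lia.
  have /andP[v1 vn] := sourceF nv.
  have Pn : pos (ord_pred v) = (pos v).-1.
    by rewrite pos_ord_pred; case: eqP => //; clear -v1; lia.
  rewrite left_of_chain_side // side_pred left_of_chain_side Pn; last by clear -vn v1; lia.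
  by move: vl; rewrite -pos_eq; clear -v1; lia.
move: vt; case/triangleP: tT md => c nc -> md vt.
rewrite monoE in md; rewrite (mem_chain_to sP nc md) (mem_chain_from sP nc md) => vc cv.
have [R1 R2] := left_of_chain_triangle nc ss sP.
have [c1 c2 c3 c4 [c5 c6]] := cyclic_nexts nc.
rewrite /dart_on_left [face_edge _]/= [face_edge (_, _)]/=.
have [cP|cP] := boolP (c \in P); last first.
  have [e2 e3] := R1 cP; move: vt; rewrite in_triangle => /or3P[]/eqP ->.
  - by rewrite c4 c1 e2.
  - by rewrite c5 c2 (setUC [set c] [set lo c]) e2.
  - by rewrite c6 c3 (setUC [set hi c] [set lo c]) (setUC [set hi c] [set c]) e3.
have [x xc] := steps_into s cP; have [e1 e2 e3] := R2 x xc.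
have [/andP[_ xlh] _] := steps_step sP xc; have nxv : x != v by apply: contraNneq vc => <-.
have h1 := lo_lt nc; have h2 := lt_hi nc.
move: vt; rewrite in_triangle => /or3P[]/eqP vE; subst v.
- by rewrite c4 c1 e1 e2 (negPf nxv).
- by case/negP: cv; rewrite eqxx.
- rewrite c6 c3 (setUC [set hi c] [set lo c]) (setUC [set hi c] [set c]) e3 e1.
  by case/orP: xlh => // /eqP xE; rewrite xE eqxx in nxv.
Qed.

Lemma left_move_dart_on_left d x : plabic_dart d -> dart_on_left d -> connect (left_move G p) d x ->
  plabic_dart x /\ dart_on_left x.
Proof.
move=> gd ld /connectP[q]; elim: q d gd ld => [|y q IH] d gd ld /=; first by move=> _ ->.
case/andP=> /orP[/eqP yE|/and3P[/eqP yE dp odp]] yq lq; apply: (IH y) => //.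
- by rewrite yE; have [] := fnext_dart gd.
- by rewrite yE /dart_on_left; have [_ ->] := fnext_dart gd.
- case/andP: gd => pd md; rewrite yE /plabic_dart /= /pre_opp is_dart_opp pd.
  by rewrite /mono /monochromatic eq_sym.
- by rewrite yE /= /pre_opp dart_on_left_cross.
Qed.

Lemma connect_face d x : plabic_dart d -> plabic_dart x -> face_edge d = face_edge x ->
  connect (left_move G p) d x.
Proof.
move=> gd gx dx; apply: connect_sub (same_face gd gx dx) => y z /eqP <-.
by apply: connect1; rewrite /left_move eqxx.
Qed.

Lemma connect_cross x d y : connect (left_move G p) x d -> plabic_dart d ->
  d \notin p -> (d.2, d.1) \notin p -> plabic_dart y -> face_edge y = face_edge (d.2, d.1) -> connect (left_move G p) x y.
Proof.
move=> xd gd dp odp gy ey; apply: connect_trans xd _.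
have go : plabic_dart (d.2, d.1).
  by case/andP: gd => pd md; rewrite /plabic_dart is_dart_opp pd /mono /monochromatic eq_sym.
apply: connect_trans (connect_face go gy (esym ey)); apply: connect1.
by rewrite /left_move /= /pre_opp eqxx dp odp orbT.
Qed.

Definition reachable (e : {set 'I_n}) :=
  forall y, plabic_dart y -> face_edge y = e -> exists2 d, d \in p & connect (left_move G p) d y.

(** From the last dart of the path, across the rays of the vertices after the end
    point. *)
Lemma reachable_side v : pos v < n -> pos (last s P) <= pos v -> reachable [set v; ordS v].
Proof.
have [k] := ubnP (pos v); elim: k v => // k IH v vk vn lv y gy ey.
have [vl|vl] := eqVneq v (last s P).
  exists (pv v, bv v); first by rewrite mem_chain_out vl.
  by apply: connect_face; rewrite ?plabic_dart_out.
have := sourceF nl => lin; have vl' : pos v != pos (last s P) by rewrite pos_eq.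
have pv1 : pos (ord_pred v) = (pos v).-1 by rewrite pos_ord_pred; case: eqP => //; clear -lin lv; lia.
have gi := plabic_dart_in v.
have l1 : pos (ord_pred v) < k by rewrite pv1; clear -vk lin lv; lia.
have l2 : pos (ord_pred v) < n by rewrite pv1; clear -vn; lia.
have l3 : pos (last s P) <= pos (ord_pred v) by rewrite pv1; clear -lv vl'; lia.
have [d dp dc] := IH _ l1 l2 l3 (bv v, pv v) gi (side_pred v).
exists d => //; apply: (connect_cross dc gi) => //=.
  rewrite mem_chain_in; apply: contraTneq ss => <-; rewrite /source.
  by clear -vn lv lin vl'; lia.
by rewrite mem_chain_out.
Qed.

Lemma diagonal_white v x : [set v; x] \in Dd -> ~~ ear_tip v.
Proof.
by move=> e; rewrite negbK; apply/exists_inP; exists [set v; x]; rewrite // set21.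
Qed.

(** Follow the triangles behind the diagonal.  If the path crosses the child triangle,
    it comes from the lower end, and its dart into the triangle has the face of the
    diagonal on its left.  Otherwise the edge from the apex to the upper end is on the
    left of the path as well, and it is reached by induction or by
    [reachable_side]. *)
Lemma reachable_diagonal e : e \in Dd -> left_of_chain e (s :: P) -> reachable e.
Proof.
have [k] := ubnP (end_hi e - end_lo e); elim: k e => // k IH e ek eD le y gy ey.
have [a [b [lab nroot eE ea eb]]] := diagonal_ends eD.
have abE : edge a b by rewrite /edge -eE eD.
have [c [nc lc hc]] := child_triangle abE lab.
have h1 := lo_lt nc; have h2 := lt_hi nc.
have [R1 R2] := left_of_chain_triangle nc ss sP; rewrite lc hc -eE le in R1 R2 h1 h2.
have [c1 c2 c3 c4 [c5 c6]] := cyclic_nexts nc; rewrite lc hc in c1 c2 c3 c4 c5 c6.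
have wa : ~~ ear_tip a by apply: (@diagonal_white a b); rewrite -eE.
have wb : ~~ ear_tip b by apply: (@diagonal_white b a); rewrite setUC -eE.
have at_ : a \in triangle c by rewrite in_triangle lc eqxx.
have bt : b \in triangle c by rewrite in_triangle hc eqxx !orbT.
have [cP|cP] := boolP (c \in P).
  have [x xc] := steps_into s cP; have [e1 _ _] := R2 x xc.
  have xa : x = a by apply/eqP.
  exists (pv a, ct (triangle c)).
    by rewrite (mem_chain_to sP nc wa) -xa.
  apply: connect_face => //; last by rewrite [face_edge (_, _)]/= c4 ey eE.
  by rewrite /plabic_dart monoE wa /is_dart /= is_triangle_triangle // at_.
have [_ l3] := R1 cP.
have gz : plabic_dart (pv b, ct (triangle c)).
  by rewrite /plabic_dart monoE wb /is_dart /= is_triangle_triangle // bt.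
have ez : face_edge (pv b, ct (triangle c)) = [set c; b].
  by rewrite [face_edge _]/= c6 setUC.
have [d dp dc] : exists2 d, d \in p & connect (left_move G p) d (pv b, ct (triangle c)).
  have [cbD|cbS] := boolP ([set c; b] \in Dd).
    have l1 : end_hi [set c; b] - end_lo [set c; b] < k.
      by move: ek; rewrite ea eb (end_loE n4 h2) (end_hiE n4 h2); clear -h1 h2; lia.
    exact: (IH _ l1 cbD l3 _ gz ez).
  have cn : pos c < n := leq_trans h2 (pos_le b).
  have : edge c b by rewrite -hc; exact: edge_hi.
  have a0 := pos_gt0 a; rewrite /edge (negPf cbS) (is_sideE n4 h2) => cb.
  have bS : b = ordS c.
    apply: pos_inj; rewrite pos_ordS ltn_eqF //.
    by clear -h1 a0 cb; lia.
  have lc3 : pos (last s P) <= pos c by rewrite -left_of_chain_side // -bS.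
  exact: (reachable_side cn lc3 gz (etrans ez (congr1 (fun w => [set c; w]) bS))).
exists d => //; apply: (connect_cross dc gz).
- by rewrite (mem_chain_to sP nc wb); apply/negP => /(steps_step sP)[_]; rewrite (negPf cP).
- by rewrite (mem_chain_from sP nc wb) (negPf cP) andbF.
- exact: gy.
- by rewrite ey [face_edge _]/= c3 setUC eE.
Qed.

Lemma diagonal_dart e : e \in Dd -> exists2 d, plabic_dart d & face_edge d = e.
Proof.
move=> eD; have [a [b [lab nroot eE ea eb]]] := diagonal_ends eD.
have abE : edge a b by rewrite /edge -eE eD.
have [c [nc lc hc]] := child_triangle abE lab.
have [c1 c2 c3 c4 [c5 c6]] := cyclic_nexts nc; rewrite lc hc in c1 c2 c3 c4 c5 c6.
have wa : ~~ ear_tip a by apply: (@diagonal_white a b); rewrite -eE.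
have at_ : a \in triangle c by rewrite in_triangle lc eqxx.
exists (pv a, ct (triangle c)); last by rewrite [face_edge _]/= c4 eE.
by rewrite /plabic_dart monoE wa /is_dart /= is_triangle_triangle // at_.
Qed.

Lemma side_not_diagonal v : [set v; ordS v] \notin Dd.
Proof.
apply/negP; have [h _ _] := hDd; move=> /h /andP[_ /negP]; apply.
by apply/existsP; exists v.
Qed.

Lemma pred_side_not_diagonal v : [set v; ord_pred v] \notin Dd.
Proof. by rewrite setUC -{2}(ord_predK v) side_not_diagonal. Qed.

Definition diagonal_face (e : {set 'I_n}) : {set pre_dart n} :=
  [set x | plabic_dart x & face_edge x == e].

Lemma face_ofE d : plabic_dart d -> face_of G d = diagonal_face (face_edge d).
Proof.
move=> gd; apply/setP => x; rewrite !inE; apply/idP/andP => [dx|[gx /eqP xd]].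
  by have [-> ->] := fconnect_face_edge gd dx.
exact: same_face.
Qed.

(** The face of a side of the polygon contains a ray, so the internal faces are those of
    the diagonals. *)
Lemma path_degree_chain : path_degree G p = #|[set e in Dd | left_of_chain e (s :: P)]|.
Proof.
rewrite /path_degree; have <- : diagonal_face @: [set e in Dd | left_of_chain e (s :: P)] =
    [set F in faces G | internal_face G F && left_of G p F].
  apply/setP => F; rewrite inE; apply/imsetP/and3P => [[e]|[/imsetP[d]]].
    rewrite inE => /andP[eD le] ->; have [d gd de] := diagonal_dart eD.
    split.
    - by apply/imsetP; exists d; rewrite ?darts_plabic // face_ofE // de.
    - apply/forallP => i; rewrite !inE /=; apply/andP; split.
        rewrite negb_and; apply/orP; right; apply: contraNneq (pred_side_not_diagonal i).
        by move=> ->.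
      rewrite negb_and; apply/orP; right; apply: contraNneq (side_not_diagonal i).
      by move=> ->.
    - have [d' dp dc] := reachable_diagonal eD le gd de.
      apply/hasP; exists d' => //; apply/exists_inP; exists d => //.
      by rewrite inE gd de eqxx.
  rewrite darts_plabic => gd -> int /hasP[d' dp /exists_inP[x xF dx]].
  have /andP[pd _] := gd; exists (face_edge d); last exact: face_ofE.
  move: xF; rewrite face_ofE // inE => /andP[gx /eqP xd].
  have gd' : plabic_dart d' by have /allP/(_ d' dp)/andP[] := chain_path_outward sP ss nl.
  have [_] := left_move_dart_on_left gd' (dart_on_left_path dp) dx.
  rewrite /dart_on_left xd inE => ->; rewrite andbT.
  have [u [v [uv eE]]] := face_edge_edge pd; move: uv; rewrite /edge -eE => /orP[//|].
  case/existsP=> i /eqP eS; have /forallP/(_ i)/andP[_] := int.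
  by rewrite face_ofE // inE eS /= /pre_opp plabic_dart_out eqxx.
rewrite card_in_imset // => e e'; rewrite !inE => /andP[/diagonal_dart[d gd de] _] _.
by move/setP/(_ d); rewrite !inE gd de eqxx => /esym/eqP.
Qed.

End Path.

(** * Flows *)

Lemma plabic_degree_min (O : {set pre_dart n}) J F m :
  is_flow G O J F -> flow_degree G F = m ->
  (forall F', is_flow G O J F' -> m <= flow_degree G F') -> plabic_degree G O J = m.
Proof.
move=> fF <- minF; rewrite /plabic_degree; case: pickP => [F0 fF0|/(_ F)]; last by rewrite fF.
case: arg_minnP => // F1 fF1 /(_ F fF) le1; apply/eqP; rewrite eqn_leq le1 /=.
exact: minF.
Qed.

Definition chain_degree s P := \sum_(e in Dd) left_of_chain e (s :: P).

Lemma path_degreeE s P : path step s P -> source s -> ~~ source (last s P) ->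
  path_degree G (chain_path s P) = chain_degree s P.
Proof.
move=> sP ss nl; rewrite path_degree_chain // -sum1_card big_mkcond [RHS]big_mkcond.
by apply: eq_bigr => e _; rewrite inE; case: (e \in Dd) => //=; case: left_of_chain.
Qed.

Lemma source_notin s t P : path step s P -> source t -> s != t -> t \notin s :: P.
Proof.
elim: P s => [|y P IH] s sP st nst; first by rewrite inE eq_sym.
rewrite inE eq_sym negb_or nst /=; case/andP: sP => /step_nsource ny yP.
by apply: IH => //; apply: contraNneq ny => ->.
Qed.

Section Flows.
Variable O : {set pre_dart n}.
Hypothesis hO : perfect_orientation G O.
Hypothesis hsrc : source_set G O = [set i : 'I_n | (i < 2)%N].

(** A directed path has no repeated dart, which bounds its length. *)
Lemma dpath_of s P : path step s P -> source s -> ~~ source (last s P) ->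
  exists p : dpath (pre_dart n), p = chain_path s P :> seq _.
Proof.
move=> sP ss nl; have up : uniq (chain_path s P) := chain_path_uniq hO hsrc sP ss nl.
have sz : size (chain_path s P) <= #|{: pre_dart n}|.
  by have /card_uniqP <- := up; apply: max_card.
by exists (Bseq sz).
Qed.

Lemma single_flow s P J : path step s P -> source s -> ~~ source (last s P) ->
  source_set G O :\: J = [set s] -> J :\: source_set G O = [set last s P] ->
  exists2 F, is_flow G O J F & flow_degree G F = chain_degree s P.
Proof.
move=> sP ss nl hS hT; have [p pE] := dpath_of sP ss nl.
have pd : is_dpath G O s (last s P) p by rewrite pE; apply: chain_path_dpath.
exists [set p]; last by rewrite /flow_degree big_set1 pE path_degreeE.
rewrite /is_flow hS hT; apply/and4P; split.
- apply/forall_inP => q; rewrite inE => /eqP ->; apply/exists_inP; exists s; rewrite ?set11 //.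
  by apply/exists_inP; exists (last s P); rewrite ?set11.
- apply/forall_inP => q; rewrite inE => /eqP ->; apply/exists_inP; exists p; rewrite ?set11 //.
  by apply/exists_inP; exists (last s P); rewrite ?set11.
- apply/forall_inP => q; rewrite inE => /eqP ->; apply/exists_inP; exists p; rewrite ?set11 //.
  by apply/exists_inP; exists s; rewrite ?set11.
- apply/forall_inP => q; rewrite inE => /eqP ->; apply/forall_inP => r; rewrite inE => /eqP ->.
  by rewrite eqxx.
Qed.

Lemma single_flow_ge s t J F : source s -> ~~ source t ->
  source_set G O :\: J = [set s] -> J :\: source_set G O = [set t] -> is_flow G O J F ->
  exists P, [/\ path step s P, last s P = t & chain_degree s P <= flow_degree G F].
Proof.
move=> ss nt hS hT; rewrite /is_flow hS hT => /and4P[_ /forall_inP/(_ s) h _ _].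
have /exists_inP[p pF /exists_inP[t' /set1P -> pd]] := h (set11 s).
have [P [sP lP pE]] := extract hO hsrc ss nt pd; exists P; split=> //.
by rewrite /flow_degree (bigD1 p) //= pE path_degreeE ?lP // leq_addr.
Qed.

Lemma chain_path_neq s s' P Q : s != s' -> chain_path s P != chain_path s' Q.
Proof. by move=> ns; rewrite !chain_path_cons; apply: contraNneq ns => -[->]. Qed.

Lemma double_flow s s' P Q J : path step s P -> path step s' Q -> source s -> source s' ->
  ~~ source (last s P) -> ~~ source (last s' Q) -> ~~ has (mem (s :: P)) (s' :: Q) ->
  source_set G O :\: J = [set s; s'] -> J :\: source_set G O = [set last s P; last s' Q] ->
  exists2 F, is_flow G O J F & flow_degree G F = chain_degree s P + chain_degree s' Q.
Proof.
move=> sP sQ ss ss' nl nl' dis hS hT.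
have [p pE] := dpath_of sP ss nl; have [q qE] := dpath_of sQ ss' nl'.
have pd : is_dpath G O s (last s P) p by rewrite pE; apply: chain_path_dpath.
have qd : is_dpath G O s' (last s' Q) q by rewrite qE; apply: chain_path_dpath.
have nss : s != s'.
  by apply: contraNneq dis => <-; apply/hasP; exists s; rewrite /= mem_head.
have npq : p != q.
  by rewrite -(inj_eq val_inj) /= pE qE chain_path_neq.
have dpq := chain_paths_disjoint sP sQ ss ss' nl nl' dis.
exists [set p; q]; last first.
  rewrite /flow_degree big_setU1 ?inE //= big_set1 pE qE !path_degreeE //.
rewrite /is_flow hS hT; apply/and4P; split.
- apply/forall_inP => r; rewrite inE => /orP[]/set1P ->; apply/exists_inP.
    by exists s; rewrite ?set21 //; apply/exists_inP; exists (last s P); rewrite ?set21.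
  by exists s'; rewrite ?set22 //; apply/exists_inP; exists (last s' Q); rewrite ?set22.
- apply/forall_inP => r; rewrite inE => /orP[]/set1P ->; apply/exists_inP.
    by exists p; rewrite ?set21 //; apply/exists_inP; exists (last s P); rewrite ?set21.
  by exists q; rewrite ?set22 //; apply/exists_inP; exists (last s' Q); rewrite ?set22.
- apply/forall_inP => r; rewrite inE => /orP[]/set1P ->; apply/exists_inP.
    by exists p; rewrite ?set21 //; apply/exists_inP; exists s; rewrite ?set21.
  by exists q; rewrite ?set22 //; apply/exists_inP; exists s'; rewrite ?set22.
- apply/forall_inP => r; rewrite inE => rF; apply/forall_inP => r'; rewrite inE => rF'.
  apply/implyP; case/orP: rF => /set1P ->; case/orP: rF' => /set1P -> ; rewrite ?eqxx // => _.
    by rewrite pE qE.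
  by rewrite pE qE has_sym.
Qed.

Lemma double_flow_ge s s' x y J F : source s -> source s' -> s != s' ->
  ~~ source x -> ~~ source y ->
  source_set G O :\: J = [set s; s'] -> J :\: source_set G O = [set x; y] -> is_flow G O J F ->
  exists P Q, [/\ path step s P, path step s' Q, ~~ has (mem (s :: P)) (s' :: Q),
    (last s P = x /\ last s' Q = y) \/ (last s P = y /\ last s' Q = x) &
    chain_degree s P + chain_degree s' Q <= flow_degree G F].
Proof.
move=> ss ss' nss nx ny hS hT; rewrite /is_flow hS hT => /and4P[_ /forall_inP h _ /forall_inP dF].
have nxy t : t \in [set x; y] -> ~~ source t by rewrite !inE => /orP[]/eqP->.
have /exists_inP[p pF /exists_inP[t tT pd]] := h s (set21 _ _).
have /exists_inP[q qF /exists_inP[t' tT' qd]] := h s' (set22 _ _).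
have [P [sP lP pE]] := extract hO hsrc ss (nxy t tT) pd.
have [Q [sQ lQ qE]] := extract hO hsrc ss' (nxy t' tT') qd.
have nP : ~~ source (last s P) by rewrite lP nxy.
have nQ : ~~ source (last s' Q) by rewrite lQ nxy.
have npq : p != q by rewrite -(inj_eq val_inj) /= pE qE chain_path_neq.
have /forall_inP/(_ q qF)/implyP/(_ npq) := dF p pF; rewrite pE qE => dis.
have dPQ : ~~ has (mem (s :: P)) (s' :: Q).
  apply: contra dis => /hasP[v vQ vP]; apply/hasP; exists (contract_root (pv v)).
    exact: mem_path_vertices.
  exact: mem_path_vertices.
have ntt : t != t'.
  rewrite -lP -lQ; apply: contraNneq dPQ => e; apply/hasP; exists (last s' Q).
    exact: mem_last.
  by rewrite /= -e mem_last.
exists P, Q; split=> //.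
- rewrite lP lQ; move: tT tT' ntt; rewrite !inE.
  by do 2 case/orP => /eqP ->; rewrite ?eqxx //; auto.
- rewrite /flow_degree (bigD1 p) //= (bigD1 q) /=; last by rewrite qF eq_sym.
  by rewrite pE qE !path_degreeE // addnA leq_addr.
Qed.

Lemma in_sources v : (v \in source_set G O) = source v.
Proof. by rewrite hsrc inE sourceE. Qed.

Lemma chain_trivial s P : path step s P -> source (last s P) -> P = [::].
Proof.
case: P => // y P /andP[sy yP] sl.
by have := last_nsource yP (step_nsource sy); rewrite /= in sl; rewrite sl.
Qed.

Lemma sum_chain_degree s s' P Q x y :
  {in Dd, forall e, left_of_chain e (s :: P) + left_of_chain e (s' :: Q) = min_left e x y} ->
  chain_degree s P + chain_degree s' Q = \sum_(e in Dd) min_left e x y.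
Proof. by move=> h; rewrite /chain_degree -big_split /=; apply: eq_bigr => e eD; exact: h. Qed.

Lemma sum_chain_degree_ge s s' P Q : source s -> source s' ->
  path step s P -> path step s' Q -> ~~ has (mem (s :: P)) (s' :: Q) ->
  \sum_(e in Dd) min_left e (last s P) (last s' Q) <= chain_degree s P + chain_degree s' Q.
Proof.
move=> ss ss' sP sQ dis; rewrite /chain_degree -big_split /=; apply: leq_sum => e eD.
exact: min_left_le.
Qed.

(** A source in the set {x, y} corresponds to a chain without steps.  Such a chain is
    not a path of the flow; at position [n] it has nothing to its left, and at position
    [1] it has all the diagonals to its left, whence the correction. *)
Lemma plabic_degreeE x y : pos x < pos y ->
  plabic_degree G O [set x; y] + (n - 3) * (pos x == 1) = \sum_(e in Dd) min_left e x y.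
Proof.
move=> xy; have n0 : 0 < n by apply: leq_trans n4.
have [s s1] := @pos_surj n 1 isT n0; have [t tn] := @pos_surj n n n0 (leqnn n).
have ss : source s by rewrite /source s1.
have st : source t by rewrite /source tn eqxx orbT.
have nst : s != t by rewrite -pos_eq s1 tn; clear -n4; lia.
have sourceP v : source v -> v = s \/ v = t.
  by rewrite /source -s1 -[X in _ || (_ == X)]tn !pos_eq => /orP[]/eqP; auto.
have [P [Q [[sP lP] [tQ lQ] dis tot]]] := min_left_attained s1 tn xy.
have sum_tot := sum_chain_degree tot.
(* The chains without steps at the two sources. *)
have cs : chain_degree s [::] = n - 3.
  have [_ _ <-] := hDd; rewrite -sum1_card; apply: eq_bigr => e eD.
  rewrite left_of_chain_last /=; have [a [b [_ ea eb lab _]]] := diagonal_edge eD.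
    by rewrite s1 -ea pos_gt0.
  by rewrite s1 -ea -eb ltnNge pos_gt0.
have ct0 : chain_degree t [::] = 0.
  apply: big1 => e eD; have [a [b [_ ea eb lab _]]] := diagonal_edge eD.
  rewrite left_of_chain_last /= tn -ea -?eb.
    by have := pos_le b; clear -lab; lia.
  by have := pos_le b; clear -lab; lia.
have xs : (pos x == 1) = (x == s) by rewrite -s1 pos_eq.
have memS v : (v \in source_set G O :\: [set x; y]) = [&& v != x, v != y & source v].
  by rewrite inE in_sources !inE negb_or andbA.
have memT v : (v \in [set x; y] :\: source_set G O) = ~~ source v && ((v == x) || (v == y)).
  by rewrite inE in_sources !inE.
have nxt : x != t by rewrite -pos_eq tn; have := pos_le y; clear -xy; lia.
have nys : y != s by rewrite -pos_eq s1; have := pos_gt0 x; clear -xy; lia.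
have nx : x != s -> ~~ source x.
  by move=> nxs; apply/negP => /sourceP[] e; rewrite e eqxx in nxs nxt.
have ny : y != t -> ~~ source y.
  by move=> nyt; apply/negP => /sourceP[] e; rewrite e eqxx in nyt nys.
have nxy : x != y by rewrite -pos_eq ltn_eqF.
rewrite xs; have [xE|nxs] := eqVneq x s; have [yE|nyt] := eqVneq y t.
(* The empty flow. *)
- have -> : plabic_degree G O [set x; y] = 0.
    have hS : source_set G O :\: [set x; y] = set0.
      apply/setP => v; rewrite memS inE; apply/and3P => -[vx vy /sourceP[] e].
        by rewrite e xE eqxx in vx.
      by rewrite e yE eqxx in vy.
    have hT : [set x; y] :\: source_set G O = set0.
      apply/setP => v; rewrite memT inE; apply/andP => -[nv /orP[]/eqP e].
        by rewrite e xE ss in nv.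
      by rewrite e yE st in nv.
    apply: (@plabic_degree_min O _ set0) => //; last by rewrite /flow_degree big_set0.
    rewrite /is_flow hS hT; apply/and4P.
    by split; apply/forall_inP => v; rewrite inE.
  rewrite -sum_tot (chain_trivial sP) ?lP ?xE // (chain_trivial tQ) ?lQ ?yE //.
  by rewrite cs ct0 muln1 addn0.
- have hS : source_set G O :\: [set x; y] = [set t].
    apply/setP => v; rewrite memS inE; apply/and3P/eqP => [[vx vy /sourceP[] e]//|->].
      by rewrite e xE eqxx in vx.
    by rewrite eq_sym nxt eq_sym nyt.
  have hT : [set x; y] :\: source_set G O = [set y].
    apply/setP => v; rewrite memT inE; apply/andP/eqP => [[nv /orP[]/eqP e]//|->].
      by rewrite e xE ss in nv.
    by rewrite eqxx orbT ny.
  have P0 : P = [::] by apply: chain_trivial sP _; rewrite lP xE.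
  have nl : ~~ source (last t Q) by rewrite lQ ny.
  have [F fF dF] : exists2 F, is_flow G O [set x; y] F & flow_degree G F = chain_degree t Q.
    by apply: single_flow; rewrite ?lQ ?ny.
  rewrite (plabic_degree_min fF dF) -?sum_tot ?P0 ?cs ?muln1; first exact: addnC.
  move=> F' fF'; have [Q' [tQ' lQ' le]] := single_flow_ge st (ny nyt) hS hT fF'.
  apply: leq_trans le; have := @sum_chain_degree_ge s t [::] Q' ss st isT tQ'.
  rewrite lQ' [last _ _]/= -xE -sum_tot P0 xE cs leq_add2l; apply.
  by rewrite has_sym has_seq1; apply: (source_notin tQ' ss); rewrite eq_sym.
- have hS : source_set G O :\: [set x; y] = [set s].
    apply/setP => v; rewrite memS inE; apply/and3P/eqP => [[vx vy /sourceP[] e]//|->].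
      by rewrite e yE eqxx in vy.
    by rewrite eq_sym nxs eq_sym nys.
  have hT : [set x; y] :\: source_set G O = [set x].
    apply/setP => v; rewrite memT inE; apply/andP/eqP => [[nv /orP[]/eqP e]//|->].
      by rewrite e yE st in nv.
    by rewrite eqxx nx.
  have Q0 : Q = [::] by apply: chain_trivial tQ _; rewrite lQ yE.
  have nl : ~~ source (last s P) by rewrite lP nx.
  have [F fF dF] : exists2 F, is_flow G O [set x; y] F & flow_degree G F = chain_degree s P.
    by apply: single_flow; rewrite ?lP ?nx.
  rewrite (plabic_degree_min fF dF) -?sum_tot ?Q0 ?ct0 ?muln0 //.
  move=> F' fF'; have [P' [sP' lP' le]] := single_flow_ge ss (nx nxs) hS hT fF'.
  apply: leq_trans le; have := @sum_chain_degree_ge s t P' [::] ss st sP' isT.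
  rewrite lP' [last _ _]/= -yE -sum_tot Q0 yE ct0 !addn0; apply.
  by rewrite has_seq1; apply: (source_notin sP' st nst).
- have hS : source_set G O :\: [set x; y] = [set s; t].
    apply/setP => v; rewrite memS !inE; apply/and3P/orP => [[vx vy /sourceP[] ->]|[]/eqP ->].
    + by left.
    + by right.
    + by rewrite eq_sym nxs eq_sym nys.
    + by rewrite eq_sym nxt eq_sym nyt.
  have hT : [set x; y] :\: source_set G O = [set last s P; last t Q].
    apply/setP => v; rewrite memT !inE lP lQ; apply/andP/orP => [[_ /orP[]]|[]/eqP ->]; auto.
    + by rewrite eqxx nx.
    + by rewrite eqxx orbT ny.
  have [F fF dF] : exists2 F, is_flow G O [set x; y] F &
      flow_degree G F = chain_degree s P + chain_degree t Q.
    have nlP : ~~ source (last s P) by rewrite lP nx.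
    have nlQ : ~~ source (last t Q) by rewrite lQ ny.
    exact: double_flow sP tQ ss st nlP nlQ dis hS hT.
  rewrite (plabic_degree_min fF dF) -?sum_tot ?muln0 ?addn0 //.
  move=> F' fF'; rewrite lP lQ in hT.
  have [P' [Q' [sP' tQ' dis' ends le]]] := double_flow_ge ss st nst (nx nxs) (ny nyt) hS hT fF'.
  apply: leq_trans le; rewrite sum_tot; have := sum_chain_degree_ge ss st sP' tQ' dis'.
  case: ends => -[-> ->] //; by rewrite (eq_bigr _ (fun e _ => min_leftC e y x)).
Qed.

(** The degree of a vertex in the grading that compares the two weight vectors. *)
Definition vertex_weight (v : 'I_n) : nat :=
  \sum_(e in Dd) (2 * (pos v <= end_lo e) + (end_lo e < pos v <= end_hi e)).

(** For each diagonal, the contributions of [x] and [y] separate because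
    2 u v + [u <> v] = u + v for u and v in {0, 1}. *)
Lemma degrees_relation x y : x != y ->
  2 * plabic_degree G O [set x; y] + tree_degree Dd x y +
    2 * (n - 3) * ((pos x == 1) + (pos y == 1)) = vertex_weight x + vertex_weight y.
Proof.
wlog xy : x y / pos x < pos y => [W nxy|_].
  have [xy|yx|/pos_inj e] := ltngtP (pos x) (pos y); last by rewrite e eqxx in nxy.
    exact: W.
  have := W y x yx; rewrite eq_sym nxy setUC [(pos y == 1) + _]addnC => /(_ isT).
  rewrite [vertex_weight x + _]addnC => <-; congr (_ + _ + _); rewrite !tree_degreeE.
  by apply: eq_bigr => e _; rewrite eq_sym.
have -> : (pos y == 1) = false by have := pos_gt0 x; clear -xy; lia.
have := plabic_degreeE xy; move: (plabic_degree _ _ _) => w wE.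
have -> : 2 * w + tree_degree Dd x y + 2 * (n - 3) * ((pos x == 1) + false) =
    2 * (w + (n - 3) * (pos x == 1)) + tree_degree Dd x y.
  by rewrite addn0 mulnDr mulnA addnAC.
rewrite wE tree_degreeE big_distrr /= -!big_split /=; apply: eq_bigr => e _.
by rewrite /min_left; do 2 case: (_ <= end_lo e); do 2 case: (_ < _ <= _).
Qed.

End Flows.
End Triangulated.

(** * Initial ideals of graded ideals *)

Import Order.TTheory GRing.Theory Num.Theory.
Local Open Scope ring_scope.

Section Graded.
Variables (R : realType) (N : nat).
Implicit Types (f g : {mpoly R[i][N]}) (w gam : 'I_N -> R) (m : 'X_{1..N}).

Definition graded_part gam (r : R) f : {mpoly R[i][N]} :=
  \sum_(m <- msupp f | mweight gam m == r) f@_m *: 'X_[m].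

Lemma mcoeff_sum_supp (P : pred 'X_{1..N}) f m :
  (\sum_(m' <- msupp f | P m') f@_m' *: 'X_[m'])@_m = if P m then f@_m else 0.
Proof.
rewrite raddf_sum /= (eq_bigr (fun m' => f@_m' * (m' == m)%:R)); last first.
  by move=> m' _; rewrite mcoeffZ mcoeffX.
case mf: (m \in msupp f); last first.
  rewrite big1_seq; first by rewrite memN_msupp_eq0 ?mf // if_same.
  move=> m' /andP[_ m'f]; case: eqP => [mm'|_]; last by rewrite mulr0.
  by rewrite -mm' m'f in mf.
rewrite big_mkcond (bigD1_seq m) //= eqxx mulr1 big1 ?addr0 // => m' m'm.
by rewrite (negPf m'm) mulr0 if_same.
Qed.

Lemma graded_partE gam r f m :
  (graded_part gam r f)@_m = if mweight gam m == r then f@_m else 0.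
Proof. exact: mcoeff_sum_supp. Qed.

Lemma initial_formE w f m : (initial_form w f)@_m =
  if all (fun m' => mweight w m <= mweight w m') (msupp f) then f@_m else 0.
Proof. exact: mcoeff_sum_supp. Qed.

Lemma graded_part_is_linear gam r : linear (graded_part gam r).
Proof.
move=> a f g; apply/mpolyP => m; rewrite mcoeffD mcoeffZ !graded_partE mcoeffD mcoeffZ.
by case: ifP; rewrite ?mulr0 ?addr0.
Qed.

HB.instance Definition _ gam r :=
  GRing.isLinear.Build R[i] {mpoly R[i][N]} {mpoly R[i][N]} _
    (graded_part gam r) (graded_part_is_linear gam r).

Definition homogeneous gam f :=
  exists r, forall m, m \in msupp f -> mweight gam m = r.

Lemma mweightD w m1 m2 : mweight w (m1 + m2)%MM = mweight w m1 + mweight w m2.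
Proof.
rewrite /mweight -big_split /=; apply: eq_bigr => k _.
by rewrite mnmDE natrD mulrDl.
Qed.

Lemma mweight1 w k : mweight w U_(k)%MM = w k.
Proof.
rewrite /mweight (bigD1 k) //= mnm1E eqxx mul1r big1 ?addr0 // => j jk.
by rewrite mnm1E eq_sym (negPf jk) mul0r.
Qed.

Lemma graded_part_homogeneous gam f r : homogeneous gam f ->
  graded_part gam r f = f \/ graded_part gam r f = 0.
Proof.
move=> [s fs]; case: (eqVneq s r) => [<-|sr]; [left|right]; apply/mpolyP => m;
  rewrite graded_partE ?mcoeff0; case: ifP => // /eqP.
- by move=> ms; rewrite memN_msupp_eq0 //; apply/negP => /fs.
- move=> mr; rewrite memN_msupp_eq0 //; apply/negP => /fs sm.
  by rewrite -sm mr eqxx in sr.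
Qed.

Lemma homogeneousMX gam f m : homogeneous gam f -> homogeneous gam ('X_[m] * f).
Proof.
move=> [r fr]; exists (mweight gam m + r) => m'.
move=> /msuppM_le /allpairsP [[m1 m2] /= [m1X m2f ->]].
rewrite msuppX inE in m1X; rewrite mweightD (fr _ m2f).
by move/eqP: m1X => ->.
Qed.

Lemma ideal_generated0 (A : comNzRingType) (S : A -> Prop) : ideal_generated S 0.
Proof. by exists [::]; rewrite big_nil. Qed.

Lemma ideal_generatedD (A : comNzRingType) (S : A -> Prop) x y :
  ideal_generated S x -> ideal_generated S y -> ideal_generated S (x + y).
Proof.
move=> [s [Ss ->]] [t [St ->]]; exists (s ++ t); split; last by rewrite big_cat.
by move=> u; rewrite mem_cat => /orP[/Ss|/St].
Qed.

Lemma ideal_generatedM (A : comNzRingType) (S : A -> Prop) a x :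
  ideal_generated S x -> ideal_generated S (a * x).
Proof.
move=> [s [Ss ->]]; exists [seq (a * u.1, u.2) | u <- s]; split.
  by move=> u /mapP[v /Ss Sv ->].
by rewrite big_map mulr_sumr; apply: eq_bigr => u _; rewrite mulrA.
Qed.

Lemma ideal_generated_mem (A : comNzRingType) (S : A -> Prop) x :
  S x -> ideal_generated S x.
Proof.
move=> Sx; exists [:: (1, x)]; rewrite big_seq1 mul1r; split=> // u.
by rewrite inE => /eqP ->.
Qed.

Lemma ideal_generated_sum (A : comNzRingType) (S : A -> Prop) (J : eqType)
    (s : seq J) (F : J -> A) :
  (forall j, j \in s -> ideal_generated S (F j)) ->
  ideal_generated S (\sum_(j <- s) F j).
Proof.
move=> SF; rewrite big_seq; apply: big_ind => //; first exact: ideal_generated0.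
exact: ideal_generatedD.
Qed.

(** Every element of the ideal is a sum of products of a monomial and a generator, and
    these products are homogeneous. *)
Lemma ideal_generated_graded gam (S : {mpoly R[i][N]} -> Prop) f r :
  (forall g, S g -> homogeneous gam g) ->
  ideal_generated S f -> ideal_generated S (graded_part gam r f).
Proof.
move=> hS [s [Ss ->]]; rewrite raddf_sum; apply: ideal_generated_sum => -[h g] /Ss /= Sg.
rewrite {1}[h]mpolyE mulr_suml raddf_sum; apply: ideal_generated_sum => m _.
rewrite -scalerAl -[X in ideal_generated _ X]/(graded_part gam r _) linearZ /=.
rewrite -mul_mpolyC; apply: ideal_generatedM.
have [->|->] := graded_part_homogeneous r (homogeneousMX m (hS g Sg)).
- exact/ideal_generatedM/ideal_generated_mem.
- exact: ideal_generated0.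
Qed.

Lemma mweight_affine w w' gam c m : (forall k, w' k = c * w k + gam k) ->
  mweight w' m = c * mweight w m + mweight gam m.
Proof.
move=> ww'; rewrite /mweight mulr_sumr -big_split /=; apply: eq_bigr => k _.
by rewrite ww' mulrDr mulrCA.
Qed.

Lemma initial_form_affine w w' gam c f : 0 < c ->
  (forall k, w' k = c * w k + gam k) -> homogeneous gam f ->
  initial_form w' f = initial_form w f.
Proof.
move=> c0 ww' [r fr]; apply/mpolyP => m; rewrite !initial_formE.
case mf: (m \in msupp f); last by rewrite (memN_msupp_eq0 (negbT mf)) !if_same.
congr (if _ then _ else _); apply: eq_in_all => m' m'f.
by rewrite !(mweight_affine _ ww') !fr // lerD2r ler_pM2l.
Qed.

(** The initial form of a polynomial is the sum of the initial forms of those of its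
    graded parts which reach the minimal weight; on a graded part the two weights differ by a
    positive factor and a constant. *)
Lemma initial_ideal_affine w w' gam c (I : {mpoly R[i][N]} -> Prop) f :
  0 < c -> (forall k, w' k = c * w k + gam k) ->
  (forall g r, I g -> I (graded_part gam r g)) ->
  initial_ideal w I f -> initial_ideal w' I f.
Proof.
move=> c0 ww' Igr [s [Ss ->]]; apply: ideal_generated_sum => -[h g] /Ss /= [g' Ig' ->].
apply: ideal_generatedM; pose lead := [seq m <- msupp g' |
  all (fun m' => mweight w m <= mweight w m') (msupp g')].
have -> : initial_form w g' = \sum_(r <- undup (map (mweight gam) lead))
    initial_form w (graded_part gam r g').
  apply/mpolyP => m; rewrite initial_formE raddf_sum /=.
  have grm r : mweight gam m != r -> (initial_form w (graded_part gam r g'))@_m = 0.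
    by rewrite initial_formE graded_partE => /negPf ->; rewrite if_same.
  have supp_gr r m' : (m' \in msupp (graded_part gam r g')) =
      (mweight gam m' == r) && (m' \in msupp g').
    by rewrite !mcoeff_msupp graded_partE; case: (_ == r); rewrite ?eqxx.
  have lead_gr m0 : m0 \in lead -> mweight gam m0 = mweight gam m ->
      all (fun m' => mweight w m <= mweight w m')
        (msupp (graded_part gam (mweight gam m) g')) ->
      mweight w m <= mweight w m0.
    rewrite mem_filter => /andP[_ m0g] e /allP -> //.
    by rewrite supp_gr e eqxx.
  case: ifPn => ml; last first.
    rewrite big1_seq // => r /andP[_]; rewrite mem_undup => /mapP[m0 m0l rE].
    have [mr|/grm//] := eqVneq (mweight gam m) r.
    rewrite initial_formE; case: ifPn => // al; rewrite graded_partE mr eqxx.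
    rewrite -mr in al; have m0m := lead_gr _ m0l (etrans (esym rE) (esym mr)) al.
    move: m0l; rewrite mem_filter => /andP[/allP m0l _].
    case/negP: ml; apply/allP => m' /m0l; exact: le_trans.
  case mg: (m \in msupp g'); last first.
    rewrite memN_msupp_eq0 ?mg // big1_seq // => r _.
    rewrite initial_formE graded_partE (memN_msupp_eq0 (negbT mg)) if_same.
    by rewrite if_same.
  rewrite (bigD1_seq (mweight gam m)) ?undup_uniq //=; last first.
    by rewrite mem_undup; apply: map_f; rewrite mem_filter ml mg.
  rewrite big1 ?addr0; last by move=> r mr; apply: grm; rewrite eq_sym.
  rewrite initial_formE graded_partE eqxx; case: ifPn => // /negP[].
  by apply/allP => m'; rewrite supp_gr => /andP[_ /(allP ml)].
apply: ideal_generated_sum => r _; apply: ideal_generated_mem.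
exists (graded_part gam r g'); first exact: Igr.
symmetry; apply: initial_form_affine c0 ww' _; exists r => m.
by rewrite mcoeff_msupp graded_partE; case: ifP => [/eqP|]; rewrite ?eqxx.
Qed.

End Graded.

(** * The two degenerations *)

(** The three terms of a Plücker relation have the same four indices. *)
Lemma plucker_ideal_graded (R : realType) n (B : 'I_n -> R) r f :
  let gam k := let p := val (enum_val k : plucker_index n) in B p.1 + B p.2 in
  plucker_ideal f -> @plucker_ideal R n (graded_part gam r f).
Proof.
move=> gam; apply: ideal_generated_graded => g [i [j [k [l [ij jk kl ->]]]]].
have XE (x y : 'I_n) : (x < y)%N -> exists2 h : 'I_(nplucker n),
    plucker R x y = 'X_h & gam h = B x + B y.
  move=> xy; rewrite /plucker; case: insubP => [p _ pE|]; last by rewrite /= xy.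
  by exists (enum_rank (p : plucker_index n)); rewrite // /gam enum_rankK pE.
have ik := ltn_trans ij jk; have jl := ltn_trans jk kl; have il := ltn_trans ij jl.
have [a1 -> e1] := XE _ _ ij; have [a2 -> e2] := XE _ _ kl.
have [a3 -> e3] := XE _ _ ik; have [a4 -> e4] := XE _ _ jl.
have [a5 -> e5] := XE _ _ il; have [a6 -> e6] := XE _ _ jk.
rewrite -!mpolyXD; exists (B i + B j + B k + B l) => m.
move=> /msuppD_le; rewrite mem_cat => /orP[/msuppB_le|]; rewrite ?mem_cat.
  case/orP; rewrite msuppX inE => /eqP ->; rewrite mweightD !mweight1.
    by rewrite e1 e2 !addrA.
  by rewrite e3 e4 !addrA (addrAC (B i) (B k)).
rewrite msuppX inE => /eqP ->; rewrite mweightD !mweight1 e5 e6 !addrA.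
by rewrite (addrAC (B i) (B l)) (addrAC _ (B l)).
Qed.

Theorem theorem4p6 (R : realType) (n : nat) (hn : (4 <= n)%N)
    (Dd : {set {set 'I_n}}) (hDd : triangulation Dd)
    (O : {set pre_dart n})
    (hO : perfect_orientation (plabic_graph Dd) O)
    (hsrc : source_set (plabic_graph Dd) O = [set i : 'I_n | (i < 2)%N])
    (f : plucker_ring R n) :
  initial_ideal (fun k => - tree_weight R Dd k) (@plucker_ideal R n) f <->
  initial_ideal (plabic_weight R Dd O) (@plucker_ideal R n) f.
Proof.
pose B (v : 'I_n) : R := (vertex_weight Dd v)%:R - (2 * (n - 3) * (pos v == 1%N))%:R.
have two0 : 0 < 2%:R :> R by rewrite ltr0n.
have rel k : 2 * plabic_weight R Dd O k = - tree_weight R Dd k +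
    (B (val (enum_val k : plucker_index n)).1 + B (val (enum_val k : plucker_index n)).2).
  rewrite /plabic_weight /tree_weight; case: (enum_val k) => -[x y] /= xy.
  have nxy : x != y by rewrite -val_eqE /= ltn_eqF.
  have /(congr1 (fun a => a%:R : R)) := degrees_relation hn hDd hO hsrc nxy.
  rewrite /B mulnDr !natrD natrM => e.
  by rewrite addrACA -e; ring.
split.
- apply: (initial_ideal_affine (c := 2^-1) (gam := fun k =>
    let p := val (enum_val k : plucker_index n) in B p.1 / 2 + B p.2 / 2)).
  + by rewrite invr_gt0.
  + by move=> k; have := rel k; rewrite /=; lra.
  + by move=> g r; exact: (plucker_ideal_graded (fun v => B v / 2)).
- apply: (initial_ideal_affine (c := 2) (gam := fun k =>
    let p := val (enum_val k : plucker_index n) in - B p.1 + - B p.2)) => //.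
  + by move=> k; have := rel k; rewrite /=; lra.
  + by move=> g r; exact: (plucker_ideal_graded (fun v => - B v)).
Qed.
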